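(* For every $p \in [1,\infty]$ with $p \neq 2$ there exists a constant $c_p > 0$, depending only on $p$, such that for every integer $n \ge 1$ and every vector $a = (a_1, \ldots, a_n) \in \mathbb{R}^n$ with $\sum_{i=1}^n a_i^2 = 1$ and $a_1 \ge a_2 \ge \ldots \ge a_n \ge 0$ the following hold: (a) if $2 < p \le \infty$, then $$\frac{\mathrm{vol}_{n-1}\left(\mathrm{Proj}_{a^{\perp}}B_p^n\right)}{\mathrm{vol}_{n-1}\left(\mathrm{Proj}_{a_{(1)}^{\perp}}B_p^n\right)} \ge 1 + c_p\left|a - a_{(1)}\right|^2;$$ (b) if $p = \infty$, then $$\frac{\mathrm{vol}_{n-1}\left(\mathrm{Proj}_{a^{\perp}}B_\infty^n\right)}{\mathrm{vol}_{n-1}\left(\mathrm{Proj}_{a_{(n)}^{\perp}}B_\infty^n\right)} \le 1 - \frac{c_{\infty}}{n}\sum_{i, j = 1}^n\left(a_i - a_j\right)^2;$$ (c) if $2 < p < \infty$, then $$\frac{\mathrm{vol}_{n-1}\left(\mathrm{Proj}_{a^{\perp}}B_p^n\right)}{\mathrm{vol}_{n-1}\left(\mathrm{Proj}_{a_{(n)}^{\perp}}B_p^n\right)} \le 1 - c_p\sum_{i=1}^n\left(a_i^2 - \frac{1}{n}\right)^2;$$ (d) if $1 \le p < 2$, then $$\frac{\mathrm{vol}_{n-1}\left(\mathrm{Proj}_{a^{\perp}}B_p^n\right)}{\mathrm{vol}_{n-1}\left(\mathrm{Proj}_{a_{(1)}^{\perp}}B_p^n\right)} \le 1 - c_p\left|a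 - a_{(1)}\right|^2.$$
   Context: For $1 \le p \le \infty$, $B_p^n = \{x \in \mathbb{R}^n : \|x\|_p \le 1\}$ is the closed unit ball of the standard $\ell_p^n$ norm on $\mathbb{R}^n$. Let $e_1, \ldots, e_n$ be the standard orthonormal basis of $\mathbb{R}^n$; for $1 \le k \le n$ put $a_{(k)} = \frac{1}{\sqrt{k}}\sum_{i=1}^k e_i$. For a nonzero $a \in \mathbb{R}^n$, $a^\perp$ is the linear hyperplane orthogonal to $a$, and $\mathrm{Proj}_{a^\perp}K$ is the image of $K \subseteq \mathbb{R}^n$ under the orthogonal projection onto $a^\perp$. $\mathrm{vol}_{n-1}$ denotes $(n-1)$-dimensional Lebesgue measure on the hyperplane (for $n=1$ it is the counting measure on the one-point space). $|\cdot|$ is the Euclidean norm on $\mathbb{R}^n$. *)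

(* Defs.v *)
From HB Require Import structures.
From mathcomp Require Import all_boot all_order all_algebra.
From mathcomp Require Import all_classical all_reals all_analysis.
From mathcomp Require Import ring.

Set Implicit Arguments.
Unset Strict Implicit.
Unset Printing Implicit Defensive.
Import Order.TTheory GRing.Theory Num.Theory.
Import numFieldNormedType.Exports.

Local Open Scope classical_set_scope.
Local Open Scope ring_scope.

(* Vectors of R^n are row vectors. The library norm `|x| on 'rV[R]_n
   is the sup norm, hence the explicit Euclidean norm. *)
Definition dot (R : realType) n (x y : 'rV[R]_n) : R :=
  \sum_(i < n) x 0 i * y 0 i.

Definition enorm (R : realType) n (x : 'rV[R]_n) : R := Num.sqrt (dot x x).

(* Only meant for 1 <= p; the branch p = -oo is a dummy. *)
Definition lpnorm (R : realType) (p : \bar R) n (x : 'rV[R]_n) : R :=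
  match p with
  | r%:E => (\sum_(i < n) `|x 0 i| `^ r) `^ r^-1
  | +oo%E => \big[Num.max/0]_(i < n) `|x 0 i|
  | -oo%E => 0
  end.

Definition lpball (R : realType) (p : \bar R) n : set 'rV[R]_n :=
  [set x | lpnorm p x <= 1].
Arguments lpball {R} p n _.

(* a_(k) = k^(-1/2) (e_1 + ... + e_k); coordinates are numbered from 0. *)
Definition adiag (R : realType) n (k : nat) : 'rV[R]_n :=
  (Num.sqrt k%:R)^-1 *: \sum_(i < n | (i < k)%N) delta_mx 0 i.

Definition orthoproj (R : realType) n (a x : 'rV[R]_n) : 'rV[R]_n :=
  x - (dot x a / dot a a) *: a.

(* Lebesgue measure on R^n.+1 from a measure m on R^n: the image of the product
   of Lebesgue measure on R with m under (x, t) |-> x :: t. *)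
Section lebesgue_cons.
Variables (R : realType) (n : nat).
Variable m : {sigma_finite_measure set (n.-tuple R) -> \bar R}.

Definition cons_tuple_pair (x : R * n.-tuple R) : n.+1.-tuple R :=
  [tuple of x.1 :: x.2].

Let measurable_cons_pair : measurable_fun [set: R * n.-tuple R] cons_tuple_pair.
Proof. exact: measurable_cons. Qed.

Definition lebesgue_cons : set (n.+1.-tuple R) -> \bar R :=
  pushforward (@lebesgue_measure R \x m)%E cons_tuple_pair.

Let lebesgue_cons0 : lebesgue_cons set0 = 0%E.
Proof. by rewrite /lebesgue_cons /pushforward preimage_set0 measure0. Qed.

Let lebesgue_cons_ge0 A : (0 <= lebesgue_cons A)%E.
Proof. exact: measure_ge0. Qed.

Let lebesgue_cons_sigma_additive : semi_sigma_additive lebesgue_cons.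
Proof.
exact: (@measure_semi_sigma_additive _ _ _
  [the measure _ _ of pushforward _ _]).
Qed.

HB.instance Definition _ := isMeasure.Build _ _ _ lebesgue_cons
  lebesgue_cons0 lebesgue_cons_ge0 lebesgue_cons_sigma_additive.

Let lebesgue_cons_sigma_finite : sigma_finite setT lebesgue_cons.
Proof.
have /sigma_finiteP[F [TF ndF Foo]] := sigma_finiteT (@lebesgue_measure R).
have /sigma_finiteP[G [TG ndG Goo]] := sigma_finiteT m.
pose C k : set (n.+1.-tuple R) :=
  (fun t => F k (thead t)) `&` (fun t => G k [tuple of behead t]).
exists C => [|k].
  apply/esym; rewrite -subTset => t _.
  have : setT (thead t) by []. rewrite TF => -[i _ Fi].
  have : setT ([tuple of behead t] : n.-tuple R) by []. rewrite TG => -[j _ Gj].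
  exists (maxn i j) => //; split.
  - by move: Fi; exact/subsetPset/ndF/leq_maxl.
  - by move: Gj; exact/subsetPset/ndG/leq_maxr.
have [mF Fk] := Foo k; have [mG Gk] := Goo k; split.
  apply: measurableI; rewrite -[X in measurable X]setTI.
  - exact: (measurable_tnth ord0).
  - exact: measurable_behead.
rewrite /lebesgue_cons /pushforward (_ : _ @^-1` _ = F k `*` G k).
  by rewrite product_measure1E// lte_mul_pinfty// ge0_fin_numE.
rewrite /C; apply/seteqP; split => -[x t] /= [Fx Gt]; split => //.
- by move: Gt; congr (G k _); apply/val_inj.
- by rewrite /= (_ : [tuple of _] = t) //; apply/val_inj.
Qed.

HB.instance Definition _ := Measure_isSigmaFinite.Build _ _ _ lebesgue_cons
  lebesgue_cons_sigma_finite.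

End lebesgue_cons.

Fixpoint lebesgue_tuple (R : realType) (n : nat) :
    {sigma_finite_measure set (n.-tuple R) -> \bar R} :=
  match n with
  | 0 => \d_([tuple] : 0.-tuple R)
  | k.+1 => lebesgue_cons (lebesgue_tuple R k)
  end.

Lemma lebesgue_tuple_box (R : realType) n (A : 'I_n -> set R) :
  (forall i, measurable (A i)) ->
  lebesgue_tuple R n [set t | forall i, A i (tnth t i)] =
  (\prod_(i < n) lebesgue_measure (A i))%E.
Proof.
elim: n A => [|n IH] A mA.
  by rewrite big_ord0 /= diracE mem_set// => -[].
rewrite big_ord_recl -IH//.
have mB : measurable [set t : n.-tuple R | forall i, A (lift ord0 i) (tnth t i)].
  rewrite (_ : mkset _ = \bigcap_(i in [set: 'I_n])
    ((fun t : n.-tuple R => tnth t i) @^-1` A (lift ord0 i))).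
    apply: fin_bigcap_measurable => // i _.
    by rewrite -[X in measurable X]setTI; exact: measurable_tnth.
  by apply/seteqP; split=> [t h i _|t h i]; exact: h.
rewrite -product_measure1E//; last exact: mA.
apply: (congr1 (product_measure1 (@lebesgue_measure R) (lebesgue_tuple R n))).
apply/seteqP; split=> -[x t] /= => [h|[Ax h] i].
  by split=> [|i]; [exact: (h ord0)|have := h (lift ord0 i); rewrite tnthS].
by have [j ->|->] := unliftP ord0 i => //; rewrite tnthS.
Qed.

(* The rows of U form an orthonormal basis of the hyperplane orthogonal to a. *)
Definition orthonormal_hyperplane_basis (R : realType) n (a : 'rV[R]_n)
    (U : 'M[R]_(n.-1, n)) : Prop :=
  U *m U^T = 1%:M /\ U *m a^T = 0.

Definition hyperplane_basis (R : realType) n (a : 'rV[R]_n) : 'M[R]_(n.-1, n) :=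
  xget 0 (orthonormal_hyperplane_basis a : set _).

(* (n-1)-dimensional Lebesgue measure on the hyperplane orthogonal to a != 0:
   R^(n-1) is identified with the hyperplane by the linear isometry given by an
   orthonormal basis. The choice of the basis is immaterial as Lebesgue measure
   is invariant under orthogonal transformations. For n = 1 this is the Dirac
   (i.e., counting) measure on the one-point space. *)
Definition vol_hyperplane (R : realType) n (a : 'rV[R]_n) (A : set 'rV[R]_n) :
    \bar R :=
  lebesgue_tuple R n.-1
    [set t | A ((\row_(i < n.-1) tnth t i) *m hyperplane_basis a)].

Definition projvol (R : realType) (p : \bar R) n (a : 'rV[R]_n) : \bar R :=
  vol_hyperplane a (orthoproj a @` lpball p n).


Lemma householder_orthogonal (R : realType) n (v : 'rV[R]_n) :
  v *m v^T != 0 ->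
  let H := 1%:M - (2 / dot v v) *: (v^T *m v) in H *m H^T = 1%:M.
Proof.
have vvE : v *m v^T = (dot v v)%:M.
  by rewrite [LHS]mx11_scalar mxE; congr (_%:M); apply: eq_bigr => i _; rewrite mxE.
rewrite vvE => v0 /=; set d := dot v v in v0 *.
have {}v0 : d != 0 by apply: contraNneq v0 => ->; rewrite raddf0.
have -> : (1%:M - (2 / d) *: (v^T *m v))^T = 1%:M - (2 / d) *: (v^T *m v).
  by apply/matrixP => i j; rewrite !mxE eq_sym !big_ord1 !mxE [v 0 i * _]mulrC.
rewrite mulmxBl mul1mx mulmxBr mulmx1 -scalemxAl -scalemxAr.
rewrite -mulmxA [v *m (_ *m _)]mulmxA vvE mul_scalar_mx -scalemxAr !scalerA.
rewrite (_ : 2 / d * (2 / d * _) = 2 / d + 2 / d); last by rewrite -/d; field.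
by rewrite scalerDl; apply/matrixP => i j; rewrite !mxE; ring.
Qed.

Lemma orthonormal_hyperplane_basis_exists (R : realType) n (a : 'rV[R]_n) :
  a != 0 -> exists U, orthonormal_hyperplane_basis a U.
Proof.
case: n a => [a|n a a0]; first by rewrite thinmx0 eqxx.
have aa0 : 0 < dot a a.
  rewrite lt0r sumr_ge0 ?andbT; last by move=> i _; rewrite -expr2 sqr_ge0.
  apply: contraNneq a0 => /eqP; rewrite psumr_eq0; last first.
    by move=> i _; rewrite -expr2 sqr_ge0.
  move=> /allP h; apply/eqP/rowP => i; rewrite mxE; apply/eqP.
  by have := h i (mem_index_enum _); rewrite /= mulf_eq0 orbb.
pose s := Num.sqrt (dot a a); pose b := s^-1 *: a.
have s0 : s != 0 by rewrite gt_eqF// sqrtr_gt0.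
have ab : a = s *: b by rewrite scalerA divff// scale1r.
have bb : \sum_i b 0 i ^+ 2 = 1.
  rewrite (eq_bigr (fun i => s ^- 2 * (a 0 i * a 0 i))); last first.
    by move=> i _; rewrite mxE exprMn exprVn expr2.
  rewrite -mulr_sumr -/(dot a a) -[dot a a]sqr_sqrtr ?ltW// mulVf// expf_neq0//.
clearbody b.
suff [H [HH Hb]] : exists H : 'M[R]_n.+1, H *m H^T = 1%:M /\ row ord0 H = b.
  have rU i j : \sum_l H i l * H j l = (i == j)%:R.
    have /matrixP/(_ i j) := HH; rewrite !mxE => <-.
    by apply: eq_bigr => l _; rewrite mxE.
  exists (row' ord0 H); split.
    apply/matrixP => i j; rewrite !mxE.
    rewrite (eq_bigr (fun l => H (lift ord0 i) l * H (lift ord0 j) l)); last first.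
      by move=> l _; rewrite !mxE.
    by rewrite rU (inj_eq lift_inj).
  rewrite ab -Hb; apply/matrixP => i j; rewrite !mxE.
  rewrite (eq_bigr (fun l => s * (H (lift ord0 i) l * H ord0 l))); last first.
    by move=> l _; rewrite !mxE mulrCA.
  by rewrite -mulr_sumr rU mulr0.
pose e : 'rV[R]_n.+1 := delta_mx 0 ord0.
have [be|be] := eqVneq b e.
  exists 1%:M; rewrite trmx1 mulmx1; split=> //.
  by rewrite be; apply/rowP => i; rewrite !mxE eqxx/= eq_sym.
pose v := b - e.
have vv : dot v v = 2 * (1 - b 0 ord0).
  rewrite /dot (eq_bigr (fun i => b 0 i ^+ 2 + (1 - 2 * b 0 ord0) * (i == ord0)%:R)).
    rewrite big_split/= bb -mulr_sumr (bigD1 ord0)//= big1 ?addr0; last first.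
      by move=> i /negPf ->.
    by ring.
  move=> i _; rewrite !mxE eqxx/=; have [->|_] := eqVneq i ord0; rewrite ?eqxx /=; ring.
have v0 : dot v v != 0.
  apply: contra be; rewrite psumr_eq0; last by move=> i _; rewrite -expr2 sqr_ge0.
  move=> /allP h; rewrite -subr_eq0; apply/eqP/rowP => i; rewrite [RHS]mxE.
  by apply/eqP; have := h i (mem_index_enum _); rewrite /= mulf_eq0 orbb.
exists (1%:M - (2 / dot v v) *: (v^T *m v)); split.
  apply: (@householder_orthogonal _ _ v); apply: contra v0 => /eqP/matrixP/(_ 0 0).
  rewrite [LHS]mxE [RHS]mxE => vv0; apply/eqP; apply: etrans vv0.
  by apply: eq_bigr => i _; rewrite [v^T _ _]mxE.
apply/rowP => i; rewrite !mxE big_ord1 !mxE eqxx/= vv.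
rewrite vv mulf_eq0 negb_or in v0; have /andP[_ v1] := v0.
by rewrite [ord0 == i]eq_sym; field.
Qed.

Lemma hyperplane_basisP (R : realType) n (a : 'rV[R]_n) :
  a != 0 -> orthonormal_hyperplane_basis a (hyperplane_basis a).
Proof.
by move=> /orthonormal_hyperplane_basis_exists[U aU]; exact: (xgetI _ aU).
Qed.

(* Main.v *)
Require Import Defs.
From HB Require Import structures.
From mathcomp Require Import all_boot all_order all_algebra.
From mathcomp Require Import all_classical all_reals all_analysis.
From mathcomp Require Import measurable_realfun ring lra.

Set Implicit Arguments.
Unset Strict Implicit.
Unset Printing Implicit Defensive.
Import Order.TTheory GRing.Theory Num.Theory.
Import numFieldNormedType.Exports.

Local Open Scope classical_set_scope.
Local Open Scope ring_scope.

(* For finite p, Cauchy's formula makes the ratio of projection volumes a ratio of first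
   absolute moments of S = sum_i a_i Y_i, where the Y_i are independent copies of
   sgn(x) |x|^(p-1) with x distributed with density proportional to exp(-|x|^p). For
   p = oo the volume is 2^(n-1) sum_i a_i, which settles the cube by elementary algebra.
   For p > 2, Y is a Gaussian scale mixture, so its characteristic function is a Laplace
   transform at t^2, hence log-convex in t^2 and strictly so near 0; comparing
   prod_i E cos(t a_i Y) with the products for a_(1) and a_(n), and integrating in
   E|S| = K int (1 - E cos(t S)) / t^2 dt, gives both quantitative bounds.
   For p < 2 the mixture goes the other way: a Gaussian with the same E|.| satisfies
   E|x + aY| <= E|x + aG|, with a gain quadratic in x near 0. Replacing the Y_i by
   Gaussians one at a time gives E|S| <= E|Y|; the gain comes from the largest coordinate
   if a_1 >= 1/2, and from a proportion of the replacement steps otherwise. *)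

(** * Linear images of Lebesgue measure *)

(** Cauchy's formula is used without surface measure. Along a line parallel to [a] the weight
    exp(-|x|_p^p) is unimodal, so its absolute derivative integrates to twice its maximum exp(-v),
    with v the least value of |x|_p^p on the line. Slicing by v gives the volume of the projection
    times a factor free of [a], while the same integral over R^n is an expectation over independent
    coordinates. The mixing laws are never constructed: [Ew_mixture] transfers the sign of an
    expectation from an exponent p to a larger q for every continuous even test function of moderate
    growth, and log-convexity, its defect and the comparison for 1 < p < 2 are choices of test
    function. Gains are additive terms in first moments; the constants are independent of n because
    these moments are bounded in terms of p alone. For p > 2 strictness is the positive variance of
    the mixing law, that is E Y^4 > 3 (E Y^2)^2. For p < 2 the gain of order a_i^2 of a replacement
    step is secured only while the partial sum is bounded, so the gains are collected through a
    potential controlled by the second moment. *)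

Lemma measurable_affine (R : realType) (a b : R) :
  measurable_fun [set: R] (fun x : R => a * x + b).
Proof. by apply: measurable_funD => //; apply: measurable_funM. Qed.

(** Lebesgue measure is determined by its values on half-open intervals. For [a < 0] the preimage of
    ]u, v] is closed on the left instead of the right, which does not change its length. *)
Lemma lebesgue_measure_affine (R : realType) (a b : R) (A : set R) :
  a != 0 -> measurable A ->
  (`|a|%:E * lebesgue_measure ((fun x : R => (a * x + b)%R) @^-1` A) =
   lebesgue_measure A)%E.
Proof.
move=> a0 mA.
pose f : measurableTypeR R -> measurableTypeR R := fun x : R => a * x + b.
have mf : measurable_fun (setT : set (measurableTypeR R)) f.
  exact: measurable_affine.
pose F : {mfun measurableTypeR R >-> measurableTypeR R} :=
  HB.pack f (isMeasurableFun.Build _ _ _ _ _ mf).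
pose r : {nonneg R} := NngNum (normr_ge0 a).
pose m : {measure set (measurableTypeR R) -> \bar R} :=
  mscale r (pushforward (@lebesgue_measure R) F).
apply/esym/(lebesgue_measure_unique (mu := m mf)) => //.
move=> _ [[u v] _ <-] /=.
rewrite /m /mscale /= /pushforward.
have [a_gt0|a_lt0] : 0 < a \/ a < 0 by case: (ltgtP a 0) a0 => //; [right|left].
- rewrite (_ : _ @^-1` _ = `](u - b) / a, (v - b) / a]%classic); last first.
    apply/seteqP; split => x /=; rewrite !in_itv/= /f ltr_pdivrMr// ler_pdivlMr//;
    by rewrite ltrBlDr lerBrDr [x * a]mulrC.
  rewrite !lebesgue_measure_itv/= !lte_fin ltr_pM2r ?invr_gt0// ltrD2r.
  case: ifPn => _; last by rewrite mule0.
  by rewrite !EFinN -!EFinD -EFinM gtr0_norm//; congr EFin; field.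
- rewrite (_ : _ @^-1` _ = `[(v - b) / a, (u - b) / a[%classic); last first.
    apply/seteqP; split => x /=; rewrite !in_itv/= /f ltr_ndivlMr// ler_ndivrMr//;
    by rewrite andbC ltrBlDr lerBrDr [x * a]mulrC.
  rewrite !lebesgue_measure_itv/= !lte_fin ltr_nM2r ?invr_lt0// ltrD2r.
  case: ifPn => _; last by rewrite mule0.
  by rewrite !EFinN -!EFinD -EFinM ltr0_norm//; congr EFin; field.
Qed.

Lemma ge0_integral_affine (R : realType) (a b : R) (f : R -> \bar R) :
  a != 0 -> measurable_fun setT f -> (forall x, 0 <= f x)%E ->
  (`|a|%:E * (\int[@lebesgue_measure R]_x f (a * x + b)%R) =
   \int[@lebesgue_measure R]_x f x)%E.
Proof.
move=> a0 mf f0.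
pose g : measurableTypeR R -> measurableTypeR R := fun x : R => a * x + b.
have mg : measurable_fun (setT : set (measurableTypeR R)) g.
  exact: measurable_affine.
pose F : {mfun measurableTypeR R >-> measurableTypeR R} :=
  HB.pack g (isMeasurableFun.Build _ _ _ _ _ mg).
pose r : {nonneg R} := NngNum (normr_ge0 a).
pose m : {measure set (measurableTypeR R) -> \bar R} :=
  mscale r (pushforward (@lebesgue_measure R) F).
transitivity (\int[m mg]_x f x)%E; last first.
  apply: eq_measure_integral => A mA _.
  exact/lebesgue_measure_affine.
rewrite /m ge0_integral_mscale//=.
by congr (_ * _)%E; rewrite ge0_integral_pushforward.
Qed.
Definition trow (R : realType) n (t : n.-tuple R) : 'rV[R]_n := \row_i tnth t i.
Definition rtup (R : realType) n (v : 'rV[R]_n) : n.-tuple R := [tuple v 0 i | i < n].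

Lemma rtupK (R : realType) n : cancel (@rtup R n) (@trow R n).
Proof. by move=> v; apply/rowP => i; rewrite mxE tnth_mktuple. Qed.

Lemma trowK (R : realType) n : cancel (@trow R n) (@rtup R n).
Proof. by move=> t; apply/eq_from_tnth => i; rewrite tnth_mktuple mxE. Qed.

Lemma measurable_rtup d (T : measurableType d) (R : realType) n (f : T -> 'rV[R]_n) :
  (forall i, measurable_fun setT (fun x => f x 0 i)) ->
  measurable_fun setT (fun x => rtup (f x)).
Proof.
move=> mf; apply/measurable_fun_tnthP => i.
by apply: eq_measurable_fun (mf i) => x _ /=; rewrite tnth_mktuple.
Qed.

Lemma measurable_trow_mul (R : realType) n m (M : 'M[R]_(n, m)) i :
  measurable_fun setT (fun t : n.-tuple R => (trow t *m M) 0 i).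
Proof.
rewrite (_ : (fun _ => _) = (fun t : n.-tuple R => \sum_j tnth t j * M j i)).
  apply: measurable_sum => j; apply: measurable_funM => //.
  exact: measurable_tnth.
by apply/funext => t; rewrite mxE; apply: eq_bigr => j _; rewrite mxE.
Qed.

Lemma ge0_integral_lebesgue_tupleS (R : realType) n (F : n.+1.-tuple R -> \bar R) :
  measurable_fun setT F -> (forall x, 0 <= F x)%E ->
  (\int[lebesgue_tuple R n.+1]_x F x =
   \int[@lebesgue_measure R]_x \int[lebesgue_tuple R n]_t F (cons_tuple_pair (x, t)))%E.
Proof.
move=> mF F0.
have mc : measurable_fun setT (@cons_tuple_pair R n) by exact: measurable_cons.
transitivity (\int[pushforward (@lebesgue_measure R \x lebesgue_tuple R n)
    (@cons_tuple_pair R n)]_x F x)%E.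
  by apply: eq_measure_integral.
rewrite ge0_integral_pushforward// preimage_setT fubini_tonelli1//.
  exact: measurableT_comp.
by move=> x /=.
Qed.

Lemma lebesgue_tupleS (R : realType) n (A : set (n.+1.-tuple R)) :
  (lebesgue_tuple R n.+1 A =
   \int[@lebesgue_measure R]_x lebesgue_tuple R n [set t | A (cons_tuple_pair (x, t))])%E.
Proof.
rewrite [LHS]/=; apply: eq_integral => x _ /=.
by congr (lebesgue_tuple R n _); apply/seteqP; split => t; rewrite /xsection /= inE.
Qed.

Lemma measurable_tuple_slice (R : realType) n (A : set (n.+1.-tuple R)) x :
  measurable A -> measurable [set t : n.-tuple R | A (cons_tuple_pair (x, t))].
Proof.
move=> mA; rewrite -[X in measurable X]setTI.
exact: (@measurable_cons _ _ _ _ (fun=> x) _ id).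
Qed.

Lemma measurable_lebesgue_tuple_slice (R : realType) n (A : set (n.+1.-tuple R)) :
  measurable A ->
  measurable_fun setT (fun x => lebesgue_tuple R n [set t | A (cons_tuple_pair (x, t))]).
Proof.
move=> mA.
have mc : measurable_fun setT (@cons_tuple_pair R n) by exact: measurable_cons.
have mB : measurable ((@cons_tuple_pair R n) @^-1` A).
  by rewrite -[X in measurable X]setTI; exact: mc.
apply: eq_measurable_fun (measurable_fun_xsection (lebesgue_tuple R n) mB) => x _ /=.
by congr (lebesgue_tuple R n _); apply/seteqP; split => t; rewrite /xsection /= inE.
Qed.

Definition tadd (R : realType) n (x y : n.-tuple R) : n.-tuple R :=
  rtup (trow x + trow y).

Lemma lebesgue_tuple_tadd (R : realType) n (v : n.-tuple R) (A : set (n.-tuple R)) :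
  measurable A ->
  lebesgue_tuple R n ((fun t => tadd t v) @^-1` A) = lebesgue_tuple R n A.
Proof.
elim: n v A => [v A _|n IH v A mA].
  by congr (lebesgue_tuple R 0 _); apply/seteqP; split => t; rewrite /= (tuple0 (tadd t v)) (tuple0 t).
rewrite lebesgue_tupleS [RHS]lebesgue_tupleS.
rewrite -[RHS](@ge0_integral_affine R 1 (thead v)) ?oner_eq0//; last first.
  exact: measurable_lebesgue_tuple_slice.
rewrite normr1 mul1e; apply: eq_integral => x _.
rewrite mul1r -(IH [tuple of behead v] [set t | A (cons_tuple_pair (x + thead v, t))]).
  congr (lebesgue_tuple R n _); apply/seteqP; split => t /=;
  rewrite (_ : tadd (cons_tuple_pair (x, t)) v =
             cons_tuple_pair (x + thead v, tadd t [tuple of behead v]))//;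
  by apply/eq_from_tnth => i; rewrite tnth_mktuple !mxE;
     have [j ->|->] := unliftP ord0 i; rewrite ?tnthS ?tnth_mktuple ?mxE ?tnth_behead//;
     rewrite ?tnth0//; congr (_ + tnth _ _); apply/val_inj; rewrite /= inordK//= ltnS.
exact: measurable_tuple_slice.
Qed.
Lemma integral_sections d1 d2 (T1 : measurableType d1) (T2 : measurableType d2)
    (R : realType) (m1 : {sigma_finite_measure set T1 -> \bar R})
    (m2 : {sigma_finite_measure set T2 -> \bar R}) (S : set (T1 * T2)) :
  measurable S ->
  (\int[m1]_x m2 [set y | S (x, y)] = \int[m2]_y m1 [set x | S (x, y)])%E.
Proof.
move=> mS; have := indic_fubini_tonelli m1 m2 mS.
rewrite indic_fubini_tonelli_FE// indic_fubini_tonelli_GE// => h.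
transitivity (\int[m1]_x (m2 \o xsection S) x)%E.
  apply: eq_integral => x _ /=; congr (m2 _).
  by apply/seteqP; split => y; rewrite /xsection /= inE.
rewrite h; apply: eq_integral => y _ /=; congr (m1 _).
by apply/seteqP; split => x; rewrite /ysection /= inE.
Qed.

Lemma integral_cst_indic d (T : measurableType d) (R : realType)
    (m : {measure set T -> \bar R}) (c : \bar R) (A : set T) :
  measurable A -> (0 <= c)%E -> (\int[m]_x (c * (\1_A x)%:E) = c * m A)%E.
Proof.
move=> mA c0; rewrite ge0_integralZl ?integral_indic ?setIT//.
exact/measurable_EFinP.
Qed.

Definition tlin (R : realType) n (M : 'M[R]_n) (t : n.-tuple R) : n.-tuple R :=
  rtup (trow t *m M).

Lemma measurable_tlin (R : realType) n (M : 'M[R]_n) : measurable_fun setT (tlin M).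
Proof. by apply: measurable_rtup => i; exact: measurable_trow_mul. Qed.

Lemma measurable_tadd_tlin (R : realType) n (M : 'M[R]_n) :
  measurable_fun setT (fun xz : n.-tuple R * n.-tuple R => tadd xz.1 (tlin M xz.2)).
Proof.
apply: measurable_rtup => i.
rewrite (_ : (fun _ => _) = (fun xz : n.-tuple R * n.-tuple R =>
    tnth xz.1 i + (trow xz.2 *m M) 0 i)).
  apply: measurable_funD => //.
    by apply: (measurableT_comp (measurable_tnth i)).
  exact: (measurableT_comp (measurable_trow_mul M i)).
by apply/funext => t; rewrite rtupK mxE mxE.
Qed.

(** Both products are measures of sets of pairs. [S1] collects the (x, z) with x in A and x + zM in
    B, [S2] those with x in B and x - zM in A. Slicing at fixed x gives translates of the preimage
    of B, respectively of A (by symmetry of A), hence the two products; slicing at fixed z gives two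
    sets that differ by the translation zM. One symmetric set whose measure and preimage are known
    thus determines the factor by which a linear map changes volume. *)
Lemma lebesgue_tuple_tlin_cross (R : realType) n (M : 'M[R]_n) (A B : set (n.-tuple R)) :
  M \in unitmx -> measurable A -> measurable B ->
  (forall t, A t -> A (rtup (- trow t))) ->
  (lebesgue_tuple R n A * lebesgue_tuple R n (tlin M @^-1` B) =
   lebesgue_tuple R n B * lebesgue_tuple R n (tlin M @^-1` A))%E.
Proof.
move=> uM mA mB symA.
have mpre C : measurable C -> measurable (tlin M @^-1` C).
  by move=> mC; rewrite -[X in measurable X]setTI; exact: measurable_tlin.
pose S1 := [set xz : n.-tuple R * n.-tuple R | A xz.1 /\ B (tadd xz.1 (tlin M xz.2))].
pose S2 := [set xz : n.-tuple R * n.-tuple R | B xz.1 /\ A (tadd xz.1 (tlin (- M) xz.2))].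
have mS (C D : set (n.-tuple R)) N : measurable C -> measurable D ->
    measurable [set xz : n.-tuple R * n.-tuple R | C xz.1 /\ D (tadd xz.1 (tlin N xz.2))].
  move=> mC mD; rewrite (_ : mkset _ = (fst @^-1` C) `&`
    ((fun xz : n.-tuple R * n.-tuple R => tadd xz.1 (tlin N xz.2)) @^-1` D)) //.
  apply: measurableI; rewrite -[X in measurable X]setTI.
    exact: measurable_fst.
  exact: measurable_tadd_tlin.
have sect (C D : set (n.-tuple R)) x w S : measurable D ->
    (forall z, S (x, z) <-> C x /\ D (tadd z w)) ->
    lebesgue_tuple R n [set z | S (x, z)] = (lebesgue_tuple R n D * (\1_C x)%:E)%E.
  move=> mD SE; rewrite indicE; case: (pselect (C x)) => hC.
    rewrite mem_set// mule1 -(lebesgue_tuple_tadd w mD).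
    by congr (lebesgue_tuple R n _); apply/seteqP; split => z /=; rewrite SE; tauto.
  rewrite memNset// mule0 (_ : mkset _ = set0) ?measure0//.
  by apply/seteqP; split => z //=; rewrite SE => -[].
have l1 : (\int[lebesgue_tuple R n]_x lebesgue_tuple R n [set z | S1 (x, z)] =
   lebesgue_tuple R n (tlin M @^-1` B) * lebesgue_tuple R n A)%E.
  rewrite -integral_cst_indic//; apply: eq_integral => x _.
  apply: (sect _ _ _ (rtup (trow x *m invmx M)) S1); first exact: mpre.
  move=> z; rewrite /S1 /=.
  rewrite (_ : tadd x _ = tlin M (tadd z (rtup (trow x *m invmx M))))//.
  by rewrite /tlin /tadd !rtupK mulmxDl mulmxKV// addrC.
have l2 : (\int[lebesgue_tuple R n]_x lebesgue_tuple R n [set z | S2 (x, z)] =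
   lebesgue_tuple R n (tlin M @^-1` A) * lebesgue_tuple R n B)%E.
  rewrite -integral_cst_indic//; apply: eq_integral => x _.
  apply: (sect _ _ _ (rtup (- trow x *m invmx M)) S2); first exact: mpre.
  move=> z; rewrite /S2 /=.
  have -> : tadd x (tlin (- M) z) = rtup (- trow (tlin M (tadd z (rtup (- trow x *m invmx M))))).
    by rewrite /tlin /tadd !rtupK mulmxDl mulmxKV// opprD opprK addrC mulmxN.
  by split => -[Bx /symA]; rewrite rtupK ?opprK ?trowK.
rewrite muleC -l1 [RHS]muleC -l2.
have mS1 : measurable S1 by exact: mS.
have mS2 : measurable S2 by exact: mS.
rewrite (integral_sections _ _ mS1) (integral_sections _ _ mS2).
apply: eq_integral => z _.
rewrite -(lebesgue_tuple_tadd (tlin M z) (A := [set x | S2 (x, z)])); last first.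
  have /= := measurable_ysection z (mS _ _ (- M) mB mA).
  by rewrite (_ : ysection _ _ = [set x | S2 (x, z)])//;
     apply/seteqP; split => x; rewrite /ysection /= inE.
congr (lebesgue_tuple R n _); apply/seteqP; split => x /=; rewrite /S1 /S2 /=;
rewrite (_ : tadd (tadd x (tlin M z)) (tlin (- M) z) = x);
  try (by move=> []); by rewrite /tadd /tlin !rtupK mulmxN addrK trowK.
Qed.
Lemma lebesgue_tuple_cube (R : realType) n (r : R) : 0 <= r ->
  lebesgue_tuple R n [set t | forall i, `|tnth t i| <= r] = ((2 * r) ^+ n)%:E.
Proof.
move=> r0; rewrite (_ : mkset _ = [set t | forall i, `[- r, r]%classic (tnth t i)]).
  rewrite (lebesgue_tuple_box (A := fun=> `[- r, r]%classic)) => [|i]; last first.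
    exact: measurable_itv.
  rewrite (eq_bigr (fun=> (2 * r)%:E)) => [|i _].
    by rewrite prodEFin big_const_ord iter_mulr_1.
  rewrite lebesgue_measure_itv/= lte_fin -EFinD.
  case: ltP => [_|]; first by congr EFin; ring.
  by move=> h; congr EFin; lra.
by apply/seteqP; split => t /= h i; have := h i; rewrite /= in_itv/= ler_norml.
Qed.

Lemma measurable_sublevel d (T : measurableType d) (R : realType) (f : T -> R) (c : R) :
  measurable_fun setT f -> measurable [set t | f t <= c].
Proof.
move=> mf; have mle : measurable_fun setT (fun t => f t <= c).
  by apply: measurable_fun_ler.
by have := mle measurableT [set true]; rewrite setTI; apply.
Qed.

Lemma measurable_forall_tnth (R : realType) n (f : n.-tuple R -> 'I_n -> bool) :
  (forall i, measurable_fun setT (f^~ i)) -> measurable [set t | forall i, f t i].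
Proof.
move=> mf; rewrite (_ : mkset _ = \bigcap_(i in [set: 'I_n]) [set t | f t i]).
  apply: fin_bigcap_measurable => // i _.
  rewrite -[X in measurable X]setTI.
  exact: (mf i measurableT [set true]).
by apply/seteqP; split => t /= h i; [move=> _|]; exact: h.
Qed.

Lemma measurable_cube (R : realType) n (r : R) :
  measurable [set t : n.-tuple R | forall i, `|tnth t i| <= r].
Proof.
apply: (measurable_forall_tnth (f := fun t i => `|tnth t i| <= r)) => i.
apply: measurable_fun_ler => //; apply: measurableT_comp => //.
exact: measurable_tnth.
Qed.

Lemma dot_mulmxtr (R : realType) n (x y : 'rV[R]_n) : x *m y^T = (dot x y)%:M.
Proof.
by rewrite [LHS]mx11_scalar mxE; congr (_%:M); apply: eq_bigr => i _; rewrite mxE.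
Qed.

Lemma mule_pIr (R : realType) (c x y : \bar R) :
  (0 < c)%E -> (c < +oo)%E -> (x * c = y * c)%E -> x = y.
Proof.
move=> c0 coo h.
have cf : c \is a fin_num by rewrite fin_numElt coo (lt_trans _ c0)// ltNyr.
have := congr1 (fun z => z * ((fine c)^-1)%:E)%E h.
by rewrite /= -!muleA -(fineK cf) -EFinM mulfV ?mule1// gt_eqF// fine_gt0// c0.
Qed.

(** The Euclidean unit ball is symmetric and invariant under [M], so the cross relation with A the
    ball leaves its measure as a common factor. It can be cancelled because the ball lies between
    two cubes of positive finite volume. *)
Lemma lebesgue_tuple_orth (R : realType) n (M : 'M[R]_n) (B : set (n.-tuple R)) :
  M *m M^T = 1%:M -> measurable B ->
  lebesgue_tuple R n (tlin M @^-1` B) = lebesgue_tuple R n B.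
Proof.
move=> MM mB.
have uM : M \in unitmx by have /mulmx1_unit[] := MM.
pose A : set (n.-tuple R) := [set t | dot (trow t) (trow t) <= 1].
have mA : measurable A.
  apply: measurable_sublevel; apply: measurable_sum => i.
  under eq_fun do rewrite mxE.
  by apply: measurable_funM; exact: measurable_tnth.
have symA t : A t -> A (rtup (- trow t)).
  rewrite /A /= rtupK; congr (_ <= _); apply: eq_bigr => i _.
  by rewrite !mxE mulrNN.
have TA : tlin M @^-1` A = A.
  apply/seteqP; split => t; rewrite /A /= rtupK;
  suff -> : dot (trow t *m M) (trow t *m M) = dot (trow t) (trow t) by [].
    have := dot_mulmxtr (trow t *m M) (trow t *m M).
    rewrite trmx_mul mulmxA -(mulmxA (trow t)) MM mulmx1 dot_mulmxtr.
    by move=> /matrixP/(_ 0 0); rewrite !mxE eqxx !mulr1n.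
  have := dot_mulmxtr (trow t *m M) (trow t *m M).
  rewrite trmx_mul mulmxA -(mulmxA (trow t)) MM mulmx1 dot_mulmxtr.
  by move=> /matrixP/(_ 0 0); rewrite !mxE eqxx !mulr1n.
have := lebesgue_tuple_tlin_cross uM mA mB symA; rewrite TA muleC.
have Aoo : (lebesgue_tuple R n A < +oo)%E.
  apply: (@le_lt_trans _ _ (lebesgue_tuple R n [set t | forall i, `|tnth t i| <= 1])).
    apply: le_measure; rewrite ?inE//; first exact: measurable_cube.
    move=> t /= At i; rewrite -(@ler_pXn2r _ 2) ?nnegrE// real_normK ?num_real// expr1n.
    apply: le_trans At; rewrite /dot (bigD1 i)//= mxE -expr2 lerDl sumr_ge0// => j _.
    by rewrite -expr2 sqr_ge0.
  by rewrite lebesgue_tuple_cube// ltry.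
have A0 : (0 < lebesgue_tuple R n A)%E.
  apply: (@lt_le_trans _ _ (lebesgue_tuple R n [set t | forall i, `|tnth t i| <= n.+1%:R^-1])).
    by rewrite lebesgue_tuple_cube// lte_fin exprn_gt0// mulr_gt0// invr_gt0.
  apply: le_measure; rewrite ?inE//; first exact: measurable_cube.
  move=> t /= h; rewrite /A /= /dot.
  apply: (@le_trans _ _ (\sum_(i < n) n.+1%:R^-1)).
    apply: ler_sum => i _; rewrite mxE -expr2 -real_normK ?num_real//.
    apply: (@le_trans _ _ (n.+1%:R^-1 ^+ 2)).
      by rewrite ler_pXn2r ?nnegrE ?invr_ge0//; exact: h.
    by rewrite expr2 ler_piMr ?invr_ge0// invf_le1// ler1n.
  by rewrite sumr_const card_ord -[X in X <= _]mulr_natl ler_pdivrMr// mul1r ler_nat.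
exact: mule_pIr.
Qed.

(** Applied with A a cube, whose dilates have explicit volume, this yields the homogeneity of
    volume. *)
Lemma lebesgue_tuple_scale_cross (R : realType) n (r : R) (A B : set (n.-tuple R)) :
  r != 0 -> measurable A -> measurable B ->
  (forall t, A t -> A (rtup (- trow t))) ->
  (lebesgue_tuple R n A * lebesgue_tuple R n [set t | B (rtup (r *: trow t))] =
   lebesgue_tuple R n B * lebesgue_tuple R n [set t | A (rtup (r *: trow t))])%E.
Proof.
move=> r0 mA mB symA.
have uM : (r%:M : 'M[R]_n) \in unitmx by rewrite unitmxE det_scalar unitrX// unitfE.
have := lebesgue_tuple_tlin_cross uM mA mB symA.
have E C : tlin r%:M @^-1` C = [set t | C (rtup (r *: trow t))] :> set (n.-tuple R).
  by apply/seteqP; split => t /=; rewrite /tlin mul_mx_scalar.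
by rewrite !E.
Qed.

(** Stacking [a] on top of [U] gives an orthogonal matrix, so this is invariance of Lebesgue measure
    followed by Tonelli: the space is fibred into lines parallel to [a] over the hyperplane. *)
Lemma ge0_integral_hyperplane (R : realType) m (a : 'rV[R]_m.+1)
    (U : 'M[R]_(m, m.+1)) (F : m.+1.-tuple R -> \bar R) :
  dot a a = 1 -> orthonormal_hyperplane_basis a U ->
  measurable_fun setT F -> (forall x, 0 <= F x)%E ->
  (\int[lebesgue_tuple R m.+1]_x F x =
   \int[lebesgue_tuple R m]_t \int[@lebesgue_measure R]_s
      F (rtup (s *: a + trow t *m U)))%E.
Proof.
move=> aa [UU Ua] mF F0.
pose M : 'M[R]_(1 + m, m.+1) := col_mx a U.
have MM : (M : 'M[R]_m.+1) *m M^T = 1%:M.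
  have : M *m M^T = 1%:M; last by [].
  rewrite /M (tr_col_mx a U) (mul_col_row a U a^T U^T) UU Ua dot_mulmxtr aa.
  rewrite (_ : a *m U^T = 0); last by apply: trmx_inj; rewrite trmx_mul trmxK Ua trmx0.
  by rewrite -scalar_mx_block.
have MT (s : R) (t : m.-tuple R) :
    tlin (M : 'M[R]_m.+1) (cons_tuple_pair (s, t)) = rtup (s *: a + trow t *m U).
  rewrite /tlin; congr rtup.
  rewrite (_ : trow _ = row_mx s%:M (trow t)).
    by rewrite /M (mul_row_col s%:M (trow t) a U) mul_scalar_mx.
  apply/rowP => i; rewrite !mxE; case: splitP => j ij; rewrite !mxE.
    rewrite (_ : i = ord0) ?ord1; last by apply/val_inj; rewrite /= ij ord1.
    by rewrite tnth0 ?eqxx ?mulr1n.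
  by rewrite (_ : i = lift ord0 j) ?tnthS//; apply/val_inj; rewrite /= ij.
transitivity (\int[pushforward (lebesgue_tuple R m.+1) (tlin (M : 'M[R]_m.+1))]_x F x)%E.
  apply: eq_measure_integral => [|mT A mA _]; first exact: measurable_tlin.
  exact/esym/lebesgue_tuple_orth.
rewrite ge0_integral_pushforward//; last exact: measurable_tlin.
rewrite preimage_setT.
rewrite ge0_integral_lebesgue_tupleS; last 2 first.
- by apply: measurableT_comp => //; exact: measurable_tlin.
- by move=> x /=; exact: F0.
transitivity (\int[@lebesgue_measure R]_s \int[lebesgue_tuple R m]_t
   F (rtup (s *: a + trow t *m U)))%E.
  by apply: eq_integral => s _; apply: eq_integral => t _ /=; rewrite MT.
rewrite (fubini_tonelli (m1 := @lebesgue_measure R) (m2 := lebesgue_tuple R m)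
  (fun st : R * m.-tuple R => F (rtup (st.1 *: a + trow st.2 *m U))))//.
apply: measurableT_comp => //; apply: measurable_rtup => i.
rewrite (_ : (fun _ => _) = (fun x : R * m.-tuple R => x.1 * a 0 i + (trow x.2 *m U) 0 i)).
  apply: measurable_funD; first by apply: measurable_funM.
  exact: (measurableT_comp (measurable_trow_mul U i)).
by apply/funext => x; rewrite !mxE.
Qed.

(** * Fundamental theorem of calculus for Lipschitz functions, variation of unimodal functions *)

Lemma is_derive_continuous (R : realType) (G g : R -> R) (x : R) :
  is_derive x 1 G (g x) -> {for x, continuous G}.
Proof. by move=> Gx; apply: differentiable_continuous; apply/derivable1_diffP. Qed.

Lemma integral_derive (R : realType) (G g : R -> R) (A B : R) :
  A <= B -> (forall x, A <= x <= B -> {for x, continuous g}) ->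
  (forall x, A <= x <= B -> is_derive x 1 G (g x)) ->
  (\int[lebesgue_measure]_(x in `[A, B]) (g x)%:E = (G B - G A)%:E)%E.
Proof.
rewrite le_eqVlt => /predU1P[<- _ _|AB cg dG].
  by rewrite set_itv1 integral_set1 subrr.
rewrite (@continuous_FTC2 _ g G)//.
- by apply: continuous_in_subspaceT => x /[!inE] xAB; apply: cg.
- split.
  + move=> x; rewrite in_itv/= => /andP[Ax xB].
    by have := dG x; rewrite (ltW Ax) (ltW xB) => /(_ isT)[].
  + apply: cvg_at_right_filter; apply: (@is_derive_continuous _ _ g).
    by apply: dG; rewrite lexx ltW.
  + apply: cvg_at_left_filter; apply: (@is_derive_continuous _ _ g).
    by apply: dG; rewrite lexx ltW.
- move=> x; rewrite in_itv/= => /andP[Ax xB]; rewrite derive1E.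
  by have := dG x; rewrite (ltW Ax) (ltW xB) => /(_ isT) /@derive_val.
Qed.

Lemma primitive_exists (R : realType) (F : R -> R) (a u : R) :
  continuous F -> exists G : R -> R, forall x, a < x < u -> is_derive x 1 G (F x).
Proof.
move=> cF; exists (fun x => \int[lebesgue_measure]_(t in `[a, x]) F t) => x /andP[ax xu].
have int : (@lebesgue_measure R).-integrable `[a, u] (EFin \o F).
  apply: continuous_compact_integrable; first exact: segment_compact.
  by apply: continuous_subspaceT.
have [dF <-] := continuous_FTC1_closed xu int ax (cF x).
by rewrite derive1E; apply: DeriveDef.
Qed.

Lemma lipschitz_continuous (R : realType) (F : R -> R) (L : R) :
  (forall x y, `|F x - F y| <= L * `|x - y|) -> continuous F.
Proof.
move=> LF x; apply/cvgrPdist_lt => e e0.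
have L0 : 0 <= L by have := LF 1 0; rewrite subr0 normr1 mulr1; apply: le_trans.
near=> y; apply: le_lt_trans (LF _ _) _.
apply: (@le_lt_trans _ _ ((L + 1) * `|x - y|)); first by rewrite ler_wpM2r// lerDl.
rewrite -ltr_pdivlMl; last by rewrite ltr_wpDl.
near: y; exists ((L + 1)^-1 * e) => //=.
by rewrite mulr_gt0// invr_gt0 ltr_wpDl.
Unshelve. all: by end_near. Qed.

Lemma is_derive_cvg_seq (R : realType) (F : R -> R) (x d : R) (h : R^nat) :
  is_derive x 1 F d -> (forall n, h n != 0) -> h @ \oo --> 0 ->
  (h n)^-1 * (F (h n + x) - F x) @[n --> \oo] --> d.
Proof.
move=> [dF <-] h0 hcvg.
have c : (fun h => h^-1 *: ((F \o shift x) (h *: 1) - F x)) @ 0^' --> 'D_1 F x by exact: dF.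
have := (cvgr_dnbhsP (fun h => h^-1 *: ((F \o shift x) (h *: 1) - F x)) 0 ('D_1 F x)).1 c h.
move=> /(_ (conj h0 hcvg)); apply: cvg_trans; apply: near_eq_cvg; apply: nearW => n /=.
by rewrite -[_ *: 1]/(_ * 1) mulr1.
Qed.

(** The weight exp(-|x|^r) can have a kink at 0 (r = 1), so an almost everywhere derivative has to
    suffice. The difference quotients of [F] are bounded by [L] and converge to [f]; their integrals
    are difference quotients, at B and at A, of a primitive [G] of the continuous function [F].
    Dominated convergence identifies the two limits. *)
Lemma integral_lipschitz_derive (R : realType) (F f : R -> R) (L A B : R) :
  A <= B -> (forall x y, `|F x - F y| <= L * `|x - y|) ->
  measurable_fun setT f ->
  {ae @lebesgue_measure R, forall x : R, is_derive (x : R) 1 F (f x)} ->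
  (\int[lebesgue_measure]_(x in `[A, B]) (f x)%:E = (F B - F A)%:E)%E.
Proof.
move=> AB LF mf dF.
have L0 : 0 <= L by have := LF 1 0; rewrite subr0 normr1 mulr1; apply: le_trans.
have cF := lipschitz_continuous LF.
pose h (j : nat) : R := (j.+1%:R)^-1.
have h_gt0 j : 0 < h j by rewrite invr_gt0.
have h_le1 j : h j <= 1 by rewrite invf_le1// ler1n.
have hcvg : h @ \oo --> (0 : R) by exact: cvg_harmonic.
pose g j x := (h j)^-1 * (F (h j + x) - F x).
have cg j : continuous (g j).
  move=> x; apply: cvgMr; apply: cvgB; last exact: cF.
  by apply: (@continuous_comp _ _ _ (fun x => h j + x) F);
    [apply: cvgD; [exact: cvg_cst|exact: cvg_id]|exact: cF].
have mg j : measurable_fun setT (g j) by exact: continuous_measurable_fun.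
have gL j x : `|g j x| <= L.
  rewrite /g normrM normfV (gtr0_norm (h_gt0 j)) ler_pdivrMl// mulrC.
  by apply: le_trans (LF _ _) _; rewrite addrK gtr0_norm.
(* The margins keep [h j + x], with [h j] at most 1, inside the open interval where [G] is
   differentiable. *)
have [G dG] := @primitive_exists _ F (A - 1) (B + 2) cF.
have intg j : (\int[lebesgue_measure]_(x in `[A, B]) (g j x)%:E =
    ((h j)^-1 * (G (h j + B) - G B) - (h j)^-1 * (G (h j + A) - G A))%:E)%E.
  have dGh (x : R) : A <= x <= B ->
      is_derive x 1 (fun x : R => (h j)^-1 * (G (h j + x) - G x)) (g j x).
    move=> /andP[Ax xB].
    have d1 : is_derive x 1 G (F x) by apply: dG; have := h_gt0 j; lra.
    have d2 : is_derive (h j + x) 1 G (F (h j + x)).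
      by apply: dG; have := h_gt0 j; have := h_le1 j; lra.
    have d0 : is_derive x 1 (fun y : R => h j + y) (0 + 1) by exact: is_deriveD.
    have d3 : is_derive x 1 (G \o (fun y : R => h j + y)) (F (h j + x)).
      by apply: is_derive_eq; rewrite add0r mulr1.
    have d4 : is_derive x 1 (G \o (fun y : R => h j + y) \- G) (F (h j + x) - F x).
      exact: is_deriveB.
    exact: is_deriveZ.
  by rewrite (integral_derive AB _ dGh) => [|x _]; [rewrite mulrBr|exact: cg].
have [|||||_ _] := @dominated_convergence _ _ _ (@lebesgue_measure R) `[A, B]%classic
  (measurable_itv _) (fun j x => (g j x)%:E) (EFin \o f) (cst L%:E).
- by move=> j; apply/measurable_EFinP; apply: measurable_funTS; exact: mg.
- by apply/measurable_EFinP; apply: measurable_funTS; exact: mf.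
- move: dF; apply: filterS.
    exact: (ae_filter_ringOfSetsType (@lebesgue_measure R)).
  move=> x dFx _; apply/fine_cvgP; split; first exact: nearW.
  by apply: is_derive_cvg_seq => // n; rewrite gt_eqF.
- apply: continuous_compact_integrable; first exact: segment_compact.
  by apply: continuous_subspaceT => x; exact: cvg_cst.
- by apply: aeW => x j _; rewrite lee_fin.
have -> : [sequence (\int[lebesgue_measure]_(x in `[A, B]) (g j x)%:E)%E]_j =
   (fun j => ((h j)^-1 * (G (h j + B) - G B) - (h j)^-1 * (G (h j + A) - G A))%:E).
  by apply/funext => j; exact: intg.
move=> c1; apply: (cvg_unique _ c1) => //; apply: cvg_EFin; first exact: nearW.
by apply: cvgB; apply: is_derive_cvg_seq => //; try (by move=> n; rewrite gt_eqF);
  apply: dG; lra.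
Qed.
Lemma ge0_integral_cvg_sets d (T : measurableType d) (R : realType)
    (mu : {measure set T -> \bar R}) (D : set T) (D_ : (set T)^nat) (f : T -> \bar R) :
  (forall n, measurable (D_ n)) -> nondecreasing_seq D_ -> \bigcup_n D_ n = D ->
  measurable_fun D f -> (forall x, D x -> 0 <= f x)%E ->
  (\int[mu]_(x in D_ n) f x)%E @[n --> \oo] --> (\int[mu]_(x in D) f x)%E.
Proof.
move=> mD_ ndD UD mf f0.
have mD : measurable D by rewrite -UD; exact: bigcupT_measurable.
have subD n : D_ n `<=` D by rewrite -UD => x Dx; exists n.
have E n : (\int[mu]_(x in D_ n) f x = \int[mu]_(x in D) (f \_ (D_ n)) x)%E.
  by rewrite -integral_mkcondr setIidr.
under eq_fun do rewrite E.
have -> : (\int[mu]_(x in D) f x =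
    \int[mu]_(x in D) (limn (fun n => (f \_ (D_ n)) x)))%E.
  apply: eq_integral => x /set_mem Dx; apply/esym/cvg_lim => //.
  move: Dx; rewrite -UD => -[N _ DN].
  apply: cvg_near_cst; exists N => // n /= Nn.
  by rewrite patchE mem_set//; move: DN; apply/subsetPset/ndD.
apply: cvg_monotone_convergence => //.
- move=> n; apply/measurable_restrict => //.
  by apply: measurable_funS mf => //; exact: subIsetl.
- by move=> n x Dx; rewrite patchE; case: ifP => // _; exact: f0.
- move=> x Dx m n mn; rewrite !patchE.
  case: ifPn => [xm|_]; last by case: ifP => // _; exact: f0.
  by rewrite ifT//; move: xm; rewrite !inE; apply/subsetPset/ndD.
Qed.

Lemma ge0_integral_itv_cvg (R : realType) (s : R) (f : R -> \bar R) (u : R^nat) (l : R) :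
  measurable_fun setT f -> (forall x, 0 <= f x)%E ->
  (forall n : nat, \int[lebesgue_measure]_(x in `[(s - n%:R)%R, (s + n%:R)%R]) f x = (u n)%:E)%E ->
  u n @[n --> \oo] --> l -> (\int[lebesgue_measure]_x f x = l%:E)%E.
Proof.
move=> mf f0 fu ul.
have := @ge0_integral_cvg_sets _ _ _ (@lebesgue_measure R) setT
  (fun n : nat => `[s - n%:R, s + n%:R]%classic) f.
move=> /(_ _ _ _ mf) h; apply: (cvg_unique _ (h _ _ _ _)) => //.
- move=> m n mn; apply/subsetPset; apply: subset_itv; rewrite bnd_simp lerD2l ?lerN2;
  by rewrite ler_nat.
- apply/seteqP; split => // x _; exists (Num.truncn `|x - s|).+1 => //=.
  by rewrite in_itv/= -ler_distl ltW// truncnS_gt.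
- rewrite /= (_ : (fun _ => _) = EFin \o u); last by apply/funext => n; exact: fu.
  by apply: cvg_EFin => //; exact: nearW.
Qed.
Lemma nonincreasing_derive_le0 (R : realType) (F : R -> R) (s x d : R) :
  (forall x y, s <= x <= y -> F y <= F x) -> s <= x -> is_derive x 1 F d -> d <= 0.
Proof.
move=> mono sx dF.
have hne n : (harmonic n : R) != 0 by rewrite /harmonic/= invr_eq0 pnatr_eq0.
have c := is_derive_cvg_seq dF hne (@cvg_harmonic R).
rewrite -(cvg_lim _ c)//; apply: limr_le; first by apply/cvg_ex; exists d.
apply: nearW => n; rewrite mulr_ge0_le0 ?subr_le0 ?invr_ge0//.
by apply: mono; rewrite sx lerDr /harmonic/= invr_ge0.
Qed.

Lemma nondecreasing_derive_ge0 (R : realType) (F : R -> R) (s x d : R) :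
  (forall x y, x <= y <= s -> F x <= F y) -> x <= s -> is_derive x 1 F d -> 0 <= d.
Proof.
move=> mono xs dF.
have dG : is_derive (- x) 1 (F \o -%R) (- d).
  have d1 : is_derive (- - x) 1 F d by rewrite opprK.
  by apply: is_derive_eq; rewrite mulrN1.
rewrite -oppr_le0; apply: (nonincreasing_derive_le0 (F := F \o -%R) (s := - s)) dG.
  by move=> u v /andP[su uv] /=; apply: mono; rewrite lerN2 uv lerNl.
by rewrite lerN2.
Qed.

(** The function rises from 0 to its maximum and falls back to 0, so its total variation is twice
    the maximum. Unimodality is given as quasi-concavity: left of a maximiser [s] the function
    increases and right of it it decreases, which fixes the sign of the derivative. *)
Lemma integral_abs_derive_unimodal (R : realType) (F f : R -> R) (L : R) :
  (forall x y, `|F x - F y| <= L * `|x - y|) -> (forall x, 0 < F x) ->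
  (forall e : R, 0 < e -> exists M : R, forall x, M <= `|x| -> F x <= e) ->
  (forall x y z, x <= y <= z -> Num.min (F x) (F z) <= F y) ->
  measurable_fun setT f ->
  {ae @lebesgue_measure R, forall x : R, is_derive (x : R) 1 F (f x)} ->
  exists s, (forall x, F x <= F s) /\
    (\int[lebesgue_measure]_x `|f x|%:E = (2 * F s)%:E)%E.
Proof.
move=> LF F0 F_oo qc mf dF.
have cF := lipschitz_continuous LF.
(* Far out, [F] stays below [F 0], so a maximum over a large segment containing 0 is a global
   one. *)
have [s Fs] : exists s, forall x, F x <= F s.
  have [M FM] := F_oo _ (F0 0).
  have M0 : - (`|M| + 1) <= `|M| + 1 by rewrite -subr_ge0 opprK addr_ge0.
  have cFM : {within `[- (`|M| + 1), `|M| + 1], continuous F}.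
    exact: continuous_subspaceT.
  have [s sM Fs] := EVT_max M0 cFM.
  exists s => x; have [xM|xM] := lerP `|x| (`|M| + 1).
    by apply: Fs; rewrite in_itv/= -ler_norml.
  apply: (le_trans (FM x _)); first by have := ler_norm M; lra.
  by apply: Fs; rewrite in_itv/= oppr_le0 ltW ?ltr_wpDl// ltW// ltr_wpDl.
exists s; split => //.
have decr x y : s <= x <= y -> F y <= F x.
  by move=> /qc; rewrite (min_idPr (Fs y)).
have incr x y : x <= y <= s -> F x <= F y.
  by move=> /qc; rewrite (min_idPl (Fs x)).
have mnf : measurable_fun setT (fun x => `|f x|%:E).
  by apply/measurable_EFinP; exact: measurableT_comp.
apply: (ge0_integral_itv_cvg (s := s) (u := fun n => (F s - F (s - n%:R)) + (F s - F (s + n%:R)))) => //.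
  move=> n.
  have -> : `[s - n%:R, s + n%:R]%classic = `[s - n%:R, s]%classic `|` `]s, s + n%:R]%classic.
    by rewrite -itv_bndbnd_setU ?bnd_simp ?gerBl ?lerDl.
  rewrite ge0_integral_setU//=; last 2 first.
  - exact: measurable_funTS.
  - rewrite disj_set2E; apply/eqP/seteqP; split => // x /=; rewrite !in_itv/=.
    by move=> [/andP[_ a] /andP[b _]]; have := lt_le_trans b a; rewrite ltxx.
  rewrite EFinD; congr (_ + _)%E.
    rewrite -(integral_lipschitz_derive _ LF mf dF) ?gerBl//.
    apply: ae_eq_integral => //.
    - exact: measurable_funTS.
    - by apply/measurable_EFinP; apply: measurable_funTS.
    move: dF; apply: filterS; first exact: (ae_filter_ringOfSetsType (@lebesgue_measure R)).
    move=> x dFx /=; rewrite in_itv/= => /andP[_ xs].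
    by rewrite ger0_norm//; exact: nondecreasing_derive_ge0 incr xs dFx.
  rewrite integral_itv_obnd_cbnd; last exact: measurable_funTS.
  have LFN x y : `|(- F x) - (- F y)| <= L * `|x - y|.
    by rewrite -opprD normrN.
  have mfN : measurable_fun setT (fun x => - f x) by exact: measurableT_comp.
  have dFN : {ae @lebesgue_measure R, forall x : R, is_derive (x : R) 1 (fun x => - F x) (- f x)}.
    move: dF; apply: filterS; first exact: (ae_filter_ringOfSetsType (@lebesgue_measure R)).
    by move=> x dFx; exact: is_deriveN.
  rewrite -[in RHS]opprB opprD -(integral_lipschitz_derive _ LFN mfN dFN) ?lerDl//.
  apply: ae_eq_integral => //.
  - exact: measurable_funTS.
  - by apply/measurable_EFinP; apply: measurable_funTS.
  move: dF; apply: filterS; first exact: (ae_filter_ringOfSetsType (@lebesgue_measure R)).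
  move=> x dFx /=; rewrite in_itv/= => /andP[sx _].
  by rewrite ler0_norm//; exact: nonincreasing_derive_le0 decr sx dFx.
rewrite [2 * _]mulr_natl mulr2n.
have lim (sg : R) : `|sg| = 1 -> F (s + sg * n%:R) @[n --> \oo] --> 0.
  move=> sg1; apply/cvgrPdist_le => e e0; have [M FM] := F_oo _ e0.
  near=> n; rewrite sub0r normrN gtr0_norm//; apply: FM.
  have : `|s| + M <= n%:R by near: n; exact: nbhs_infty_ger.
  have := lerB_normD (sg * n%:R) s.
  rewrite normrM sg1 mul1r normr_nat [sg * _ + s]addrC => h1 h2; lra.
rewrite -[X in _ --> X + _]subr0 -[X in _ --> _ + X]subr0.
apply: cvgD; apply: cvgB; try exact: cvg_cst.
  by have := lim (-1); rewrite normrN1 => /(_ erefl); under eq_fun do rewrite mulN1r.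
by have := lim 1; rewrite normr1 => /(_ erefl); under eq_fun do rewrite mul1r.
Unshelve. all: by end_near. Qed.

(** * The one-dimensional weight exp(-|x|^r) and its derivative *)

Definition phi (R : realType) (r x : R) : R := Num.sg x * `|x| `^ (r - 1).

Definition wexp (R : realType) (r x : R) : R := expR (- (`|x| `^ r)).

Lemma wexp_gt0 (R : realType) (r x : R) : 0 < wexp r x.
Proof. exact: expR_gt0. Qed.

Lemma wexp_le1 (R : realType) (r x : R) : wexp r x <= 1.
Proof. by rewrite /wexp expR_le1 oppr_le0 powR_ge0. Qed.

Lemma is_derive_powR (R : realType) (r x : R) : 0 < x ->
  is_derive x 1 (fun y => y `^ r) (r * x `^ (r - 1)).
Proof.
move=> x0; have xI : x \in `]0, +oo[ by rewrite in_itv/= x0.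
by have := powR_derive1 r xI; rewrite derive1E => <-; apply/DeriveDef => //;
  exact: derivable_powR.
Qed.

Lemma is_derive_normr_powR (R : realType) (r x : R) : x != 0 ->
  is_derive x 1 (fun y => `|y| `^ r) (r * phi r x).
Proof.
rewrite neq_lt /phi => /orP[x0|x0].
  have d1 : is_derive (- x) 1 (fun y => y `^ r) (r * (- x) `^ (r - 1)).
    by apply: is_derive_powR; rewrite oppr_gt0.
  apply: (@near_eq_is_derive _ _ _ ((fun y => y `^ r) \o -%R)).
    near=> y; rewrite /= ltr0_norm//; near: y; exact: lt_nbhsl.
  by apply: is_derive_eq; rewrite ltr0_sg// ltr0_norm// mulrN1 mulN1r mulrN.
apply: (@near_eq_is_derive _ _ _ (fun y => y `^ r)).
  near=> y; rewrite /= gtr0_norm//; near: y; exact: lt_nbhsr.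
by rewrite gtr0_sg// gtr0_norm// mul1r; exact: is_derive_powR.
Unshelve. all: by end_near. Qed.

Lemma is_derive_wexp (R : realType) (r x : R) : x != 0 ->
  is_derive x 1 (wexp r) (- (r * phi r x) * wexp r x).
Proof.
move=> x0; have d := is_derive_normr_powR r x0.
have d1 : is_derive x 1 (fun y => - (`|y| `^ r)) (- (r * phi r x)) by exact: is_deriveN.
have d2 : is_derive x 1 (expR \o (fun y => - (`|y| `^ r)))
   (expR (- (`|x| `^ r)) * - (r * phi r x)) by exact: is_derive1_comp.
by rewrite mulrC.
Qed.

(** exp(y) >= 1 + y with y = x^r dominates x^(r-1): through the term 1 when x <= 1 and through y
    when x > 1. *)
Lemma powR_Bwexp_le1 (R : realType) (r x : R) : 1 <= r -> 0 < x ->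
  x `^ (r - 1) * expR (- (x `^ r)) <= 1.
Proof.
move=> r1 x0; have e1 := expR_ge1Dx (x `^ r).
rewrite expRN ler_pdivrMr ?expR_gt0// mul1r; apply: le_trans e1.
have [x1|x1] := leP x 1.
  apply: (@le_trans _ _ 1); last by rewrite lerDl powR_ge0.
  by rewrite -[leRHS](powRr0 x); apply: ger_powR; rewrite ?x0// subr_ge0.
apply: (@le_trans _ _ (x `^ r)); last by rewrite lerDr.
by rewrite ler_powR ?ltW// ltrBlDr ltrDl.
Qed.

(** Away from 0 the mean value theorem applies, with the derivative bounded by r through
    [powR_Bwexp_le1]. Evenness reduces to 0 <= u <= v, and the endpoint u = 0, where the derivative
    may fail to exist, is treated directly by 1 - exp(-v^r) <= v^r. *)
Lemma wexp_lipschitz (R : realType) (r x y : R) : 1 <= r ->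
  `|wexp r x - wexp r y| <= r * `|x - y|.
Proof.
move=> r1; have r0 : 0 < r by apply: lt_le_trans r1.
suff pos u v : 0 <= u -> u <= v -> `|wexp r u - wexp r v| <= r * `|u - v|.
  have wn z : wexp r z = wexp r `|z| by rewrite /wexp normr_id.
  have key : `|wexp r `|x| - wexp r `|y| | <= r * `| `|x| - `|y| |.
    have [xy|/ltW xy] := leP `|x| `|y|; first exact: pos.
    by rewrite distrC [in X in _ <= X]distrC; exact: pos.
  rewrite (wn x) (wn y); apply: (le_trans key).
  by rewrite ler_pM2l// ler_dist_dist.
rewrite le_eqVlt => /predU1P[<-|u0] uv.
  have -> : wexp r 0 = 1 by rewrite /wexp normr0 powR0 ?gt_eqF// oppr0 expR0.
  rewrite sub0r normrN (ger0_norm uv) ger0_norm ?subr_ge0 ?wexp_le1//.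
  have [v1|v1] := leP v 1; last first.
    apply: (@le_trans _ _ 1); first by rewrite lerBlDr lerDl ltW// wexp_gt0.
    by rewrite -[1]mulr1 ler_pM// ltW.
  have := expR_ge1Dx (- (`|v| `^ r)); rewrite -/(wexp r v) (ger0_norm uv) => e1.
  apply: (@le_trans _ _ (v `^ r)); first by lra.
  apply: (@le_trans _ _ v); last by rewrite ler_peMl.
  move: uv; rewrite le_eqVlt => /predU1P[<-|v0]; first by rewrite powR0 ?gt_eqF.
  by apply: ge1r_powR; rewrite ?v0.
move: uv; rewrite le_eqVlt => /predU1P[<-|uv]; first by rewrite !subrr normr0 mulr0.
have dw (z : R) : z \in `]u, v[ -> is_derive z 1 (wexp r) (- (r * phi r z) * wexp r z).
  by rewrite in_itv/= => /andP[uz _]; apply: is_derive_wexp; rewrite gt_eqF// (lt_trans u0).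
have cw : {within `[u, v], continuous (wexp r)}.
  apply: continuous_in_subspaceT => z; rewrite inE/= in_itv/= => /andP[uz _].
  have z0 : z != 0 by rewrite gt_eqF// (lt_le_trans u0).
  exact: (is_derive_continuous (g := fun z => - (r * phi r z) * wexp r z)) (is_derive_wexp r z0).
have [z zuv] := MVT uv dw cw.
rewrite distrC => ->; rewrite normrM [`|v - u|]distrC ler_wpM2r//.
move: zuv; rewrite in_itv/= => /andP[uz _].
have z0 : 0 < z by rewrite (lt_trans u0).
rewrite /phi gtr0_sg// mul1r /wexp (gtr0_norm z0) mulNr normrN -mulrA normrM (gtr0_norm r0).
rewrite ler_piMr ?(ltW r0)// ger0_norm ?powR_Bwexp_le1//.
by rewrite mulr_ge0 ?powR_ge0 ?expR_ge0.
Qed.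

Lemma prod_lipschitz (R : realDomainType) (I : Type) (s : seq I) (u v : I -> R) :
  (forall i, 0 <= u i <= 1) -> (forall i, 0 <= v i <= 1) ->
  `|\prod_(i <- s) u i - \prod_(i <- s) v i| <= \sum_(i <- s) `|u i - v i|.
Proof.
move=> u01 v01; elim: s => [|i s IH]; first by rewrite !big_nil subrr normr0.
rewrite !big_cons.
set U := \prod_(j <- s) u j; set V := \prod_(j <- s) v j.
have -> : u i * U - v i * V = (u i - v i) * U + v i * (U - V) by ring.
apply: (le_trans (ler_normD _ _)); rewrite lerD//.
  rewrite normrM ler_piMr// ger0_norm; last by apply: prodr_ge0 => j _; case/andP: (u01 j).
  by apply: prodr_ile1 => j _; exact: u01.
by rewrite normrM; apply: le_trans IH; rewrite ler_piMl// ger0_norm; case/andP: (v01 i).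
Qed.

Lemma normr_powR_convex (R : realType) (r x y t : R) : 1 <= r -> 0 <= t <= 1 ->
  `|t * x + (1 - t) * y| `^ r <= t * `|x| `^ r + (1 - t) * `|y| `^ r.
Proof.
move=> r1 /andP[t0 t1]; have r0 : 0 <= r by apply: le_trans r1.
apply: (@le_trans _ _ ((t * `|x| + (1 - t) * `|y|) `^ r)).
  apply: ge0_ler_powR; rewrite ?nnegrE ?addr_ge0 ?mulr_ge0 ?subr_ge0//.
  apply: (le_trans (ler_normD _ _)).
  by rewrite !normrM (ger0_norm t0) [`|1 - t|]ger0_norm ?subr_ge0.
have xI : `|x| \in (`[0, +oo[%classic : set R) by rewrite inE/= in_itv/= normr_ge0.
have yI : `|y| \in (`[0, +oo[%classic : set R) by rewrite inE/= in_itv/= normr_ge0.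
have := convex_powR r1 (Itv01 t0 t1) xI yI.
by rewrite !convRE.
Qed.
(** * Cauchy's projection formula *)

Definition hpow (R : realType) (r : R) n (x : 'rV[R]_n) : R := \sum_(i < n) `|x 0 i| `^ r.

Definition ewt (R : realType) (r : R) n (x : 'rV[R]_n) : R := \prod_(i < n) wexp r (x 0 i).

(* Minus the derivative of [ewt r] at [x] in the direction [a]. *)
Definition dirK (R : realType) (r : R) n (a x : 'rV[R]_n) : R :=
  (\sum_(i < n) a 0 i * (r * phi r (x 0 i))) * ewt r x.

Lemma ewtE (R : realType) (r : R) n (x : 'rV[R]_n) : ewt r x = expR (- hpow r x).
Proof. by rewrite /ewt /hpow -sumrN expR_sum. Qed.

Lemma ewt_gt0 (R : realType) (r : R) n (x : 'rV[R]_n) : 0 < ewt r x.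
Proof. by rewrite ewtE expR_gt0. Qed.

Lemma measurable_phi (R : realType) (r : R) : measurable_fun setT (phi r).
Proof.
apply: measurable_funM.
  rewrite (_ : Num.sg = fun x : R => if 0 < x then 1 else if x < 0 then -1 else 0).
    by apply: measurable_fun_ifT => //; [exact: measurable_fun_ltr|
       apply: measurable_fun_ifT => //; exact: measurable_fun_ltr].
  by apply/funext => x; case: (ltgtP x 0) => h; rewrite ?(gtr0_sg h) ?(ltr0_sg h) ?h ?sgr0.
exact: (measurableT_comp (measurable_powR _)).
Qed.

Lemma measurable_wexp (R : realType) (r : R) : measurable_fun setT (wexp r).
Proof.
apply: (measurableT_comp (@measurable_expR R)); apply: measurableT_comp => //.
exact: (measurableT_comp (measurable_powR _)).
Qed.

Lemma hpow_convex (R : realType) (r t : R) n (x y : 'rV[R]_n) : 1 <= r -> 0 <= t <= 1 ->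
  hpow r (t *: x + (1 - t) *: y) <= t * hpow r x + (1 - t) * hpow r y.
Proof.
move=> r1 t01; rewrite /hpow !mulr_sumr -big_split/=; apply: ler_sum => i _.
by rewrite !mxE; exact: normr_powR_convex.
Qed.

(** [hpow] is convex, so between two points of a line it stays below the larger of the end
    values. *)
Lemma ewt_line_quasiconcave (R : realType) (r : R) n (a y : 'rV[R]_n) (u v w : R) : 1 <= r ->
  u <= v <= w ->
  Num.min (ewt r (u *: a + y)) (ewt r (w *: a + y)) <= ewt r (v *: a + y).
Proof.
move=> r1 /andP[uv vw].
have [uw|wu] := ltP u w; last first.
  have -> : u = v by apply/le_anti; rewrite uv (le_trans vw).
  by move: (ewt r (v *: a + y)) (ewt r (w *: a + y)) => A B; rewrite ge_min lexx.
pose t := (w - v) / (w - u).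
have wu0 : 0 < w - u by rewrite subr_gt0.
have t01 : 0 <= t <= 1.
  by rewrite /t divr_ge0 ?subr_ge0 ?(ltW uw)//= ler_pdivrMr// mul1r lerD2l lerN2.
have E : v *: a + y = t *: (u *: a + y) + (1 - t) *: (w *: a + y).
  apply/rowP => i; rewrite !mxE /t; field; lra.
rewrite !ewtE E.
have := hpow_convex (u *: a + y) (w *: a + y) r1 t01.
move: (hpow r (u *: a + y)) (hpow r (w *: a + y)) (hpow r _) => A B C h.
rewrite ge_min !ler_expR !lerN2.
case: (leP A B) => AB; apply/orP; [right|left]; case/andP: t01 => t0 t1; nra.
Qed.

Lemma ewt_line_lipschitz (R : realType) (r : R) n (a y : 'rV[R]_n) (u v : R) : 1 <= r ->
  `|ewt r (u *: a + y) - ewt r (v *: a + y)| <= (\sum_(i < n) r * `|a 0 i|) * `|u - v|.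
Proof.
move=> r1; rewrite mulr_suml; apply: (le_trans (prod_lipschitz _ _ _)).
- by move=> i; rewrite ltW ?wexp_gt0//= wexp_le1.
- by move=> i; rewrite ltW ?wexp_gt0//= wexp_le1.
apply: ler_sum => i _; apply: (le_trans (wexp_lipschitz _ _ r1)).
by rewrite !mxE opprD addrACA subrr addr0 -mulrBl normrM -mulrA [`|a 0 i| * _]mulrC.
Qed.

Lemma ewt_line_cvg0 (R : realType) (r : R) n (a y : 'rV[R]_n) (e : R) : 1 <= r -> a != 0 ->
  0 < e -> exists M, forall s, M <= `|s| -> ewt r (s *: a + y) <= e.
Proof.
move=> r1 a0 e0.
have [i ai] : exists i, a 0 i != 0.
  apply/existsP; apply: contraR a0 => /existsPn h; apply/eqP/rowP => i; rewrite mxE.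
  by apply/eqP; have := h i; rewrite negbK.
have ai0 : 0 < `|a 0 i| by rewrite normr_gt0.
exists ((1 + `|ln e| + `|y 0 i|) / `|a 0 i|) => s; rewrite ler_pdivrMr// => hs.
rewrite -[leRHS]lnK ?posrE// ewtE ler_expR lerNl.
apply: (@le_trans _ _ (`|(s *: a + y) 0 i| `^ r)); last first.
  rewrite /hpow (bigD1 i)//= lerDl; apply: sumr_ge0 => j _; exact: powR_ge0.
have big : 1 + `|ln e| <= `|(s *: a + y) 0 i|.
  rewrite !mxE; have := lerB_normD (s * a 0 i) (y 0 i); rewrite normrM; lra.
apply: (@le_trans _ _ `|(s *: a + y) 0 i|).
  have := ler_norm (- ln e); rewrite normrN; lra.
by apply: le1r_powR => //; apply: le_trans big; rewrite lerDl.
Qed.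

(** Giving each derivative through a logarithmic derivative [g i] turns the product rule into a
    plain sum, which is the shape of [dirK]. *)
Lemma is_derive_prod_log (R : realType) (I : Type) (l : seq I) (f : I -> R -> R)
    (g : I -> R) (s : R) :
  (forall i, is_derive s 1 (f i) (g i * f i s)) ->
  is_derive s 1 (fun u => \prod_(i <- l) f i u)
    ((\sum_(i <- l) g i) * \prod_(i <- l) f i s).
Proof.
move=> df; elim: l => [|i l IH].
  rewrite (_ : (fun _ => _) = cst 1); last by apply/funext => u; rewrite big_nil.
  by apply: is_derive_eq; rewrite !big_nil mul0r.
rewrite (_ : (fun _ => _) = f i * (fun s => \prod_(i <- l) f i s)); last first.
  by apply/funext => u; rewrite big_cons.
have d := is_deriveM (df i) IH.
apply: is_derive_eq; rewrite !big_cons /GRing.scale/=; ring.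
Qed.

(** Differentiability can fail only where a coordinate that moves along the line vanishes, at one
    parameter per coordinate. A coordinate with [a 0 i = 0] gives a constant factor, whatever its
    value. *)
Lemma ewt_line_derive (R : realType) (r : R) n (a y : 'rV[R]_n) :
  {ae @lebesgue_measure R, forall s : R,
    is_derive (s : R) 1 (fun s => ewt r (s *: a + y)) (- dirK r a (s *: a + y))}.
Proof.
pose S := \bigcup_(i in [set: 'I_n]) [set - y 0 i / a 0 i].
have cS : countable S.
  by apply: bigcup_countable => // i _; exact: countable1.
exists S; split.
- by apply: countable_measurable.
- exact: countable_lebesgue_measure0.
move=> s /=; apply: contra_notP => /= nS.
have nz i : a 0 i != 0 -> (s *: a + y) 0 i != 0.
  move=> ai; apply/eqP => h; apply: nS; exists i => //=.
  by apply: (mulIf ai); rewrite mulfVK//; move: h; rewrite !mxE => h; lra.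
pose f i (s : R) := wexp r ((s *: a + y) 0 i).
pose f' i := - (a 0 i * (r * phi r ((s *: a + y) 0 i))).
have df i : is_derive s 1 (f i) (f' i * f i s).
  rewrite /f' /f; have [ai|ai] := eqVneq (a 0 i) 0.
    rewrite ai mul0r oppr0 mul0r (_ : (fun _ => _) = cst (wexp r (y 0 i))).
      exact: is_derive_cst.
    by apply/funext => u; rewrite !mxE ai mulr0 add0r.
  have d0 := is_derive_wexp r (nz i ai).
  have d1 : is_derive s 1 (fun u : R => (u *: a + y) 0 i) (a 0 i).
    rewrite (_ : (fun _ => _) = (fun u : R => a 0 i *: u + y 0 i)).
      have d2 : is_derive s 1 (fun u : R => a 0 i *: u) (a 0 i *: 1) by exact: is_deriveZ.
      have d3 : is_derive s 1 ((fun u : R => a 0 i *: u) + cst (y 0 i)) (a 0 i *: 1 + 0).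
        exact: is_deriveD.
      by apply: is_derive_eq; rewrite addr0 -[_ *: 1]/(_ * 1) mulr1.
    by apply/funext => u; rewrite !mxE mulrC.
  have d2 : is_derive s 1 (wexp r \o (fun u : R => (u *: a + y) 0 i))
    (- (r * phi r ((s *: a + y) 0 i)) * wexp r ((s *: a + y) 0 i) * a 0 i).
    exact: is_derive1_comp.
  by apply: is_derive_eq; ring.
have := is_derive_prod_log (index_enum 'I_n) df.
by rewrite /dirK -mulNr -sumrN.
Qed.
Lemma measurable_dirK d (T : measurableType d) (R : realType) (r : R) n (a : 'rV[R]_n)
    (x : T -> 'rV[R]_n) :
  (forall i, measurable_fun setT (fun t => x t 0 i)) ->
  measurable_fun setT (fun t => dirK r a (x t)).
Proof.
move=> mx; apply: measurable_funM.
  apply: measurable_sum => i; apply: measurable_funM => //; apply: measurable_funM => //.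
  exact: measurableT_comp (measurable_phi r) (mx i).
rewrite (_ : (fun _ => _) = (fun t => expR (\sum_(i < n) - (`|x t 0 i| `^ r)))).
  apply: (measurableT_comp (@measurable_expR R)); apply: measurable_sum => i.
  apply: measurableT_comp => //; apply: (measurableT_comp (measurable_powR r)).
  exact: measurableT_comp.
by apply/funext => t; rewrite ewtE /hpow sumrN.
Qed.

Lemma ewt_line_max (R : realType) (r : R) n (a y : 'rV[R]_n) : 1 <= r -> a != 0 ->
  exists s0, (forall s, ewt r (s *: a + y) <= ewt r (s0 *: a + y)) /\
    (\int[lebesgue_measure]_s `|dirK r a (s *: a + y)|%:E = (2 * ewt r (s0 *: a + y))%:E)%E.
Proof.
move=> r1 a0.
have mf : measurable_fun setT (fun s : R => - dirK r a (s *: a + y)).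
  apply: measurableT_comp => //; apply: measurable_dirK => i.
  rewrite (_ : (fun _ => _) = (fun s => s * a 0 i + y 0 i)); last first.
    by apply/funext => s; rewrite !mxE.
  by apply: measurable_funD => //; apply: measurable_funM.
have [||||s0 [smax sint]] := integral_abs_derive_unimodal
  (fun u v => ewt_line_lipschitz a y u v r1) _ _ _ mf.
- by move=> s; exact: ewt_gt0.
- by move=> e e0; exact: ewt_line_cvg0.
- by move=> u v w; exact: ewt_line_quasiconcave.
- exact: ewt_line_derive.
by exists s0; split => //; rewrite -sint; apply: eq_integral => s _; rewrite normrN.
Qed.

Lemma hpow_scale (R : realType) (r c : R) n (x : 'rV[R]_n) : 0 <= c ->
  hpow r (c *: x) = c `^ r * hpow r x.
Proof.
move=> c0; rewrite /hpow mulr_sumr; apply: eq_bigr => i _.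
by rewrite mxE normrM powRM// ger0_norm.
Qed.

Lemma hpow_ge0 (R : realType) (r : R) n (x : 'rV[R]_n) : 0 <= hpow r x.
Proof. by apply: sumr_ge0 => i _; exact: powR_ge0. Qed.

Lemma lpball_fin (R : realType) (r : R) n : 0 < r ->
  lpball r%:E n = [set x | hpow r x <= 1].
Proof.
move=> r0; have one1 (u : R) : 1 = 1 `^ u :> R by rewrite powR1.
apply/seteqP; split => x; rewrite /lpball /= /lpnorm -/(hpow r x) => h.
- rewrite -(@powRr1 _ (hpow r x)) ?hpow_ge0//.
  rewrite -[X in _ `^ X <= _](@mulVf _ r) ?gt_eqF// powRrM [leRHS](one1 r).
  by apply: ge0_ler_powR; rewrite ?nnegrE ?powR_ge0// ltW.
- rewrite [leRHS](one1 r^-1); apply: ge0_ler_powR; rewrite ?nnegrE ?invr_ge0 ?hpow_ge0 ?(ltW r0)//.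
Qed.

Lemma orthoproj_preimage (R : realType) m (a : 'rV[R]_m.+1) (U : 'M[R]_(m, m.+1))
    (K : set 'rV[R]_m.+1) : dot a a = 1 -> orthonormal_hyperplane_basis a U ->
  [set t : m.-tuple R | (orthoproj a @` K) (trow t *m U)] =
  [set t | exists s, K (s *: a + trow t *m U)].
Proof.
move=> aa [UU Ua].
have dotUa t : dot (trow t *m U) a = 0.
  have := dot_mulmxtr (trow t *m U) a; rewrite -mulmxA Ua mulmx0.
  by move=> /matrixP/(_ 0 0); rewrite !mxE eqxx mulr1n.
apply/seteqP; split => t /=.
  move=> [x Kx]; rewrite /orthoproj aa divr1 => <-; exists (dot x a).
  by rewrite addrC subrK.
move=> [s Ks]; exists (s *: a + trow t *m U) => //.
rewrite /orthoproj aa divr1.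
have -> : dot (s *: a + trow t *m U) a = s.
  rewrite -[RHS]mulr1 -aa -[RHS]addr0 -(dotUa t) /dot mulr_sumr -big_split/=.
  by apply: eq_bigr => i _; rewrite !mxE; ring.
by rewrite addrC addKr.
Qed.

Lemma measurable_expRN2 (R : realType) :
  measurable_fun setT (fun v : R => 2 * expR (- v)).
Proof.
by apply: measurable_funM => //; apply: (measurableT_comp (@measurable_expR R)).
Qed.

Lemma integral_expRN (R : realType) (M : R) :
  (\int[@lebesgue_measure R]_(v in `[M, +oo[) (2 * expR (- v))%:E = (2 * expR (- M))%:E)%E.
Proof.
have d (x : R) : is_derive x 1 (fun v : R => - (2 * expR (- v))) (2 * expR (- x)).
  have d1 : is_derive x 1 (expR \o (fun v : R => - v)) (expR (- x) * - 1).
    exact: is_derive1_comp.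
  have d2 : is_derive x 1 (fun v : R => -2 *: (expR \o (fun v : R => - v)) v)
      (-2 *: (expR (- x) * - 1)) by exact: is_deriveZ.
  rewrite (_ : (fun _ => _) = (fun v : R => -2 *: (expR \o (fun v : R => - v)) v)).
    by apply: is_derive_eq; rewrite /GRing.scale/=; ring.
  by apply/funext => v; rewrite /GRing.scale/= mulNr.
have c : continuous (fun v : R => 2 * expR (- v)).
  move=> x; apply: cvgMr; apply: continuous_comp; first exact: continuousN.
  exact: continuous_expR.
rewrite (@ge0_continuous_FTC2y _ _ (fun v : R => - (2 * expR (- v))) M 0).
- by rewrite EFinN oppeK add0e.
- by move=> x _; rewrite mulr_ge0// expR_ge0.
- exact: continuous_subspaceT.
- rewrite -oppr0 -[X in _ --> - X](mulr0 2); apply: cvgN; apply: cvgMr; exact: cvgr_expR.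
- by move=> x _; have [] := d x.
- by apply: cvg_at_right_filter; apply: cvgN; exact: c.
- by move=> x _; rewrite derive1E; have /@derive_val := d x.
Qed.

(** The integral of the absolute derivative of [ewt] in the direction [a]: the side of Cauchy's
    formula that factorises over coordinates. *)
Definition Psi (R : realType) (r : R) n (a : 'rV[R]_n) : \bar R :=
  (\int[lebesgue_tuple R n]_x `|dirK r a (trow x)|%:E)%E.

(** Layer cake over the hyperplane. The line over a point t contributes [G t] = 2 exp(-M), where M
    is the least value of [hpow] on it, and this is the integral of 2 exp(-v) over v >= M. The
    points with M <= v form the projection of the ball of radius v^(1/r), whose measure is v^(m/r)
    times that of the projected unit ball. The remaining integral in v does not depend on [a]; it is
    left unevaluated because it cancels in ratios. *)
Lemma projvol_Psi (R : realType) (r : R) m (a : 'rV[R]_m.+1) : 1 <= r -> dot a a = 1 ->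
  (projvol r%:E a *
   (\int[@lebesgue_measure R]_(v in `]0%R, +oo[) (2 * expR (- v) * (v `^ r^-1) ^+ m)%:E)
   = Psi r a)%E.
Proof.
move=> r1 aa; have r0 : 0 < r by apply: lt_le_trans r1.
have a0 : a != 0.
  apply/eqP => a0; move: aa; rewrite a0 /dot.
  under eq_bigr do rewrite mxE mul0r.
  by rewrite sumr_const mul0rn => /eqP; rewrite eq_sym oner_eq0.
set U := hyperplane_basis a.
have oU : orthonormal_hyperplane_basis a U by exact: hyperplane_basisP.
pose S (v : R) := [set t : m.-tuple R | exists s, hpow r (s *: a + trow t *m U) <= v].
have -> : projvol r%:E a = lebesgue_tuple R m (S 1).
  rewrite /projvol /vol_hyperplane lpball_fin//; congr (lebesgue_tuple R m _).
  exact: (orthoproj_preimage (U := U)).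
pose f (z : R * m.-tuple R) : \bar R := `|dirK r a (z.1 *: a + trow z.2 *m U)|%:E.
have mf : measurable_fun setT f.
  apply/measurable_EFinP; apply: measurableT_comp => //; apply: measurable_dirK => i.
  rewrite (_ : (fun _ => _) = (fun x : R * m.-tuple R => x.1 * a 0 i + (trow x.2 *m U) 0 i)).
    apply: measurable_funD; first by apply: measurable_funM.
    exact: (measurableT_comp (measurable_trow_mul U i)).
  by apply/funext => x; rewrite !mxE.
have f0 z : (0 <= f z)%E by rewrite lee_fin.
pose G (t : m.-tuple R) : \bar R := (\int[@lebesgue_measure R]_s f (s, t))%E.
have mG : measurable_fun setT G.
  exact: (measurable_fun_fubini_tonelli_G (m1 := @lebesgue_measure R) f mf f0).
have GE t : exists s0, (forall s, ewt r (s *: a + trow t *m U) <= ewt r (s0 *: a + trow t *m U))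
    /\ G t = (2 * ewt r (s0 *: a + trow t *m U))%:E.
  exact: ewt_line_max.
have SE v t : S v t <-> ((2 * expR (- v))%:E <= G t)%E.
  have [s0 [smax ->]] := GE t; rewrite lee_fin ler_pM2l//; split.
    move=> [s hs]; apply: le_trans (smax s).
    by rewrite ewtE ler_expR lerN2.
  by move=> h; exists s0; move: h; rewrite ewtE ler_expR lerN2.
pose g t := fine (G t).
have gE t : G t = (g t)%:E by rewrite /g; have [s0 [_ ->]] := GE t.
have mg : measurable_fun setT g by exact: measurableT_comp.
pose Q := [set z : R * m.-tuple R | 2 * expR (- z.1) - g z.2 <= 0].
have mQ : measurable Q.
  apply: measurable_sublevel; apply: measurable_funB; last exact: measurableT_comp.
  apply: measurable_funM => //; apply: (measurableT_comp (@measurable_expR R)).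
  exact: measurableT_comp.
have QE v t : Q (v, t) <-> S v t.
  by rewrite SE gE lee_fin /Q /= subr_le0.
have mS v : measurable (S v).
  rewrite (_ : S v = [set t | 2 * expR (- v) - g t <= 0]).
    by apply: measurable_sublevel; apply: measurable_funB.
  by apply/seteqP; split => t; rewrite -QE.
have scaleS v : 0 < v ->
    (lebesgue_tuple R m (S v) = ((v `^ r^-1) ^+ m)%:E * lebesgue_tuple R m (S 1%R))%E.
  move=> v0; pose rho := v `^ r^-1.
  have rho0 : 0 < rho by exact: powR_gt0.
  have rhor : rho `^ r = v by rewrite /rho -powRrM mulVf ?gt_eqF// powRr1// ltW.
  have symC (t : m.-tuple R) : (forall i, `|tnth t i| <= 1) ->
      forall i, `|tnth (rtup (- trow t)) i| <= 1.
    by move=> h i; rewrite tnth_mktuple !mxE normrN.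
  have rho'0 : rho^-1 != 0 by rewrite invr_eq0 gt_eqF.
  (* The dilation by 1/rho is gauged by the cube of half-side 1, whose preimage is the cube of
     half-side rho. *)
  have := lebesgue_tuple_scale_cross rho'0 (measurable_cube 1) (mS 1) symC.
  have -> : [set t | S 1 (rtup (rho^-1 *: trow t))] = S v.
    apply/seteqP; split => t /=; rewrite /S /= rtupK => -[s hs].
      exists (rho * s).
      have -> : (rho * s) *: a + trow t *m U =
          rho *: (s *: a + (rho^-1 *: trow t) *m U).
        by rewrite -scalemxAl scalerDr !scalerA divff ?gt_eqF// scale1r.
      by rewrite hpow_scale ?(ltW rho0)// rhor ler_piMr// ltW.
    exists (rho^-1 * s).
    have -> : (rho^-1 * s) *: a + (rho^-1 *: trow t) *m U =
        rho^-1 *: (s *: a + trow t *m U).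
      by rewrite -scalemxAl scalerDr !scalerA.
    rewrite hpow_scale ?invr_ge0 ?(ltW rho0)// -powR_inv1 ?(ltW rho0)//.
    rewrite -powRrM mulN1r powRN rhor ler_pdivrMl// mulr1//.
  have -> : [set t : m.-tuple R | (fun u : m.-tuple R => forall i, `|tnth u i| <= 1)
        (rtup (rho^-1 *: trow t))] = [set t | forall i, `|tnth t i| <= rho].
    apply/seteqP; split => t /= h i; have := h i;
    by rewrite tnth_mktuple !mxE normrM normfV (gtr0_norm rho0) ler_pdivrMl// mulr1.
  rewrite !lebesgue_tuple_cube ?(ltW rho0)//.
  rewrite !exprMn expr1n mulr1 [in RHS]muleC EFinM => h.
  apply: (@mule_pIr R (2 ^+ m)%:E); rewrite ?lte_fin ?ltry ?exprn_gt0//.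
  by rewrite muleC h muleC -muleA [RHS]muleC -!muleA.
(* Only v > 0 is kept, where the scaling relation applies; as M >= 0, the part removed from {v >= M}
   is at most the single value v = 0. *)
pose Q0 := Q `&` (fst @^-1` `]0, +oo[%classic).
have mQ0 : measurable Q0.
  apply: measurableI => //; rewrite -[X in measurable X]setTI.
  by apply: measurable_fst => //; exact: measurable_itv.
pose k : R * m.-tuple R -> \bar R := (fun z => (2 * expR (- z.1))%:E) \_ Q0.
have k0 z : (0 <= k z)%E.
  by rewrite /k patchE; case: ifP => // _; rewrite lee_fin mulr_ge0// expR_ge0.
have mk : measurable_fun setT k.
  apply/(measurable_restrictT _ mQ0)/measurable_EFinP; apply: measurable_funTS.
  apply: measurable_funM => //; apply: (measurableT_comp (@measurable_expR R)).
  exact: measurableT_comp.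
have kG t : (\int[@lebesgue_measure R]_v k (v, t) = G t)%E.
  have [s0 [smax GtE]] := GE t; rewrite GtE ewtE.
  set M := hpow r _ in GtE *.
  have QM v : Q (v, t) <-> M <= v.
    by rewrite QE SE GtE lee_fin ler_pM2l// ewtE ler_expR lerN2.
  have M0 : 0 <= M by exact: hpow_ge0.
  rewrite (_ : (fun v => _) = (fun v => (2 * expR (- v))%:E) \_
      ([set v | M <= v] `&` `]0, +oo[%classic)); last first.
    apply/funext => v; rewrite /k !patchE /=; congr (if _ then _ else _).
    by apply/idP/idP; rewrite !inE => -[/= h1 h2]; split => //; exact/QM.
  rewrite -integral_mkcond.
  have [M_gt0|M_le0] := ltP 0 M.
    rewrite (_ : _ `&` _ = `[M, +oo[%classic) ?integral_expRN//.
    apply/seteqP; split => v /=; rewrite !in_itv/= !andbT; first by case.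
    by move=> h; split => //; exact: lt_le_trans h.
  have -> : M = 0 by apply/le_anti; rewrite M0 M_le0.
  rewrite (_ : _ `&` _ = `]0, +oo[%classic).
    by rewrite integral_itv_obnd_cbnd ?integral_expRN//; apply: measurable_funTS;
      apply/measurable_EFinP; exact: measurable_expRN2.
  apply/seteqP; split => v /=; rewrite !in_itv/= !andbT; first by case.
  by move=> h; split => //; exact: ltW.
rewrite /Psi (ge0_integral_hyperplane aa oU); last 2 first.
- apply/measurable_EFinP; apply: measurableT_comp => //; apply: measurable_dirK => i.
  by under eq_fun do rewrite mxE; exact: measurable_tnth.
- by move=> x; rewrite lee_fin.
transitivity (\int[lebesgue_tuple R m]_t \int[@lebesgue_measure R]_v k (v, t))%E; last first.
  apply: eq_integral => t _; rewrite kG /G; apply: eq_integral => s _.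
  by rewrite /f rtupK.
rewrite -(fubini_tonelli (m1 := @lebesgue_measure R) (m2 := lebesgue_tuple R m) k)//.
rewrite -ge0_integralZl//; last 2 first.
- apply: measurable_funTS; apply/measurable_EFinP; apply: measurable_funM.
    exact: measurable_expRN2.
  by apply: measurable_funX; exact: measurable_powR.
- by move=> v _; rewrite lee_fin !mulr_ge0 ?expR_ge0// exprn_ge0// powR_ge0.
rewrite integral_mkcond; apply: eq_integral => v _; rewrite patchE.
case: ifPn => [|nv].
  rewrite inE/= in_itv/= andbT => v0.
  rewrite (_ : (fun t => _) = (cst (2 * expR (- v))%:E) \_ (S v)); last first.
    apply/funext => t; rewrite /k !patchE /=; congr (if _ then _ else _).
    apply/idP/idP; rewrite !inE; first by move=> [/QE].
    by move=> /QE h; split => //=; rewrite in_itv/= v0.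
  rewrite -integral_mkcond integral_cst//.
  apply: etrans (congr1 (fun z => (2 * expR (- v))%:E * z)%E (esym (scaleS v v0))).
  by rewrite [LHS]muleC EFinM -muleA.
rewrite (_ : (fun t => _) = cst 0%E) ?integral0//.
apply/funext => t; rewrite /k patchE memNset// => -[_ /=]; rewrite in_itv/= andbT => h.
by move: nv; rewrite notin_setE /= in_itv/= andbT; apply.
Qed.

(** * Projections of the cube *)

Definition incube (R : realType) n (r : R) (x : 'rV[R]_n) : Prop := forall i, `|x 0 i| <= r.

(** The coordinates that move along the line bound the parameter s from both sides; the ends of the
    segment are the maximum [u] of the lower and the minimum [v] of the upper bounds. The last
    clause turns u <= v into finitely many inequalities affine in [y], from which the set of lines
    that meet the cube is seen to be measurable. *)
Lemma incube_line (R : realType) n (r : R) (a y : 'rV[R]_n) : (forall i, 0 <= a 0 i) ->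
  a != 0 -> exists u v,
    (forall s, incube r (s *: a + y) <->
       (forall i, a 0 i = 0 -> `|y 0 i| <= r) /\ u <= s <= v) /\
    (u <= v <-> forall i j, 0 < a 0 i -> 0 < a 0 j ->
       (- r - y 0 i) * a 0 j <= (r - y 0 j) * a 0 i).
Proof.
move=> a0 an0.
have [i0 ai0] : exists i, 0 < a 0 i.
  apply/existsP; apply: contraR an0 => /existsPn h; apply/eqP/rowP => i; rewrite mxE.
  by apply/eqP; rewrite eq_le a0 andbT leNgt; exact: h.
pose lo i := (- r - y 0 i) / a 0 i; pose hi i := (r - y 0 i) / a 0 i.
pose i1 := [arg max_(i > i0 | 0 < a 0 i) lo i]%O.
pose j1 := [arg min_(i < i0 | 0 < a 0 i) hi i]%O.
have [ai1 lomax] : 0 < a 0 i1 /\ forall i, 0 < a 0 i -> lo i <= lo i1.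
  by rewrite /i1; case: arg_maxP.
have [aj1 himin] : 0 < a 0 j1 /\ forall i, 0 < a 0 i -> hi j1 <= hi i.
  by rewrite /j1; case: arg_minP.
exists (lo i1), (hi j1); split.
  move=> s; split.
    move=> h; split.
      by move=> i ai; have := h i; rewrite !mxE ai mulr0 add0r.
    rewrite /lo /hi ler_pdivrMr// ler_pdivlMr//; apply/andP; split.
      by have := h i1; rewrite !mxE ler_norml => /andP[]; lra.
    by have := h j1; rewrite !mxE ler_norml => /andP[]; lra.
  move=> [h0 /andP[h1 h2]] i; rewrite !mxE.
  have := a0 i; rewrite le_eqVlt => /predU1P[ai|ai].
    by rewrite -ai mulr0 add0r; apply: h0.
  have := le_trans (lomax _ ai) h1; have := le_trans h2 (himin _ ai).
  by rewrite /lo /hi ler_pdivrMr// ler_pdivlMr// ler_norml; lra.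
split => [uv i j ai aj|h].
  have := le_trans (le_trans (lomax _ ai) uv) (himin _ aj).
  by rewrite /lo /hi ler_pdivrMr// mulrAC ler_pdivlMr.
by rewrite /lo /hi ler_pdivrMr// mulrAC ler_pdivlMr//; apply: h.
Qed.

Lemma bigmax_le1 (R : realType) n (x : 'rV[R]_n) :
  \big[Num.max/0]_(i < n) `|x 0 i| <= 1 <-> incube 1 x.
Proof.
split => [h i|h]; last by apply/bigmax_leP; split.
by move/bigmax_leP : h => [_]; apply.
Qed.

Lemma measurable_incube d (T : measurableType d) (R : realType) n (r : R) (x : T -> 'rV[R]_n) :
  (forall i, measurable_fun setT (fun t => x t 0 i)) -> measurable [set t | incube r (x t)].
Proof.
move=> mx; rewrite (_ : mkset _ = \bigcap_(i in [set: 'I_n]) [set t | `|x t 0 i| <= r]).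
  apply: fin_bigcap_measurable => // i _; apply: measurable_sublevel.
  exact: measurableT_comp.
by apply/seteqP; split => t /= h i; [move=> _|]; exact: h.
Qed.

(** These are the points of the cube pushed out of it by the shift [e *: a]. The points that stay
    form a box with side 2r - e a_i in the i-th coordinate. *)
Lemma lebesgue_tuple_cube_slab (R : realType) n (r e : R) (a : 'rV[R]_n) :
  0 < e <= r -> (forall i, 0 <= a 0 i <= 1) ->
  lebesgue_tuple R n [set x | incube r (trow x) /\ ~ incube r (e *: a + trow x)] =
  ((2 * r) ^+ n - \prod_(i < n) (2 * r - e * a 0 i))%:E.
Proof.
move=> /andP[e0 er] a01; have r0 : 0 < r by apply: lt_le_trans er.
have mC : measurable [set x : n.-tuple R | incube r (trow x)].
  by apply: measurable_incube => i; under eq_fun do rewrite mxE; exact: measurable_tnth.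
have mD : measurable [set x : n.-tuple R | incube r (e *: a + trow x)].
  apply: measurable_incube => i; under eq_fun do rewrite !mxE.
  by apply: measurable_funD => //; exact: measurable_tnth.
rewrite (_ : mkset _ = [set x | incube r (trow x)] `\` [set x | incube r (e *: a + trow x)])//.
have cubeE : lebesgue_tuple R n [set x | incube r (trow x)] = ((2 * r) ^+ n)%:E.
  rewrite -lebesgue_tuple_cube ?(ltW r0)//; congr (lebesgue_tuple R n _).
  by apply/seteqP; split => x /= h i; have := h i; rewrite mxE.
rewrite measureD//=; last by rewrite [ltLHS]cubeE ltry.
rewrite [X in (X - _)%E]cubeE EFinB; congr (_ - _)%E.
rewrite (_ : _ `&` _ = [set t | forall i, `[- r, r - e * a 0 i]%classic (tnth t i)]).
  rewrite (lebesgue_tuple_box (A := fun i => `[- r, r - e * a 0 i]%classic)) => [|i]; last first.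
    exact: measurable_itv.
  rewrite -prodEFin; apply: eq_bigr => i _.
  have /andP[ai0 ai1] := a01 i.
  have ea : e * a 0 i <= r by apply: le_trans er; rewrite ler_piMr// ltW.
  rewrite lebesgue_measure_itv/= lte_fin -EFinD; case: ltP; first by move=> _; congr EFin; ring.
  by move=> h; congr EFin; lra.
apply/seteqP; split => t /=.
  move=> [h1 h2] i; have := h1 i; have := h2 i; rewrite !mxE in_itv/= !ler_norml.
  by move=> /andP[_ ?] /andP[? _]; apply/andP; split; lra.
move=> h; split => i; have := h i; have /andP[ai0 _] := a01 i;
  have ea : 0 <= e * a 0 i by [rewrite mulr_ge0 ?(ltW e0)];
  by rewrite !mxE in_itv/= ler_norml => /andP[? ?]; apply/andP; split; lra.
Qed.

Lemma is_derive_prod_affine (R : realType) n (c : 'I_n -> R) :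
  is_derive (0 : R) 1 (fun u => \prod_(i < n) (2 + u * c i)) ((\sum_(i < n) c i / 2) * 2 ^+ n).
Proof.
have df i : is_derive (0 : R) 1 (fun u : R => 2 + u * c i) (c i / 2 * (2 + 0 * c i)).
  have d1 : is_derive (0 : R) 1 (fun u : R => c i *: u) (c i *: 1) by exact: is_deriveZ.
  have d2 : is_derive (0 : R) 1 (cst 2 + (fun u : R => c i *: u)) (0 + c i *: 1).
    exact: is_deriveD.
  rewrite (_ : (fun _ => _) = cst 2 + (fun u : R => c i *: u)).
    by apply: is_derive_eq; rewrite mul0r addr0 add0r mulfVK ?pnatr_eq0// -[_ *: 1]/(_ * 1) mulr1.
  by apply/funext => u; rewrite mulrC.
have := is_derive_prod_log (index_enum 'I_n) df.
rewrite [X in _ * X](eq_bigr (fun=> 2)) => [|i _]; last by rewrite mul0r addr0.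
by rewrite prodr_const card_ord.
Qed.

(** To first order, the volume lost by the shift [e *: a] is e times the volume of the projection. A
    line parallel to [a] meets the slab in a length at most e, and exactly e when it runs in the
    cube for at least that long. The slab of the unit cube therefore has volume at most e |S|; the
    slab of the cube of half-side 1 + e, in which every line meeting the unit cube runs for at least
    e, has volume at least e |S|. After division by e both bounds tend to derivatives at 0 of
    products of affine functions. *)
Lemma projvol_infty (R : realType) m (a : 'rV[R]_m.+1) : dot a a = 1 ->
  (forall i, 0 <= a 0 i) -> projvol +oo%E a = (2 ^+ m * \sum_i a 0 i)%:E.
Proof.
move=> aa age0.
have a1 i : 0 <= a 0 i <= 1.
  rewrite age0/= -(@ler_pXn2r _ 2) ?nnegrE// expr1n -aa /dot (bigD1 i)//= -expr2 lerDl.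
  by apply: sumr_ge0 => j _; rewrite -expr2 sqr_ge0.
have a0 : a != 0.
  apply/eqP => a0; move: aa; rewrite a0 /dot.
  under eq_bigr do rewrite mxE mul0r.
  by rewrite sumr_const mul0rn => /eqP; rewrite eq_sym oner_eq0.
set U := hyperplane_basis a.
have oU : orthonormal_hyperplane_basis a U by exact: hyperplane_basisP.
pose S := [set t : m.-tuple R | exists s, incube 1 (s *: a + trow t *m U)].
have -> : projvol +oo%E a = lebesgue_tuple R m S.
  rewrite /projvol /vol_hyperplane; congr (lebesgue_tuple R m _).
  rewrite [LHS](orthoproj_preimage (U := U))//.
  by apply/seteqP; split => t [s hs]; exists s; apply/bigmax_le1.
pose D r e (t : m.-tuple R) := lebesgue_measure
  [set s : R | incube r (s *: a + trow t *m U) /\ ~ incube r (e *: a + (s *: a + trow t *m U))].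
pose B' r e := [set z : R * m.-tuple R | incube r (z.1 *: a + trow z.2 *m U) /\
   ~ incube r (e *: a + (z.1 *: a + trow z.2 *m U))].
have mB' r e : measurable (B' r e).
  have mz i : measurable_fun setT (fun z : R * m.-tuple R => (z.1 *: a + trow z.2 *m U) 0 i).
    rewrite (_ : (fun _ => _) = (fun x : R * m.-tuple R => x.1 * a 0 i + (trow x.2 *m U) 0 i)).
      apply: measurable_funD; first by apply: measurable_funM.
      exact: (measurableT_comp (measurable_trow_mul U i)).
    by apply/funext => x; rewrite !mxE.
  rewrite (_ : B' r e = [set z : R * m.-tuple R | incube r (z.1 *: a + trow z.2 *m U)] `\`
     [set z | incube r (e *: a + (z.1 *: a + trow z.2 *m U))])//.
  apply: measurableD; apply: measurable_incube => // i.
  rewrite (_ : (fun _ => _) = (fun z : R * m.-tuple R => e * a 0 i + (z.1 *: a + trow z.2 *m U) 0 i)).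
    by apply: measurable_funD.
  by apply/funext => z; rewrite !mxE.
have msl r e t : measurable [set s : R | incube r (s *: a + trow t *m U) /\
    ~ incube r (e *: a + (s *: a + trow t *m U))].
  have := measurable_ysection t (mB' r e).
  by congr (measurable _); apply/seteqP; split => s; rewrite /ysection /= inE.
have DE r e : 0 < e <= r ->
    measurable_fun setT (D r e) /\
    (\int[lebesgue_tuple R m]_t D r e t = ((2 * r) ^+ m.+1 - \prod_i (2 * r - e * a 0 i))%:E)%E.
  move=> er; rewrite -lebesgue_tuple_cube_slab//.
  pose B := [set x : m.+1.-tuple R | incube r (trow x) /\ ~ incube r (e *: a + trow x)].
  have mB : measurable B.
    rewrite (_ : B = [set x | incube r (trow x)] `\` [set x | incube r (e *: a + trow x)])//.
    apply: measurableD; apply: measurable_incube => i; under eq_fun do rewrite !mxE.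
      exact: measurable_tnth.
    by apply: measurable_funD => //; exact: measurable_tnth.
  have DB t : D r e t = (\int[@lebesgue_measure R]_s (\1_B (rtup (s *: a + trow t *m U)))%:E)%E.
    rewrite -[LHS]mul1e -integral_cst_indic//; last exact: msl.
    apply: eq_integral => s _; rewrite mul1e; congr EFin; rewrite !indicE.
    congr (_%:R); apply: congr1.
    by apply/idP/idP; rewrite !inE /B /= rtupK.
  split.
    apply: eq_measurable_fun (measurable_fun_ysection (@lebesgue_measure R) (mB' r e)) => t _ /=.
    by congr lebesgue_measure; apply/seteqP; split => s; rewrite /ysection /= inE.
  under eq_integral do rewrite DB.
  rewrite -(ge0_integral_hyperplane aa oU (F := fun x => (\1_B x)%:E))//.
    by rewrite integral_indic// setIT.
  exact/measurable_EFinP.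
have mS : measurable S.
  pose mk (P : m.-tuple R -> Prop) := measurable [set t | P t].
  have my i : measurable_fun setT (fun t : m.-tuple R => (trow t *m U) 0 i).
    exact: measurable_trow_mul.
  rewrite (_ : S = (\bigcap_(i in [set i | a 0 i = 0]) [set t | `|(trow t *m U) 0 i| <= 1]) `&`
    \bigcap_(ij in [set ij : 'I_m.+1 * 'I_m.+1 | 0 < a 0 ij.1 /\ 0 < a 0 ij.2])
      [set t | (-1 - (trow t *m U) 0 ij.1) * a 0 ij.2 - (1 - (trow t *m U) 0 ij.2) * a 0 ij.1 <= 0]).
    apply: measurableI; apply: fin_bigcap_measurable => //.
    - by move=> i _; apply: measurable_sublevel; exact: measurableT_comp.
    - move=> ij _; apply: measurable_sublevel; apply: measurable_funB;
      by apply: measurable_funM => //; apply: measurable_funB.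
  apply/seteqP; split => t.
    move=> [s]; have [u [v [I uv]]] := incube_line 1 (trow t *m U) age0 a0.
    move=> /I[C /andP[us sv]]; split; first exact: C.
    move=> [i j] /= [ai aj]; rewrite subr_le0; apply: uv.1 => //; exact: le_trans sv.
  move=> [C h]; have [u [v [I uv]]] := incube_line 1 (trow t *m U) age0 a0.
  exists u; apply/I; split => //; rewrite lexx/=; apply/uv => i j ai aj.
  by have := h (i, j); rewrite /= subr_le0; apply.
have lower e : 0 < e <= 1 ->
    ((2 ^+ m.+1 - \prod_i (2 - e * a 0 i))%:E <= e%:E * lebesgue_tuple R m S)%E.
  move=> e01; have [mD] := DE 1 e e01; rewrite mulr1 => <-.
  have e0 : 0 < e by case/andP: e01.
  rewrite -integral_cst_indic ?lee_fin ?(ltW e0)//.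
  apply: ge0_le_integral => //.
  - by apply/measurable_EFinP; apply: measurable_funM.
  move=> t _; have [u [v [I uv]]] := incube_line 1 (trow t *m U) age0 a0.
  rewrite indicE; have [tS|tS] := boolP (t \in S).
    rewrite mule1; apply: (@le_trans _ _ (lebesgue_measure `]v - e, v]%classic)).
      apply: le_measure; rewrite ?inE//.
        exact: msl.
      move=> s [/= /I[C /andP[us sv]] h]; rewrite in_itv/= sv andbT ltNge; apply/negP => sve.
      apply: h; rewrite addrA -scalerDl; apply/I; split => //; lra.
    rewrite lebesgue_measure_itv/= lte_fin; case: ifP => _; last by rewrite lee_fin ltW.
    by rewrite -EFinD lee_fin; lra.
  rewrite /D (_ : mkset _ = set0) ?measure0 ?mule0//.
  apply/seteqP; split => // s [h _]; move/negP: tS; apply; rewrite inE; by exists s.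
have upper e : 0 < e ->
    (e%:E * lebesgue_tuple R m S <= ((2 * (1 + e)) ^+ m.+1 - \prod_i (2 * (1 + e) - e * a 0 i))%:E)%E.
  move=> e0; have er : 0 < e <= 1 + e by rewrite e0 lerDr ler01.
  have [mD <-] := DE _ _ er.
  rewrite -integral_cst_indic ?lee_fin ?(ltW e0)//.
  apply: ge0_le_integral => //.
  - by move=> x _; rewrite -EFinM lee_fin mulr_ge0 ?(ltW e0)// indicE.
  - by apply/measurable_EFinP; apply: measurable_funM.
  move=> t _; rewrite indicE; have [tS|tS] := boolP (t \in S); last by rewrite mule0.
  have [u [v [I uv]]] := incube_line (1 + e) (trow t *m U) age0 a0.
  move: tS; rewrite inE => -[s hs].
  have h1 : incube (1 + e) (s *: a + trow t *m U) by move=> i; apply: le_trans (hs i) _; rewrite lerDl ltW.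
  (* The coordinates of a unit vector are at most 1, so a shift by e along [a] moves each coordinate
     by at most e: the segment in the larger cube has length at least e. *)
  have h2 : incube (1 + e) ((s + e) *: a + trow t *m U).
    move=> i; rewrite scalerDl addrAC mxE; apply: le_trans (ler_normD _ _) _.
    apply: lerD; first exact: hs.
    by have /andP[ai0 ai1] := a1 i; rewrite mxE ger0_norm ?mulr_ge0 ?(ltW e0)// ler_piMr// ltW.
  have /I [C /andP[us sv]] := h1; have /I [_ /andP[use sve]] := h2.
  rewrite mule1; apply: (@le_trans _ _ (lebesgue_measure `]v - e, v]%classic)).
    by rewrite lebesgue_measure_itv/= lte_fin ifT -?EFinD ?lee_fin; lra.
  apply: le_measure; rewrite ?inE//.
    exact: msl.
  move=> w /=; rewrite in_itv/= => /andP[w1 w2]; split; first by apply/I; split => //; lra.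
  rewrite addrA -scalerDl => /I[_ /andP[_]]; lra.
have Soo : lebesgue_tuple R m S \is a fin_num.
  rewrite ge0_fin_numE//; have := upper _ ltr01; rewrite mul1e => h.
  by apply: le_lt_trans h _; rewrite ltry.
rewrite -(fineK Soo); set x := fine _; congr EFin.
have hne n : (harmonic n : R) != 0 by rewrite /harmonic/= invr_eq0 pnatr_eq0.
have hgt n : 0 < (harmonic n : R) by rewrite /harmonic/= invr_gt0.
have hle n : (harmonic n : R) <= 1 by rewrite /harmonic/= invf_le1// ler1n.
have e20 : 2 ^+ m.+1 = 2 * 2 ^+ m :> R by rewrite exprS.
apply/le_anti/andP; split.
  have dP := is_derive_prod_affine (fun i : 'I_m.+1 => 2 : R).
  have dQ := is_derive_prod_affine (fun i : 'I_m.+1 => 2 - a 0 i).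
  have /(_ _) c := cvgB (is_derive_cvg_seq dP hne (@cvg_harmonic R))
                 (is_derive_cvg_seq dQ hne (@cvg_harmonic R)).
  have -> : 2 ^+ m * \sum_i a 0 i = (\sum_(i < m.+1) 2 / 2) * 2 ^+ m.+1
        - (\sum_(i < m.+1) (2 - a 0 i) / 2) * 2 ^+ m.+1.
    rewrite -mulrBl -sumrB e20 mulrA [LHS]mulrC; congr (_ * _).
    by rewrite mulr_suml; apply: eq_bigr => i _; field.
  rewrite -(cvg_lim _ c)//; apply: limr_ge; first by apply/cvg_ex; eexists; exact: c.
  apply: nearW => n; pose e : R := harmonic n.
  suff : x <= e^-1 * (\prod_(i < m.+1) (2 + (e + 0) * 2) - \prod_(i < m.+1) (2 + 0 * 2))
    - e^-1 * (\prod_i (2 + (e + 0) * (2 - a 0 i)) - \prod_i (2 + 0 * (2 - a 0 i))) by [].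
  have := upper e (hgt n); rewrite -(fineK Soo) -/x -EFinM lee_fin => h.
  rewrite -mulrBr ler_pdivlMl ?hgt// (le_trans h)// addr0 le_eqVlt; apply/orP; left; apply/eqP.
  have z k (b : 'I_k -> R) : \prod_(i < k) (2 + 0 * b i) = 2 ^+ k.
    by under eq_bigr do rewrite mul0r addr0; rewrite prodr_const card_ord.
  rewrite !z opprB addrA subrK; congr (_ - _).
    by rewrite prodr_const card_ord; congr (_ ^+ _); ring.
  by apply: eq_bigr => i _; ring.
have dQ := is_derive_prod_affine (fun i : 'I_m.+1 => - a 0 i).
have /(_ _) c := cvgN (is_derive_cvg_seq dQ hne (@cvg_harmonic R)).
have -> : 2 ^+ m * \sum_i a 0 i = - ((\sum_(i < m.+1) (- a 0 i) / 2) * 2 ^+ m.+1).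
  rewrite -mulNr -sumrN e20 mulrA [LHS]mulrC; congr (_ * _).
  by rewrite mulr_suml; apply: eq_bigr => i _; field.
rewrite -(cvg_lim _ c)//; apply: limr_le; first by apply/cvg_ex; eexists; exact: c.
apply: nearW => n; pose e : R := harmonic n.
suff : - (e^-1 * (\prod_i (2 + (e + 0) * - a 0 i) - \prod_i (2 + 0 * - a 0 i))) <= x by [].
have e01 : 0 < e <= 1 by rewrite hgt hle.
have := lower e e01; rewrite -(fineK Soo) -/x -EFinM lee_fin => h.
rewrite -mulrN ler_pdivrMl ?hgt// (le_trans _ h)// addr0 opprB.
have z k (b : 'I_k -> R) : \prod_(i < k) (2 + 0 * b i) = 2 ^+ k.
  by under eq_bigr do rewrite mul0r addr0; rewrite prodr_const card_ord.
rewrite z lerD2l lerN2 le_eqVlt; apply/orP; left; apply/eqP.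
by apply: eq_bigr => i _; ring.
Qed.

(** * Expectations of functions of [phi r] under the weight [wexp r] *)

Lemma phi0 (R : realType) (r : R) : phi r 0 = 0.
Proof. by rewrite /phi sgr0 mul0r. Qed.

Lemma phiN (R : realType) (r x : R) : phi r (- x) = - phi r x.
Proof. by rewrite /phi sgrN normrN mulNr. Qed.

Lemma wexpN (R : realType) (r x : R) : wexp r (- x) = wexp r x.
Proof. by rewrite /wexp normrN. Qed.

Lemma phi_bound (R : realType) (r x : R) : 1 <= r -> `|phi r x| <= 1 + `|x| `^ r.
Proof.
move=> r1; have [->|x0] := eqVneq x 0; first by rewrite phi0 normr0 addr_ge0 ?powR_ge0.
rewrite /phi normrM normr_sg x0 mul1r ger0_norm ?powR_ge0//.
have [x1|x1] := leP `|x| 1.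
  apply: (@le_trans _ _ 1); last by rewrite lerDl powR_ge0.
  by rewrite -[leRHS](powRr0 `|x|); apply: ger_powR; rewrite ?normr_gt0 ?x0// subr_ge0.
apply: (@le_trans _ _ (`|x| `^ r)); last by rewrite lerDr.
by apply: ler_powR; rewrite ?ltW// ltrBlDr ltrDl.
Qed.

(** The sixth power is the growth allowed by [admissible]. It is absorbed by z^6 / 6! <= exp(z) with
    z = (1 + y) / 2, at the cost of half of the decay exp(-y); the other half is bounded by a
    multiple of exp(-|x| / 2) because |x| <= 1 + y. *)
Lemma wexp_le_expR (R : realType) : exists2 C : R, 0 <= C &
  forall r x : R, 1 <= r ->
    (1 + (1 + `|x| `^ r) ^+ 6) * wexp r x <= C * expR (- (2^-1 * `|x|)).
Proof.
pose K : R := 2 ^+ 6 * 6`!%:R.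
have K0 : 0 <= K by rewrite mulr_ge0// exprn_ge0.
exists ((1 + K) * expR 1); first by rewrite mulr_ge0 ?expR_ge0// addr_ge0.
move=> r x r1; rewrite /wexp; set y := `|x| `^ r.
have y0 : 0 <= y by exact: powR_ge0.
have xy : `|x| <= 1 + y.
  have [x1|x1] := leP `|x| 1; first by rewrite (le_trans x1)// lerDl.
  by rewrite (le_trans (le1r_powR (ltW x1) r1))// lerDr.
have z0 : 0 <= 2^-1 * (1 + y) by rewrite mulr_ge0// addr_ge0.
have e1 : (1 + y) ^+ 6 <= K * expR (2^-1 * (1 + y)).
  have := expR_ge1Dxn 5 z0; set e := expR _; rewrite exprMn => h.
  have -> : (1 + y) ^+ 6 = K * ((2^-1 ^+ 6 * (1 + y) ^+ 6) / 6`!%:R).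
    by rewrite /K; field; rewrite pnatr_eq0.
  by rewrite ler_wpM2l//; apply: le_trans h; rewrite lerDr.
have e2 : 1 + (1 + y) ^+ 6 <= (1 + K) * expR (2^-1 * (1 + y)).
  by rewrite mulrDl lerD// mul1r -[leLHS]expR0 ler_expR.
apply: (@le_trans _ _ ((1 + K) * expR (2^-1 * (1 + y)) * expR (- y))).
  by rewrite ler_wpM2r// expR_ge0.
rewrite -!mulrA -!expRD ler_wpM2l ?addr_ge0// ler_expR; lra.
Qed.

Lemma lebesgue_oppr (R : realType) (f : R -> \bar R) : measurable_fun setT f ->
  (\int[@lebesgue_measure R]_x f (- x)%R = \int[@lebesgue_measure R]_x f x)%E.
Proof.
have pos (g : R -> \bar R) : measurable_fun setT g -> (forall x, 0 <= g x)%E ->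
    (\int[@lebesgue_measure R]_x g (- x)%R = \int[@lebesgue_measure R]_x g x)%E.
  move=> mg g0; rewrite -[RHS](@ge0_integral_affine R (-1) 0)// normrN1 mul1e.
  by apply: eq_integral => x _; rewrite mulN1r addr0.
move=> mf; rewrite integralE [RHS]integralE; congr (_ - _)%E.
- apply: etrans (pos _ (measurable_funepos mf) (funepos_ge0 f)).
  by apply: eq_integral => x _; rewrite !funeposE.
- apply: etrans (pos _ (measurable_funeneg mf) (funeneg_ge0 f)).
  by apply: eq_integral => x _; rewrite !funenegE.
Qed.

Lemma integrable_oppr (R : realType) (f : R -> \bar R) :
  (@lebesgue_measure R).-integrable setT f ->
  (@lebesgue_measure R).-integrable setT (fun x => f (- x)).
Proof.
move=> /integrableP[mf foo]; apply/integrableP; split.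
  exact: (measurableT_comp mf).
rewrite (lebesgue_oppr (f := fun x => `|f x|%E))//.
exact: measurableT_comp.
Qed.

Lemma integrable_expRN_normr (R : realType) :
  (@lebesgue_measure R).-integrable setT (fun x => (expR (- (2^-1 * `|x|)))%:E).
Proof.
have r0 : (0 : R) < 2^-1 by rewrite invr_gt0.
have i1 := integrable_exponential_pdf r0.
have i2 := integrable_oppr i1.
have i3 := integrableD measurableT i1 i2.
have i4 := integrableZl measurableT 2 i3.
apply: le_integrable i4 => //.
  apply/measurable_EFinP; apply: (measurableT_comp (@measurable_expR R)).
  by apply: measurableT_comp => //; apply: measurable_funM => //; exact: measurableT_comp.
move=> x _; rewrite /comp -EFinD -EFinM lee_fin.
have p1 := exponential_pdf_ge0 (ltW r0) x; have p2 := exponential_pdf_ge0 (ltW r0) (- x).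
rewrite ger0_norm ?expR_ge0// ger0_norm; last by rewrite mulr_ge0// addr_ge0.
have key y : 0 <= y -> expR (- (2^-1 * y)) = 2 * exponential_pdf (2^-1) y.
  by move=> y0; rewrite exponential_pdfE//= mulrA mulfV// mul1r mulNr.
have [x0|/ltW x0] := leP 0 x.
  by rewrite ger0_norm// key// ler_pM2l// lerDl.
by rewrite ler0_norm// key ?oppr_ge0// ler_pM2l// lerDr.
Qed.

(** The class of test functions, the same for all exponents r. Degree 6 is what the third moment of
    the mixing law requires, since the mixing variable scales like the square of the argument. *)
Definition admissible (R : realType) (k : R -> R) : Prop :=
  measurable_fun setT k /\ exists C, forall u, `|k u| <= C * (1 + `|u| ^+ 6).

Lemma integrable_admissible (R : realType) (r : R) (k : R -> R) : 1 <= r -> admissible k ->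
  (@lebesgue_measure R).-integrable setT (fun x => (k (phi r x) * wexp r x)%:E).
Proof.
move=> r1 [mk [C kC]].
have C0 : 0 <= C.
  by have := kC 0; rewrite normr0 expr0n addr0 mulr1; apply: le_trans.
have [D D0 wD] := @wexp_le_expR R.
have i1 := integrableZl measurableT (C * D) (integrable_expRN_normr R).
apply: le_integrable i1 => //.
  apply/measurable_EFinP; apply: measurable_funM; last exact: measurable_wexp.
  exact: (measurableT_comp mk (measurable_phi r)).
move=> x _; rewrite -EFinM lee_fin [leLHS]normrM (ger0_norm (ltW (wexp_gt0 r x))).
rewrite [leRHS]ger0_norm; last by rewrite !mulr_ge0// expR_ge0.
rewrite -mulrA; apply: le_trans (ler_wpM2l C0 (wD r x r1)).
rewrite mulrA ler_wpM2r ?(ltW (wexp_gt0 _ _))//.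
apply: (le_trans (kC _)); rewrite ler_wpM2l// lerD2l.
by rewrite lerXn2r ?nnegrE ?addr_ge0 ?powR_ge0// phi_bound.
Qed.

HB.lock Definition Zw (R : realType) (r : R) : R := \int[@lebesgue_measure R]_x wexp r x.

HB.lock Definition Ew (R : realType) (r : R) (k : R -> R) : R :=
  (\int[@lebesgue_measure R]_x (k (phi r x) * wexp r x)) / Zw r.

Lemma admissible_cst (R : realType) (c : R) : admissible (cst c).
Proof.
split => //; exists `|c| => u; rewrite ler_peMr// lerDl.
by rewrite exprn_ge0.
Qed.

Lemma integrable_wexp (R : realType) (r : R) : 1 <= r ->
  (@lebesgue_measure R).-integrable setT (fun x => (wexp r x)%:E).
Proof.
move=> r1; have := integrable_admissible r1 (@admissible_cst R 1).
by under eq_fun do rewrite mul1r.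
Qed.

Lemma Zw_gt0 (R : realType) (r : R) : 1 <= r -> 0 < Zw r.
Proof.
move=> r1; have i := integrable_wexp r1.
have l01 : @lebesgue_measure R `[0, 1]%classic = 1%E.
  by rewrite lebesgue_measure_itv/= lte_fin ltr01 oppr0 adde0.
rewrite Zw.unlock; apply: (@lt_le_trans _ _ (\int[@lebesgue_measure R]_x (expR (-1) * \1_(`[0, 1]%classic) x))).
  rewrite /Rintegral; under eq_integral do rewrite EFinM.
  rewrite integral_cst_indic ?lee_fin ?expR_ge0//.
  by rewrite [X in fine (_ * X)]l01 mule1/= expR_gt0.
apply: le_Rintegral => //.
  have := @integrable_indic_itv R 0 1 true false.
  by move=> /(integrableZl measurableT (expR (-1))).
move=> x _; rewrite indicE; have [|_] := boolP (x \in _); last by rewrite mulr0 ltW// wexp_gt0.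
rewrite inE/= in_itv/= => /andP[x0 x1]; rewrite mulr1 /wexp ler_expR lerN2 ger0_norm//.
have -> : 1 = 1 `^ r :> R by rewrite powR1.
by apply: ge0_ler_powR; rewrite ?nnegrE// (le_trans _ r1).
Qed.
Lemma admissibleD (R : realType) (k l : R -> R) :
  admissible k -> admissible l -> admissible (fun u => k u + l u).
Proof.
move=> [mk [C kC]] [ml [D lD]]; split; first exact: measurable_funD.
exists (C + D) => u; rewrite mulrDl; apply: (le_trans (ler_normD _ _)).
by rewrite lerD.
Qed.

Lemma admissibleZ (R : realType) (c : R) (k : R -> R) :
  admissible k -> admissible (fun u => c * k u).
Proof.
move=> [mk [C kC]]; split; first exact: measurable_funM.
by exists (`|c| * C) => u; rewrite normrM -mulrA ler_wpM2l.
Qed.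

Lemma EwD (R : realType) (r : R) (k l : R -> R) : 1 <= r -> admissible k -> admissible l ->
  Ew r (fun u => k u + l u) = Ew r k + Ew r l.
Proof.
move=> r1 ak al; rewrite !Ew.unlock -mulrDl -RintegralD//; last 2 first.
- exact: integrable_admissible.
- exact: integrable_admissible.
by congr (_ / _); apply: eq_Rintegral => x _; rewrite /= mulrDl.
Qed.

Lemma EwZ (R : realType) (r c : R) (k : R -> R) : 1 <= r -> admissible k ->
  Ew r (fun u => c * k u) = c * Ew r k.
Proof.
move=> r1 ak; rewrite !Ew.unlock mulrA -RintegralZl//; last exact: integrable_admissible.
by congr (_ / _); apply: eq_Rintegral => x _; rewrite /= mulrA.
Qed.

Lemma Ew_cst (R : realType) (r c : R) : 1 <= r -> Ew r (cst c) = c.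
Proof.
move=> r1; rewrite Ew.unlock RintegralZl//; last exact: integrable_wexp.
have -> : \int[@lebesgue_measure R]_x wexp r x = Zw r by rewrite Zw.unlock.
by rewrite mulfK// gt_eqF// Zw_gt0.
Qed.

Lemma Ew_le (R : realType) (r : R) (k l : R -> R) : 1 <= r -> admissible k -> admissible l ->
  (forall u, k u <= l u) -> Ew r k <= Ew r l.
Proof.
move=> r1 ak al kl; rewrite !Ew.unlock ler_pM2r ?invr_gt0 ?Zw_gt0//.
apply: le_Rintegral => //; [exact: integrable_admissible|exact: integrable_admissible|].
by move=> x _; rewrite ler_wpM2r// ltW// wexp_gt0.
Qed.

Lemma Ew_ge0 (R : realType) (r : R) (k : R -> R) : 1 <= r ->
  (forall u, 0 <= k u) -> 0 <= Ew r k.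
Proof.
move=> r1 k0; rewrite Ew.unlock divr_ge0 ?(ltW (Zw_gt0 r1))//.
by apply: Rintegral_ge0 => x _; rewrite mulr_ge0// ltW// wexp_gt0.
Qed.

Lemma EwN (R : realType) (r : R) (k : R -> R) : 1 <= r -> admissible k ->
  Ew r (fun u => k (- u)) = Ew r k.
Proof.
move=> r1 ak; rewrite !Ew.unlock; congr (_ / _); rewrite /Rintegral; congr fine.
have [/measurable_EFinP mk _] := integrableP _ _ _ (integrable_admissible r1 ak).
rewrite -[RHS](lebesgue_oppr (f := fun x => (k (phi r x) * wexp r x)%:E)); last first.
  exact/measurable_EFinP.
by apply: eq_integral => x _; rewrite phiN wexpN.
Qed.

Lemma ge0_integral_Ew (R : realType) (r : R) (k : R -> R) : 1 <= r -> admissible k ->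
  (\int[@lebesgue_measure R]_x (k (phi r x) * wexp r x / Zw r)%:E = (Ew r k)%:E)%E.
Proof.
move=> r1 ak; have i := integrable_admissible r1 ak.
under eq_integral do rewrite mulrC EFinM.
rewrite integralZl// Ew.unlock mulrC EFinM; congr (_ * _)%E.
by rewrite /Rintegral fineK//; exact: integrable_fin_num.
Qed.

Lemma Ew_fine (R : realType) (r : R) (k : R -> R) : 1 <= r -> admissible k ->
  Ew r k = fine (\int[@lebesgue_measure R]_x (k (phi r x) * wexp r x / Zw r)%:E)%E.
Proof. by move=> r1 ak; rewrite ge0_integral_Ew. Qed.

Definition lip (R : realType) (k : R -> R) : Prop :=
  exists L, forall x y, `|k x - k y| <= L * `|x - y|.

Lemma lip_continuous (R : realType) (k : R -> R) : lip k -> continuous k.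
Proof. by move=> [L kL]; exact: lipschitz_continuous kL. Qed.

Lemma lip_admissible (R : realType) (k : R -> R) : lip k -> admissible k.
Proof.
move=> lk; split; first by apply: continuous_measurable_fun; exact: lip_continuous.
have [L kL] := lk.
have L0 : 0 <= L by have := kL 1 0; rewrite subr0 normr1 mulr1; apply: le_trans.
exists (`|k 0| + L) => u.
have := kL u 0; rewrite subr0 => h.
have u6 : `|u| <= 1 + `|u| ^+ 6.
  have [u1|u1] := leP `|u| 1; first by rewrite (le_trans u1)// lerDl exprn_ge0.
  rewrite -[leLHS]add0r lerD//.
  by rewrite -[leLHS]expr1; apply: ler_weXn2l => //; exact: ltW.
have -> : k u = k 0 + (k u - k 0) by rewrite addrC subrK.
apply: (le_trans (ler_normD _ _)); rewrite mulrDl lerD//.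
  by rewrite ler_peMr// lerDl exprn_ge0.
by apply: (le_trans h); rewrite ler_wpM2l.
Qed.

Lemma lip_comp_affine (R : realType) (k : R -> R) (a c : R) : lip k -> lip (fun u => k (c + a * u)).
Proof.
move=> [L kL]; exists (L * `|a|) => x y; apply: (le_trans (kL _ _)).
by rewrite opprD addrACA subrr add0r -mulrBr normrM mulrA.
Qed.

Lemma lip_Ew (R : realType) (r a : R) (k : R -> R) : 1 <= r -> lip k ->
  lip (fun c => Ew r (fun u => k (c + a * u))).
Proof.
move=> r1 lk; have [L kL] := lk; exists L => x y.
have A c : admissible (fun u => k (c + a * u)) by exact/lip_admissible/lip_comp_affine.
have key c d : Ew r (fun u => k (c + a * u)) - Ew r (fun u => k (d + a * u)) <= L * `|c - d|.
  rewrite lerBlDr -[X in X + _](Ew_cst _ r1) -EwD//; last exact: admissible_cst.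
  apply: Ew_le => //; first exact: admissibleD (admissible_cst _) (A d).
  move=> u; rewrite -lerBlDr; apply: le_trans (ler_norm _) _.
  by apply: (le_trans (kL _ _)); rewrite opprD addrACA subrr addr0.
by rewrite ler_norml key andbT lerNl opprB distrC key.
Qed.

Lemma lip_norm (R : realType) : lip (@Num.norm R R).
Proof. by exists 1 => x y; rewrite mul1r; exact: ler_dist_dist. Qed.

(** Tonelli's theorem for the product of the two normalised densities. *)
Lemma Ew_swap (R : realType) (r q a b c : R) (k : R -> R) : 1 <= r -> 1 <= q -> lip k ->
  (forall u, 0 <= k u) ->
  Ew r (fun u => Ew q (fun v => k (c + a * u + b * v))) =
  Ew q (fun v => Ew r (fun u => k (c + b * v + a * u))).
Proof.
move=> r1 q1 lk k0.
have A c' a' : admissible (fun u => k (c' + a' * u)) by exact/lip_admissible/lip_comp_affine.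
have B (r' a' b' : R) : 1 <= r' -> admissible (fun u => Ew r' (fun v => k (c + a' * u + b' * v))).
  move=> r'1; apply: lip_admissible.
  exact: (lip_comp_affine a' c (lip_Ew b' r'1 lk)).
have B1 := B q a b q1.
have B2 := B r b a r1.
have F1 := Ew_fine r1 B1.
have F2 := Ew_fine q1 B2.
rewrite F1 F2; apply: (@congr1 _ _ fine).
pose f (z : R * R) := (k (c + a * phi r z.1 + b * phi q z.2) *
   (wexp r z.1 / Zw r * (wexp q z.2 / Zw q)))%:E.
have wZ s (z : R) : 1 <= s -> 0 <= wexp s z / Zw s.
  by move=> s1; rewrite divr_ge0 ?(ltW (wexp_gt0 _ _)) ?(ltW (Zw_gt0 _)).
have f0 z : (0 <= f z)%E by rewrite lee_fin mulr_ge0 ?k0// mulr_ge0 ?wZ.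
have mf : measurable_fun setT f.
  have mk := continuous_measurable_fun (lip_continuous lk).
  have m1 s : measurable_fun setT (fun z : R * R => phi s z.1) by exact: (measurableT_comp (measurable_phi s)).
  have m2 s : measurable_fun setT (fun z : R * R => phi s z.2) by exact: (measurableT_comp (measurable_phi s)).
  have m3 s : measurable_fun setT (fun z : R * R => wexp s z.1) by exact: (measurableT_comp (measurable_wexp s)).
  have m4 s : measurable_fun setT (fun z : R * R => wexp s z.2) by exact: (measurableT_comp (measurable_wexp s)).
  apply/measurable_EFinP; apply: measurable_funM.
    apply: (measurableT_comp mk); apply: measurable_funD; last by apply: measurable_funM.
    by apply: measurable_funD => //; apply: measurable_funM.
  by apply: measurable_funM; apply: measurable_funM.
transitivity (\int[@lebesgue_measure R]_x \int[@lebesgue_measure R]_y f (x, y))%E.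
  apply: eq_integral => x _; rewrite -mulrA mulrC EFinM.
  rewrite -(ge0_integral_Ew q1 (A (c + a * phi r x) b)) -ge0_integralZl//.
  - by apply: eq_integral => y _; rewrite /f -EFinM /=; congr EFin; ring.
  - apply/measurable_EFinP; apply: measurable_funM => //; apply: measurable_funM; last exact: measurable_wexp.
    by have [mA _] := A (c + a * phi r x) b; exact: (measurableT_comp mA (measurable_phi q)).
  - by move=> y _; rewrite lee_fin -mulrA mulr_ge0 ?k0 ?wZ.
  - by rewrite lee_fin wZ.
rewrite (fubini_tonelli (m1 := @lebesgue_measure R) (m2 := @lebesgue_measure R) f mf f0).
apply: eq_integral => y _; rewrite -mulrA mulrC EFinM.
rewrite -(ge0_integral_Ew r1 (A (c + b * phi q y) a)) -ge0_integralZl//.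
- by apply: eq_integral => x _; rewrite /f -EFinM /= addrAC; congr EFin; ring.
- apply/measurable_EFinP; apply: measurable_funM => //; apply: measurable_funM; last exact: measurable_wexp.
  by have [mA _] := A (c + b * phi q y) a; exact: (measurableT_comp mA (measurable_phi r)).
- by move=> x _; rewrite lee_fin -mulrA mulr_ge0 ?k0 ?wZ.
- by rewrite lee_fin wZ.
Qed.

(** * Characteristic functions and the cosine representation of first absolute moments *)

Lemma normr_sin_le (R : realType) (x : R) : `|sin x| <= `|x|.
Proof.
suff pos (y : R) : 0 <= y -> `|sin y| <= y.
  have [x0|/ltW x0] := leP 0 x; first by rewrite (ger0_norm x0) pos.
  by rewrite -normrN -sinN (ler0_norm x0) pos// oppr_ge0.
rewrite le_eqVlt => /predU1P[<-|y0]; first by rewrite sin0 normr0.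
have d (z : R) : z \in `]0, y[ -> is_derive z 1 (@sin R) (cos z) by move=> _; exact: is_derive_sin.
have c : {within `[0, y], continuous (@sin R)} by apply: continuous_subspaceT; exact: continuous_sin.
have [z _] := MVT y0 d c; rewrite sin0 !subr0 => ->.
by rewrite normrM (gtr0_norm y0) ler_piMl ?(ltW y0)// ler_norml cos_geN1 cos_le1.
Qed.

Lemma oneBcos_le (R : realType) (x : R) : 1 - cos x <= x ^+ 2 / 2.
Proof.
have -> : cos x = 1 - 2 * sin (x / 2) ^+ 2.
  have {1}-> : x = x / 2 + x / 2 by field.
  have := cos2Dsin2 (x / 2); rewrite cosD => h; nra.
have := normr_sin_le (x / 2); rewrite -(@ler_pXn2r _ 2) ?nnegrE// !real_normK ?num_real//.
by rewrite expr_div_n; lra.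
Qed.

(** Set to 0 for t <= 0, so that integrals over the half-line are written over the whole line. *)
Definition invsq (R : realType) (t : R) : R := if 0 < t then t ^- 2 else 0.

Lemma invsq_ge0 (R : realType) (t : R) : 0 <= invsq t.
Proof. by rewrite /invsq; case: ifP => // t0; rewrite invr_ge0 sqr_ge0. Qed.

Lemma measurable_invsq (R : realType) : measurable_fun setT (@invsq R).
Proof.
rewrite (_ : @invsq R = fun t => if 0 < t then t `^ (- 2%:R) else 0).
  apply: measurable_fun_ifT => //; first exact: measurable_fun_ltr.
by apply/funext => t; rewrite /invsq; case: ifP => // t0; rewrite powR_invn// ltW.
Qed.

(** The quadratic bound controls the integrand on ]0, 1], the constant bound on [1, +oo[, where t^-2
    is integrable. *)
Lemma integral_min_invsq_lty (R : realType) (A B : R) : 0 <= A -> 0 <= B ->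
  (\int[@lebesgue_measure R]_t (Num.min A (B * t ^+ 2) * invsq t)%:E < +oo)%E.
Proof.
move=> A0 B0.
have mm : measurable_fun setT (fun t : R => (Num.min A (B * t ^+ 2) * invsq t)%:E).
  apply/measurable_EFinP; apply: measurable_funM; last exact: measurable_invsq.
  by apply: measurable_minr => //; apply: measurable_funM => //; exact: measurable_funX.
have ge0 t : (0 <= (Num.min A (B * t ^+ 2) * invsq t)%:E)%E.
  by rewrite lee_fin mulr_ge0 ?invsq_ge0// le_min A0 mulr_ge0// sqr_ge0.
have -> : [set: R] = `]-oo, 1%R[%classic `|` `[1%R, +oo[%classic.
  by apply/seteqP; split => // x _ /=; rewrite !in_itv/= andbT; case: (leP 1 x); [right|left].
rewrite ge0_integral_setU//=; last 2 first.
- exact: measurable_funTS.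
- rewrite disj_set2E; apply/eqP/seteqP; split => // x /=; rewrite !in_itv/= andbT.
  by move=> [a b]; have := lt_le_trans a b; rewrite ltxx.
apply: lte_add_pinfty.
  apply: (@le_lt_trans _ _ (\int[@lebesgue_measure R]_(t in `]-oo, 1%R[) (B%:E * (\1_(`[0%R, 1%R]%classic) t)%:E))%E).
    apply: ge0_le_integral => //.
    - exact: measurable_funTS.
    - by apply: measurable_funTS; apply/measurable_EFinP; apply: measurable_funM.
    move=> t /=; rewrite in_itv/= => t1; rewrite -EFinM lee_fin /invsq; case: ifPn => t0.
      rewrite indicE mem_set/= ?mulr1; last by rewrite in_itv/= !ltW.
      apply: (@le_trans _ _ (B * t ^+ 2 / t ^+ 2)); last by rewrite mulfK// gt_eqF// exprn_gt0.
      by rewrite ler_wpM2r ?invr_ge0 ?sqr_ge0// ge_min lexx orbT.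
    by rewrite mulr0 mulr_ge0// indicE.
  apply: (@le_lt_trans _ _ (\int[@lebesgue_measure R]_t (B%:E * (\1_(`[0%R, 1%R]%classic) t)%:E))%E).
    apply: ge0_subset_integral => //.
    - by apply/measurable_EFinP; apply: measurable_funM.
    - by move=> x _; rewrite -EFinM lee_fin mulr_ge0// indicE.
  rewrite integral_cst_indic//.
  rewrite -[X in (_ * X)%E]/(@lebesgue_measure R `[0%R, 1%R]%classic).
  by rewrite lebesgue_measure_itv/= lte_fin ltr01 oppr0 adde0 mule1 ltry.
apply: (@le_lt_trans _ _ (\int[@lebesgue_measure R]_(t in `[1%R, +oo[) (A * t ^- 2)%:E)%E).
  apply: ge0_le_integral => //.
  - exact: measurable_funTS.
  - apply/measurable_EFinP; apply: (eq_measurable_fun (fun t => A * invsq t)).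
      move=> t; rewrite inE/= in_itv/= andbT => t1.
      by rewrite /invsq (lt_le_trans ltr01 t1).
    by apply: measurable_funTS; apply: measurable_funM => //; exact: measurable_invsq.
  move=> t /=; rewrite in_itv/= andbT => t1; rewrite lee_fin /invsq (lt_le_trans ltr01 t1).
  by rewrite ler_wpM2r ?invr_ge0 ?sqr_ge0// ge_min lexx.
have d (x : R) : 1 <= x -> is_derive x 1 (fun t : R => - A *: t^-1) (A * x ^- 2).
  move=> x1; have x0 : x != 0 by rewrite gt_eqF// (lt_le_trans ltr01 x1).
  have d1 : is_derive x 1 (fun t : R => t^-1) (- x ^- 2 *: 1).
    by apply: is_deriveV.
  by apply: is_derive_eq; rewrite -[_ *: 1]/(_ * 1) -[_ *: _]/(_ * _) mulr1 mulrNN.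
rewrite (@ge0_continuous_FTC2y _ _ (fun t => - A *: t^-1) 1 0).
- by rewrite ltry.
- by move=> x x1; rewrite mulr_ge0// invr_ge0 sqr_ge0.
- apply: continuous_in_subspaceT => x; rewrite inE/= in_itv/= andbT => x1.
  have x0 : x != 0 by rewrite gt_eqF// (lt_le_trans ltr01 x1).
  apply: cvgMr; apply: cvgV; first by rewrite expf_neq0.
  exact: exprn_continuous.
- rewrite -(scaler0 _ (- A)); apply: cvgZr; apply/gtr0_cvgV0; [exact: nbhs_pinfty_gt|exact: cvg_id].
- by move=> x x1; have [] := d x (ltW x1).
- apply: cvg_at_right_filter.
  exact: (is_derive_continuous (g := fun x => A * x ^- 2)) (d 1 (lexx _)).
- by move=> x; rewrite in_itv/= andbT => x1; rewrite derive1E; have /@derive_val := d x (ltW x1).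
Qed.
Lemma cos_dist_le (R : realType) (x y : R) : `|cos x - cos y| <= `|x - y|.
Proof.
suff h (u v : R) : u < v -> `|cos v - cos u| <= v - u.
  have [xy|xy|->] := ltgtP x y; last by rewrite !subrr.
    by rewrite distrC (le_trans (h _ _ xy))// distrC ler_norm.
  by rewrite (le_trans (h _ _ xy))// ler_norm.
move=> uv.
have d (z : R) : z \in `]u, v[ -> is_derive z 1 (@cos R) (- sin z) by move=> _; exact: is_derive_cos.
have c : {within `[u, v], continuous (@cos R)} by apply: continuous_subspaceT; exact: continuous_cos.
have [z _ ->] := MVT uv d c; rewrite normrM normrN (gtr0_norm (_ : 0 < v - u)) ?subr_gt0//.
by rewrite ler_piMl ?subr_ge0 ?(ltW uv)// ler_norml sin_geN1 sin_le1.
Qed.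

Lemma admissible_bounded (R : realType) (k : R -> R) (C : R) :
  measurable_fun setT k -> (forall u, `|k u| <= C) -> admissible k.
Proof.
move=> mk kC; split=> //; exists C => u; rewrite (le_trans (kC u))//.
by rewrite ler_peMr ?lerDl ?exprn_ge0// (le_trans _ (kC u)).
Qed.

Definition cf (R : realType) (r t : R) : R := Ew r (fun u => cos (t * u)).

Lemma measurable_cos_mul (R : realType) (t : R) : measurable_fun setT (fun u : R => cos (t * u)).
Proof.
apply: (measurableT_comp (continuous_measurable_fun (@continuous_cos R))).
exact: measurable_funM.
Qed.

Lemma admissible_cos (R : realType) (t : R) : admissible (fun u => cos (t * u)).
Proof.
apply: (@admissible_bounded _ _ 1); first exact: measurable_cos_mul.
by move=> u; rewrite ler_norml cos_geN1 cos_le1.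
Qed.

Lemma admissible_sin (R : realType) (t : R) : admissible (fun u => sin (t * u)).
Proof.
apply: (@admissible_bounded _ _ 1).
  apply: (measurableT_comp (continuous_measurable_fun (@continuous_sin R))).
  exact: measurable_funM.
by move=> u; rewrite ler_norml sin_geN1 sin_le1.
Qed.

Lemma normr_cf_le1 (R : realType) (r t : R) : 1 <= r -> `|cf r t| <= 1.
Proof.
move=> r1; rewrite ler_norml -(Ew_cst (-1) r1) -[X in _ && (_ <= X)](Ew_cst 1 r1).
have ac (c : R) := admissible_cst c.
have ak := admissible_cos t.
apply/andP; split; apply: Ew_le => // u; [exact: cos_geN1|exact: cos_le1].
Qed.

Lemma cf0 (R : realType) (r : R) : 1 <= r -> cf r 0 = 1.
Proof.
by move=> r1; rewrite /cf -[RHS](Ew_cst 1 r1); congr (Ew r _); apply/funext => u; rewrite mul0r cos0.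
Qed.

Lemma cfN (R : realType) (r t : R) : cf r (- t) = cf r t.
Proof. by rewrite /cf; congr (Ew r _); apply/funext => u; rewrite mulNr cosN. Qed.

Lemma lip_cf (R : realType) (r : R) : 1 <= r -> lip (cf r).
Proof.
move=> r1; exists (Ew r (fun u => `|u|)) => s t.
suff key s' t' : cf r s' - cf r t' <= Ew r (fun u => `|u|) * `|s' - t'|.
  by rewrite ler_norml key andbT lerNl opprB distrC key.
have an : admissible (@Num.norm R R) := lip_admissible (@lip_norm R).
have ac (c : R) := admissible_cos c.
have an1 := admissibleZ `|s' - t'| an.
rewrite lerBlDr mulrC -(EwZ _ r1 an) -(EwD r1 an1 (ac t')).
apply: Ew_le => //; first exact: admissibleD.
move=> u; rewrite -lerBlDr -normrM mulrBl (le_trans (ler_norm _))//.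
exact: cos_dist_le.
Qed.

Lemma measurable_cf (R : realType) (r : R) : 1 <= r -> measurable_fun setT (cf r).
Proof. by move=> r1; apply: continuous_measurable_fun; exact/lip_continuous/lip_cf. Qed.

Lemma Ew_odd (R : realType) (r : R) (k : R -> R) : 1 <= r -> admissible k ->
  (forall u, k (- u) = - k u) -> Ew r k = 0.
Proof.
move=> r1 ak kN; have := EwN r1 ak.
have -> : (fun u => k (- u)) = (fun u => -1 * k u) by apply/funext => u; rewrite kN mulN1r.
by rewrite (EwZ _ r1 ak); lra.
Qed.

Lemma Ew_cos (R : realType) (r t c a : R) : 1 <= r ->
  Ew r (fun u => cos (t * (c + a * u))) = cos (t * c) * cf r (t * a).
Proof.
move=> r1.
have -> : (fun u => cos (t * (c + a * u))) =
    (fun u => cos (t * c) * cos (t * a * u) + (- sin (t * c)) * sin (t * a * u)).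
  by apply/funext => u; rewrite mulrDr mulrA cosD mulNr.
have ac := admissible_cos (t * a); have as_ := admissible_sin (t * a).
rewrite (EwD r1 (admissibleZ _ ac) (admissibleZ _ as_)) (EwZ _ r1 ac) (EwZ _ r1 as_).
rewrite (Ew_odd r1 as_) ?mulr0 ?addr0//.
by move=> u; rewrite mulrN sinN.
Qed.

Lemma oneBcos_ge (R : realType) (x : R) : 0 <= x <= 1 -> x ^+ 2 / 8 <= 1 - cos x.
Proof.
move=> /andP[]; rewrite le_eqVlt => /predU1P[<- _|x0 x1].
  by rewrite expr0n/= mul0r cos0 subrr.
have y0 : 0 < x / 2 by rewrite divr_gt0.
have d (z : R) : z \in `]0, x / 2[ -> is_derive z 1 (@sin R) (cos z) by move=> _; exact: is_derive_sin.
have c : {within `[0, x / 2], continuous (@sin R)} by apply: continuous_subspaceT; exact: continuous_sin.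
have [z] := MVT y0 d c; rewrite in_itv/= sin0 !subr0 => /andP[z0 zx] e.
have h : cos z >= 1 / 2 by have := oneBcos_le z; nra.
have h2 : x / 4 <= sin (x / 2) by rewrite e; nra.
have -> : cos x = 1 - 2 * sin (x / 2) ^+ 2.
  have {1}-> : x = x / 2 + x / 2 by field.
  by have := cos2Dsin2 (x / 2); rewrite cosD => h'; nra.
nra.
Qed.

Lemma measurable_oneBcos_invsq (R : realType) (c : R) :
  measurable_fun setT (fun t : R => ((1 - cos (c * t)) * invsq t)%:E).
Proof.
apply/measurable_EFinP; apply: measurable_funM; last exact: measurable_invsq.
by apply: measurable_funB => //; exact: measurable_cos_mul.
Qed.

HB.lock Definition K0 (R : realType) : R :=
  fine (\int[@lebesgue_measure R]_t ((1 - cos (1 * t)) * invsq t)%:E)%E.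

Lemma K0E (R : realType) :
  (\int[@lebesgue_measure R]_t ((1 - cos (1 * t)) * invsq t)%:E = (K0 R)%:E)%E /\ 0 < K0 R.
Proof.
have g0 t : (0 <= ((1 - cos (1 * t)) * invsq t)%:E :> \bar R)%E.
  by rewrite lee_fin mulr_ge0 ?invsq_ge0// subr_ge0 cos_le1.
have lty : (\int[@lebesgue_measure R]_t ((1 - cos (1 * t)) * invsq t)%:E < +oo)%E.
  apply: le_lt_trans (integral_min_invsq_lty (A := 2) (B := 2^-1) _ _) => //.
  apply: ge0_le_integral => //.
  - exact: measurable_oneBcos_invsq.
  - apply/measurable_EFinP; apply: measurable_funM; last exact: measurable_invsq.
    by apply: measurable_minr => //; apply: measurable_funM => //; exact: measurable_funX.
  move=> t _; rewrite lee_fin ler_wpM2r ?invsq_ge0// le_min mul1r.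
  by rewrite mulrC oneBcos_le andbT lerBlDl -lerBlDr; apply: le_trans (cos_geN1 t); lra.
have fn : (\int[@lebesgue_measure R]_t ((1 - cos (1 * t)) * invsq t)%:E)%E \is a fin_num.
  by rewrite ge0_fin_numE// integral_ge0.
have e : (\int[@lebesgue_measure R]_t ((1 - cos (1 * t)) * invsq t)%:E = (K0 R)%:E)%E.
  by rewrite K0.unlock fineK.
split => //; rewrite -lte_fin -e.
apply: (@lt_le_trans _ _ (\int[@lebesgue_measure R]_t ((8^-1)%:E * (\1_(`]0%R, 1%R]%classic) t)%:E))%E).
  rewrite integral_cst_indic//.
  rewrite -[X in (_ * X)%E]/(@lebesgue_measure R `]0%R, 1%R]%classic).
  by rewrite lebesgue_measure_itv/= lte_fin ltr01 oppr0 adde0 mule1 lte_fin invr_gt0.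
apply: ge0_le_integral => //.
- by apply/measurable_EFinP; apply: measurable_funM.
- exact: measurable_oneBcos_invsq.
move=> t _; rewrite -EFinM lee_fin indicE; case: (boolP (t \in _)) => [|_]; last first.
  by rewrite mulr0 -lee_fin.
rewrite inE/= in_itv/= => /andP[t0 t1]; rewrite mulr1 mul1r /invsq t0.
rewrite ler_pdivlMr ?exprn_gt0// mulrC oneBcos_ge// (ltW t0) t1//.
Qed.

Lemma K0_gt0 (R : realType) : 0 < K0 R.
Proof. by have [] := K0E R. Qed.

Lemma integral_oneBcos (R : realType) (c : R) :
  (\int[@lebesgue_measure R]_t ((1 - cos (t * c)) * invsq t)%:E = (K0 R * `|c|)%:E)%E.
Proof.
wlog : c / 0 <= c => [h|].
  have [/h//|/ltW c0] := leP 0 c.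
  rewrite -normrN -h ?oppr_ge0//; apply: eq_integral => t _; by rewrite mulrN cosN.
rewrite le_eqVlt => /predU1P[<-|c0].
  by rewrite normr0 mulr0 integral0_eq// => t _; rewrite mulr0 cos0 subrr mul0r.
have g0 t : (0 <= ((1 - cos (1 * t)) * invsq t)%:E :> \bar R)%E.
  by rewrite lee_fin mulr_ge0 ?invsq_ge0// subr_ge0 cos_le1.
have e := ge0_integral_affine 0 (lt0r_neq0 c0) (@measurable_oneBcos_invsq R 1) g0.
rewrite (gtr0_norm c0) mulrC EFinM -(K0E R).1 -e muleA -EFinM -ge0_integralZl//; last 2 first.
- apply/measurable_EFinP; apply: measurable_funM.
    apply: measurable_funB => //; apply: (measurableT_comp (continuous_measurable_fun (@continuous_cos R))).
    by apply: measurable_funM => //; exact: measurable_affine.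
  by apply: (measurableT_comp (@measurable_invsq R)); exact: measurable_affine.
- by rewrite lee_fin mulr_ge0// ltW.
apply: eq_integral => t _; rewrite -EFinM; congr EFin.
rewrite (gtr0_norm c0) mul1r addr0 (mulrC t) /invsq pmulr_rgt0//; case: ifP => t0; last by rewrite !mulr0.
by field; rewrite !gt_eqF.
Qed.

(* E|c + sum a Y_r|, over the pairs (a, r) of [l], with independent Y_r = [phi r x] and x of
   density proportional to [wexp r]. *)
Fixpoint Phi (R : realType) (l : seq (R * R)) (c : R) : R :=
  if l is x :: l' then Ew x.2 (fun u => Phi l' (c + x.1 * u)) else `|c|.

Definition cfs (R : realType) (l : seq (R * R)) (t : R) : R := \prod_(x <- l) cf x.2 (t * x.1).

Definition laws (R : realType) : pred (seq (R * R)) := all (fun x => 1 <= x.2).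

Lemma lip_Phi (R : realType) (l : seq (R * R)) : laws l -> lip (Phi l).
Proof.
elim: l => [_|x l ih /= /andP[x1 /ih]]; first exact: lip_norm.
exact: lip_Ew.
Qed.

Lemma measurable_cfs (R : realType) (l : seq (R * R)) : laws l -> measurable_fun setT (cfs l).
Proof.
elim: l => [_|x l ih /= /andP[x1 /ih h]].
  by rewrite (_ : cfs [::] = cst 1)//; apply/funext => t; rewrite /cfs big_nil.
rewrite (_ : cfs (x :: l) = fun t => cf x.2 (t * x.1) * cfs l t); last first.
  by apply/funext => t; rewrite /cfs big_cons.
apply: measurable_funM => //; apply: (measurableT_comp (measurable_cf x1)).
exact: measurable_funM.
Qed.

Lemma normr_cfs_le1 (R : realType) (l : seq (R * R)) (t : R) : laws l -> `|cfs l t| <= 1.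
Proof.
elim: l => [_|x l ih /= /andP[x1 /ih h]]; first by rewrite /cfs big_nil normr1.
by rewrite /cfs big_cons normrM mulr_ile1// normr_cf_le1.
Qed.

(** |x| is, up to [K0], the integral of (1 - cos(tx)) / t^2. Averaging over one variable at a time
    peels off one factor of [cfs]: by symmetry of the law, E cos(t (c + aY)) = cos(tc) E cos(taY).
    The shift [c] is what lets the induction run. *)
Lemma Phi_rep (R : realType) (l : seq (R * R)) (c : R) : laws l ->
  (\int[@lebesgue_measure R]_t ((1 - cos (t * c) * cfs l t) * invsq t)%:E = (K0 R * Phi l c)%:E)%E.
Proof.
elim: l c => [c _|[a r] l ih c /= /andP[r1 gl]].
  by rewrite -integral_oneBcos; apply: eq_integral => t _; rewrite /cfs big_nil mulr1.
have lP := lip_Phi gl.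
have aP : admissible (fun u => Phi l (c + a * u)) by exact/lip_admissible/lip_comp_affine.
have mc := measurable_cfs gl.
have cb (t y : R) : 0 <= 1 - cos y * cfs l t.
  rewrite subr_ge0 (le_trans (ler_norm _))// normrM mulr_ile1 ?normr_cfs_le1//.
  by rewrite ler_norml cos_geN1 cos_le1.
have Z0 := Zw_gt0 r1.
have wZ x : 0 <= wexp r x / Zw r by rewrite divr_ge0 ?(ltW Z0)// ltW// wexp_gt0.
pose f (z : R * R) := ((1 - cos (z.1 * (c + a * phi r z.2)) * cfs l z.1) * invsq z.1 *
  (wexp r z.2 / Zw r))%:E.
have f0 z : (0 <= f z)%E.
  by rewrite lee_fin mulr_ge0// mulr_ge0 ?invsq_ge0.
have mf : measurable_fun setT f.
  apply/measurable_EFinP; apply: measurable_funM; last first.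
    by apply: measurable_funM => //; exact: (measurableT_comp (measurable_wexp r)).
  apply: measurable_funM; last exact: (measurableT_comp (@measurable_invsq R)).
  apply: measurable_funB => //; apply: measurable_funM; last exact: (measurableT_comp mc).
  apply: (measurableT_comp (continuous_measurable_fun (@continuous_cos R))).
  apply: measurable_funM => //; apply: measurable_funD => //; apply: measurable_funM => //.
  exact: (measurableT_comp (measurable_phi r)).
transitivity (\int[@lebesgue_measure R]_t \int[@lebesgue_measure R]_u f (t, u))%E.
  apply: eq_integral => t _.
  have ac : admissible (fun u => cos (t * (c + a * u))).
    apply: (@admissible_bounded _ _ 1); last by move=> u; rewrite ler_norml cos_geN1 cos_le1.
    apply: (measurableT_comp (continuous_measurable_fun (@continuous_cos R))).
    by apply: measurable_funM => //; apply: measurable_funD => //; apply: measurable_funM.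
  have ac1 := admissibleD (admissible_cst (invsq t)) (admissibleZ (- cfs l t * invsq t) ac).
  have := ge0_integral_Ew r1 ac1.
  rewrite (EwD r1 (admissible_cst _) (admissibleZ _ ac)) (EwZ _ r1 ac) (Ew_cst _ r1) (Ew_cos _ _ _ r1).
  move=> e; transitivity (invsq t + - cfs l t * invsq t * (cos (t * c) * cf r (t * a)))%:E.
    by rewrite /cfs big_cons /=; congr EFin; ring.
  by rewrite -e; apply: eq_integral => u _; rewrite /f /=; congr EFin; ring.
rewrite (fubini_tonelli (m1 := @lebesgue_measure R) (m2 := @lebesgue_measure R) f mf f0).
have := ge0_integral_Ew r1 (admissibleZ (K0 R) aP); rewrite (EwZ _ r1 aP) => <-.
apply: eq_integral => u _ /=; rewrite -mulrA mulrC EFinM -(ih _ gl) -ge0_integralZl//.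
- by apply: eq_integral => t _; rewrite /f /= -EFinM; congr EFin; rewrite mulrC.
- apply/measurable_EFinP; apply: measurable_funM; last exact: measurable_invsq.
  apply: measurable_funB => //; apply: measurable_funM => //.
  apply: (measurableT_comp (continuous_measurable_fun (@continuous_cos R))).
  exact: measurable_funM.
- by move=> t _; rewrite lee_fin mulr_ge0 ?invsq_ge0.
- by rewrite lee_fin wZ.
Qed.

(** * Positivity of first moments and reduction of the volume ratio to them *)

Lemma integral_gt0_itv (R : realType) (g : R -> R) (A B e : R) : measurable_fun setT g ->
  (forall t, 0 <= g t) -> 0 < e -> A < B -> (forall t, A <= t <= B -> e <= g t) ->
  (0 < \int[@lebesgue_measure R]_t (g t)%:E)%E.
Proof.
move=> mg g0 e0 AB ge.
apply: (@lt_le_trans _ _ (\int[@lebesgue_measure R]_t (e%:E * (\1_(`[A, B]%classic) t)%:E))%E).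
  rewrite integral_cst_indic//; last exact: ltW.
  rewrite -[X in (_ * X)%E]/(@lebesgue_measure R `[A, B]%classic).
  by rewrite lebesgue_measure_itv/= lte_fin AB -EFinD -EFinM lte_fin mulr_gt0// subr_gt0.
apply: ge0_le_integral => //.
- by move=> t _; rewrite -EFinM lee_fin mulr_ge0 ?(ltW e0)// indicE.
- by apply/measurable_EFinP; apply: measurable_funM.
- exact/measurable_EFinP.
move=> t _; rewrite -EFinM lee_fin indicE; case: (boolP (t \in _)) => [|_]; last by rewrite mulr0.
by rewrite inE/= in_itv/= => tAB; rewrite mulr1 ge.
Qed.

Lemma Ew_gt0 (R : realType) (r A B d : R) (k : R -> R) : 1 <= r -> admissible k ->
  (forall u, 0 <= k u) -> 0 < d -> A < B ->
  (forall x, A <= x <= B -> d <= k (phi r x)) -> 0 < Ew r k.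
Proof.
move=> r1 ak k0 d0 AB kd; have Z0 := Zw_gt0 r1.
pose M := Num.max `|A| `|B|.
have M0 : 0 <= M by rewrite le_max normr_ge0.
have e0 : 0 < d * expR (- (M `^ r)) / Zw r by rewrite divr_gt0// mulr_gt0// expR_gt0.
have ke t : A <= t <= B -> d * expR (- (M `^ r)) / Zw r <= k (phi r t) * wexp r t / Zw r.
  move=> tAB; rewrite ler_pM2r ?invr_gt0//.
  apply: ler_pM; [exact: ltW|by rewrite expR_ge0|exact: kd|].
  rewrite ler_expR lerN2 ge0_ler_powR ?nnegrE ?(le_trans ler01 r1)//.
  move: tAB => /andP[tA tB]; rewrite le_max; case: (leP 0 t) => t0.
    by apply/orP; right; rewrite ger0_norm// (le_trans tB)// ler_norm.
  apply/orP; left; rewrite ltr0_norm// -normrN; apply: le_trans (ler_norm _).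
  by rewrite lerN2.
have g0 t : 0 <= k (phi r t) * wexp r t / Zw r.
  by rewrite divr_ge0 ?(ltW Z0)// mulr_ge0// ltW// wexp_gt0.
have mg : measurable_fun setT (fun t => k (phi r t) * wexp r t / Zw r).
  have [/measurable_EFinP mk _] := integrableP _ _ _ (integrable_admissible r1 ak).
  exact: measurable_funM.
rewrite -lte_fin -(ge0_integral_Ew r1 ak).
exact: (integral_gt0_itv mg g0 e0 AB ke).
Qed.

Lemma phi_ge1 (R : realType) (r x : R) : 1 <= r -> 1 <= x -> 1 <= phi r x.
Proof.
move=> r1 x1; have x0 : 0 < x by exact: lt_le_trans x1.
rewrite /phi gtr0_sg// mul1r gtr0_norm//.
apply: (@le_trans _ _ (1 `^ (r - 1))); first by rewrite powR1.
by rewrite ge0_ler_powR ?nnegrE ?subr_ge0// ltW.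
Qed.

Lemma Ew_norm_gt0 (R : realType) (r : R) : 1 <= r -> 0 < Ew r (fun u => `|u|).
Proof.
move=> r1; apply: (@Ew_gt0 _ _ 1 2 1) => //.
- exact/lip_admissible/lip_norm.
- by rewrite ltr1n.
- by move=> x /andP[x1 _]; rewrite (le_trans (phi_ge1 r1 x1))// ler_norm.
Qed.

Lemma Ew_sym_le (R : realType) (r m : R) (k : R -> R) : 1 <= r -> admissible k ->
  (forall u, 2 * m <= k u + k (- u)) -> m <= Ew r k.
Proof.
move=> r1 ak km.
have akN : admissible (fun u => k (- u)).
  have [mk [C kC]] := ak; split; last by exists C => u; rewrite -(normrN u).
  exact: measurableT_comp.
suff : 2 * m <= Ew r k + Ew r k by lra.
rewrite -{2}(EwN r1 ak) -(EwD r1 ak akN) -[leLHS](Ew_cst _ r1).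
by apply: Ew_le => //; [exact: admissible_cst|exact: admissibleD].
Qed.

Lemma Phi_ge_norm (R : realType) (l : seq (R * R)) (c : R) : laws l -> `|c| <= Phi l c.
Proof.
elim: l c => [//|[a r] l ih c /= /andP[r1 gl]].
apply: Ew_sym_le => //; first exact/lip_admissible/lip_comp_affine/lip_Phi.
move=> u; apply: le_trans (lerD (ih _ gl) (ih _ gl)); rewrite mulrN.
by have := ler_normD (c + a * u) (c - a * u);
  rewrite (_ : c + a * u + (c - a * u) = 2 * c) ?normrM ?(ger0_norm (_ : 0 <= 2))//; ring.
Qed.

Lemma Phi_cons_gt0 (R : realType) (l : seq (R * R)) (a r : R) : laws ((a, r) :: l) ->
  a != 0 -> 0 < Phi ((a, r) :: l) 0.
Proof.
move=> /= /andP[r1 gl] a0.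
apply: (@lt_le_trans _ _ (`|a| * Ew r (fun u => `|u|))).
  by rewrite mulr_gt0 ?normr_gt0 ?Ew_norm_gt0.
have an : admissible (@Num.norm R R) := lip_admissible (@lip_norm R).
rewrite -(EwZ _ r1 an); apply: Ew_le => //; first exact: admissibleZ.
  exact/lip_admissible/lip_comp_affine/lip_Phi.
by move=> u; rewrite -normrM (le_trans _ (Phi_ge_norm _ gl))// add0r.
Qed.

Definition iid (R : realType) (r : R) n (a : 'rV[R]_n) : seq (R * R) :=
  [seq (a 0 i, r) | i <- enum 'I_n].

Lemma laws_iid (R : realType) (r : R) n (a : 'rV[R]_n) : 1 <= r -> laws (iid r a).
Proof. by move=> r1; apply/allP => _ /mapP[i _ ->]. Qed.

Lemma iidS (R : realType) (r : R) n (a : 'rV[R]_n.+1) :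
  iid r a = (a 0 0, r) :: iid r (\row_(i < n) a 0 (lift ord0 i)).
Proof.
rewrite /iid enum_ordSl /= -map_comp; congr cons.
by apply: eq_map => i /=; rewrite mxE.
Qed.

Lemma measurable_tuple_form (R : realType) (r : R) m (b : 'rV[R]_m) (e : R) :
  measurable_fun setT (fun x : m.-tuple R =>
    (`|e + \sum_(i < m) b 0 i * phi r (trow x 0 i)| * ewt r (trow x))%:E).
Proof.
have mi (i : 'I_m) : measurable_fun setT (fun x : m.-tuple R => trow x 0 i).
  rewrite (_ : (fun _ => _) = (fun x => tnth x i)); first exact: measurable_tnth.
  by apply/funext => x; rewrite mxE.
apply/measurable_EFinP; apply: measurable_funM.
  apply: measurableT_comp => //; apply: measurable_funD => //.
  by apply: measurable_sum => i; apply: measurable_funM => //; exact: measurableT_comp (measurable_phi r) (mi i).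
by apply: measurable_prod => i _; exact: measurableT_comp (measurable_wexp r) (mi i).
Qed.

Lemma integral_tuple_Phi (R : realType) (r : R) n (a : 'rV[R]_n) (c : R) : 1 <= r ->
  (\int[lebesgue_tuple R n]_x
     (`|c + \sum_(i < n) a 0 i * phi r (trow x 0 i)| * ewt r (trow x))%:E
   = (Zw r ^+ n * Phi (iid r a) c)%:E)%E.
Proof.
move=> r1; elim: n a c => [|n ih] a c.
  transitivity (\int[lebesgue_tuple R 0]_x (cst (`|c|%:E) x))%E.
    by apply: eq_integral => x _; rewrite /ewt !big_ord0 addr0 mulr1.
  rewrite integral_cst// /iid (_ : enum 'I_0 = [::]); last by apply: size0nil; rewrite size_enum_ord.
  by rewrite /= diracE mem_set// mule1 expr0 mul1r.
have Z0 := Zw_gt0 r1.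
pose a' := \row_(i < n) a 0 (lift ord0 i).
have mt m (b : 'rV[R]_m) (e : R) := measurable_tuple_form r b e.
have t0 m (b : 'rV[R]_m) (e : R) (x : m.-tuple R) :
    (0 <= (`|e + \sum_(i < m) b 0 i * phi r (trow x 0 i)| * ewt r (trow x))%:E :> \bar R)%E.
  by rewrite lee_fin mulr_ge0// ltW// ewt_gt0.
rewrite ge0_integral_lebesgue_tupleS// iidS -/a' /=.
have aP : admissible (fun u => Phi (iid r a') (c + a 0 0 * u)).
  exact/lip_admissible/lip_comp_affine/lip_Phi/laws_iid.
rewrite -(EwZ _ r1 aP) -(ge0_integral_Ew r1 (admissibleZ _ aP)).
apply: eq_integral => x _.
rewrite exprS (_ : Zw r * _ * _ * _ / _ = wexp r x * (Zw r ^+ n * Phi (iid r a') (c + a 0 0 * phi r x))).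
  rewrite [RHS]EFinM -ih -ge0_integralZl//; last by rewrite lee_fin ltW// wexp_gt0.
  apply: eq_integral => t _; rewrite -EFinM; congr EFin.
  rewrite /ewt !big_ord_recl !mxE /= mulrCA; congr (_ * (`|_| * _)).
    rewrite -addrA; congr (_ + (_ + _)).
    by apply: eq_bigr => i _; rewrite !mxE; congr (_ * phi _ _); rewrite !(tnth_nth 0).
  by apply: eq_bigr => i _; rewrite !mxE; congr wexp; rewrite !(tnth_nth 0).
  exact: mt.
by field; rewrite gt_eqF.
Qed.

Lemma Psi_Phi (R : realType) (r : R) n (a : 'rV[R]_n) : 1 <= r ->
  Psi r a = (r * (Zw r ^+ n * Phi (iid r a) 0))%:E.
Proof.
move=> r1; rewrite EFinM -integral_tuple_Phi// -ge0_integralZl//.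
- apply: eq_integral => x _; rewrite -EFinM; congr EFin.
  rewrite /dirK normrM (gtr0_norm (ewt_gt0 _ _)) mulrA; congr (_ * _).
  rewrite -[X in _ = X * _](ger0_norm (le_trans ler01 r1)) -normrM add0r mulr_sumr; congr `|_|.
  by apply: eq_bigr => i _; ring.
- exact: measurable_tuple_form.
- by move=> x _; rewrite lee_fin mulr_ge0// ltW// ewt_gt0.
- by rewrite lee_fin (le_trans _ r1).
Qed.

(** [Psi] at [b] is finite and positive, which forces the common factor [J] of Cauchy's formula to
    be finite and positive. Division in the extended reals then becomes real division, and the
    factors r, Z^n and J cancel. *)
Lemma projvol_ratio (R : realType) (r : R) m (a b : 'rV[R]_m.+1) : 1 <= r ->
  dot a a = 1 -> dot b b = 1 -> 0 < Phi (iid r b) 0 ->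
  (projvol r%:E a / projvol r%:E b)%E = (Phi (iid r a) 0 / Phi (iid r b) 0)%:E.
Proof.
move=> r1 aa bb Pb.
have r0 : 0 < r := lt_le_trans ltr01 r1.
have Z0 := Zw_gt0 r1.
have ea := projvol_Psi r1 aa; have eb := projvol_Psi r1 bb.
rewrite (Psi_Phi _ r1) in ea; rewrite (Psi_Phi _ r1) in eb.
have J0 : (0 <= \int[@lebesgue_measure R]_(v in `]0%R, +oo[)
    (2 * expR (- v) * (v `^ r^-1) ^+ m)%:E)%E.
  by apply: integral_ge0 => v _; rewrite lee_fin mulr_ge0// ?exprn_ge0// ?powR_ge0// mulr_ge0// expR_ge0.
move: ea eb J0; set J := (\int[_]_(v in _) _)%E => ea eb J0.
have Q0 : 0 < r * (Zw r ^+ m.+1 * Phi (iid r b) 0) by rewrite mulr_gt0// mulr_gt0// exprn_gt0.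
have V0 (c : 'rV[R]_m.+1) : (0 <= projvol r%:E c :> \bar R)%E by exact: measure_ge0.
case: J J0 ea eb => [J| |]//; last first.
  move=> _ _ eb; have := V0 b; rewrite le_eqVlt => /predU1P[v0|v0].
    by move: eb; rewrite -v0 mul0e => -[] /esym/eqP; rewrite gt_eqF.
  by move: eb; rewrite gt0_muley.
rewrite lee_fin => J0 ea eb.
have {}J0 : 0 < J.
  rewrite lt_neqAle J0 andbT eq_sym; apply/eqP => j0; move: eb; rewrite j0 mule0.
  by move=> [] /esym/eqP; rewrite gt_eqF.
have ev (c : 'rV[R]_m.+1) (x : R) : (projvol r%:E c * J%:E)%E = x%:E -> projvol r%:E c = (x / J)%:E.
  move=> e; have := V0 c; case: (projvol _ c) e => [y| |]//.
    by rewrite -EFinM => -[<-] _; rewrite mulfK// gt_eqF.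
  by rewrite gt0_mulye.
have B0 : r * (Zw r ^+ m.+1 * Phi (iid r b) 0) / J != 0 by rewrite gt_eqF// divr_gt0.
rewrite (ev _ _ ea) (ev _ _ eb) inver (negPf B0) -EFinM; congr EFin.
by field; rewrite !gt_eqF// exprn_gt0.
Qed.
Lemma lee_cvg_to (R : realType) (u v : (\bar R)^nat) (a b : \bar R) :
  u n @[n --> \oo] --> a -> v n @[n --> \oo] --> b -> (forall n, u n <= v n)%E -> (a <= b)%E.
Proof.
move=> ua vb uv; rewrite -(cvg_lim _ ua)// -(cvg_lim _ vb)//; apply: lee_lim.
- by apply/cvg_ex; exists a.
- by apply/cvg_ex; exists b.
- exact: nearW.
Qed.

Lemma cvg_integral_nondecreasing (R : realType) (F : nat -> R -> R) (f : R -> R) :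
  (forall n, measurable_fun setT (F n)) -> (forall n x, 0 <= F n x) ->
  (forall x, nondecreasing_seq (F ^~ x)) -> (forall x, F n x @[n --> \oo] --> f x) ->
  (\int[@lebesgue_measure R]_x (F n x)%:E)%E @[n --> \oo] --> (\int[@lebesgue_measure R]_x (f x)%:E)%E.
Proof.
move=> mF F0 ndF Ff.
have -> : (\int[@lebesgue_measure R]_x (f x)%:E = \int[@lebesgue_measure R]_x (limn (fun n => (F n x)%:E)))%E.
  apply: eq_integral => x _; apply/esym/cvg_lim => //.
  by apply: cvg_EFin; [exact: nearW|exact: Ff].
apply: (@cvg_monotone_convergence _ _ _ (@lebesgue_measure R) setT measurableT (fun n x => (F n x)%:E)) => //.
- by move=> n; apply/measurable_EFinP; exact: mF.
- by move=> n x _; rewrite lee_fin.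
- by move=> x _ m n mn; rewrite lee_fin; exact: ndF.
Qed.

(** * Scale mixtures *)

(* The functions [W] of [r] such that [W (r v) expR (- t r v)] preserves the sign
   of the integral of [gp - gm] for every [t > 0]. *)
Definition dominates (R : realType) (gm gp r W : R -> R) := forall t, 0 < t ->
  (\int[@lebesgue_measure R]_v (gm v * W (r v) * expR (- (t * r v)))%:E <=
   \int[@lebesgue_measure R]_v (gp v * W (r v) * expR (- (t * r v)))%:E)%E.

Section dominates.
Context {R : realType}.
Variables (gm gp r : R -> R).
Hypotheses (mgm : measurable_fun setT gm) (mgp : measurable_fun setT gp)
  (mr : measurable_fun setT r) (gm0 : forall v, 0 <= gm v) (gp0 : forall v, 0 <= gp v)
  (r0 : forall v, 0 < r v).

Let nonneg_fun (W : R -> R) := measurable_fun setT W /\ forall x, 0 <= W x.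

Let mterm (g W : R -> R) t : measurable_fun setT g -> measurable_fun setT W ->
  measurable_fun setT (fun v => g v * W (r v) * expR (- (t * r v))).
Proof.
move=> mg mW; apply: measurable_funM; first by apply: measurable_funM => //; exact: measurableT_comp.
apply: (measurableT_comp (@measurable_expR R)); apply: measurableT_comp => //.
exact: measurable_funM.
Qed.

Let tonelli (g W h B : R -> R) t : measurable_fun setT g -> (forall v, 0 <= g v) ->
  nonneg_fun W -> nonneg_fun h ->
  (forall x : R, 0 < x ->
    (\int[@lebesgue_measure R]_y (h y * expR (- (x * expR y)))%:E = (B x)%:E)%E) ->
  (\int[@lebesgue_measure R]_v (g v * (W (r v) * B (r v)) * expR (- (t * r v)))%:E =
   \int[@lebesgue_measure R]_y ((h y)%:E *
     \int[@lebesgue_measure R]_v (g v * W (r v) * expR (- ((t + expR y) * r v)))%:E))%E /\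
  measurable_fun setT (fun y => (h y)%:E *
     \int[@lebesgue_measure R]_v (g v * W (r v) * expR (- ((t + expR y) * r v)))%:E)%E.
Proof.
move=> mg g0 [mW W0] [mh h0] hB.
pose f (z : R * R) := (h z.2 * (g z.1 * W (r z.1) * expR (- ((t + expR z.2) * r z.1))))%:E.
have f0 z : (0 <= f z)%E by rewrite lee_fin mulr_ge0// mulr_ge0 ?expR_ge0// mulr_ge0.
have mr1 : measurable_fun setT (fun z : R * R => r z.1) by exact: measurableT_comp.
have mf : measurable_fun setT f.
  apply/measurable_EFinP; apply: measurable_funM; first exact: measurableT_comp.
  apply: measurable_funM.
    by apply: measurable_funM; [exact: measurableT_comp|exact: (measurableT_comp mW)].
  apply: (measurableT_comp (@measurable_expR R)); apply: measurableT_comp => //.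
  apply: measurable_funM => //; apply: measurable_funD => //.
  exact: (measurableT_comp (@measurable_expR R)).
have e y : (\int[@lebesgue_measure R]_v f (v, y) = (h y)%:E *
     \int[@lebesgue_measure R]_v (g v * W (r v) * expR (- ((t + expR y) * r v)))%:E)%E.
  rewrite -ge0_integralZl ?lee_fin//.
  - by apply/measurable_EFinP; exact: mterm.
  - by move=> v _; rewrite lee_fin mulr_ge0 ?expR_ge0// mulr_ge0.
split; last first.
  rewrite (_ : (fun _ => _) = (fun y => \int[@lebesgue_measure R]_v f (v, y))%E).
    exact: (measurable_fun_fubini_tonelli_G (m1 := @lebesgue_measure R) f mf f0).
  by apply/funext => y; rewrite e.
under [RHS]eq_integral do rewrite -e.
rewrite -(fubini_tonelli (m1 := @lebesgue_measure R) (m2 := @lebesgue_measure R) f mf f0).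
apply: eq_integral => v _.
have -> : g v * (W (r v) * B (r v)) * expR (- (t * r v)) =
    g v * W (r v) * expR (- (t * r v)) * B (r v) by ring.
rewrite EFinM -(hB _ (r0 v)) -ge0_integralZl//.
- apply: eq_integral => y _; rewrite /f /= -EFinM; congr EFin.
  by rewrite (_ : - ((t + expR y) * r v) = - (t * r v) + - (r v * expR y)) ?expRD; ring.
- apply/measurable_EFinP; apply: measurable_funM => //.
  apply: (measurableT_comp (@measurable_expR R)); apply: measurableT_comp => //.
  exact: measurable_funM.
- by move=> y _; rewrite lee_fin mulr_ge0// expR_ge0.
- by rewrite lee_fin mulr_ge0 ?expR_ge0// mulr_ge0.
Qed.

(** [B] is the Laplace transform of the density [h] in the coordinate e^y. Since exp(-tx) exp(-x
    e^y) = exp(-(t + e^y) x), multiplication by [B] averages the inequalities for W at the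
    parameters t + e^y with the nonnegative weight h. *)
Lemma dominatesM (W h B : R -> R) : nonneg_fun W -> nonneg_fun h ->
  (forall x : R, 0 < x ->
    (\int[@lebesgue_measure R]_y (h y * expR (- (x * expR y)))%:E = (B x)%:E)%E) ->
  dominates gm gp r W -> dominates gm gp r (fun x => W x * B x).
Proof.
move=> nW nh hB dW t t0.
have [em mm] := tonelli t mgm gm0 nW nh hB.
have [ep mp] := tonelli t mgp gp0 nW nh hB.
rewrite em ep; have [mh h0] := nh; have [mW W0] := nW; apply: ge0_le_integral => //.
- move=> y _; rewrite mule_ge0 ?lee_fin//; apply: integral_ge0 => v _.
  by rewrite lee_fin mulr_ge0 ?expR_ge0// mulr_ge0.
- by move=> y _; rewrite lee_wpmul2l ?lee_fin// dW// addr_gt0// expR_gt0.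
Qed.

Lemma dominatesD (W V : R -> R) (a : R) : nonneg_fun W -> nonneg_fun V -> 0 <= a ->
  dominates gm gp r W -> dominates gm gp r V -> dominates gm gp r (fun x => W x + a * V x).
Proof.
move=> [mW W0] [mV V0] a0 dW dV t t0.
have e (g : R -> R) : measurable_fun setT g -> (forall v, 0 <= g v) ->
    (\int[@lebesgue_measure R]_v (g v * (W (r v) + a * V (r v)) * expR (- (t * r v)))%:E =
     \int[@lebesgue_measure R]_v (g v * W (r v) * expR (- (t * r v)))%:E +
     a%:E * \int[@lebesgue_measure R]_v (g v * V (r v) * expR (- (t * r v)))%:E)%E.
  move=> mg g0.
  have t1 v : 0 <= g v * V (r v) * expR (- (t * r v)) by rewrite mulr_ge0 ?expR_ge0// mulr_ge0.
  have t2 v : 0 <= g v * W (r v) * expR (- (t * r v)) by rewrite mulr_ge0 ?expR_ge0// mulr_ge0.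
  have m1 : measurable_fun setT (fun v => (g v * V (r v) * expR (- (t * r v)))%:E).
    by apply/measurable_EFinP; exact: mterm.
  have m2 : measurable_fun setT (fun v => (g v * W (r v) * expR (- (t * r v)))%:E).
    by apply/measurable_EFinP; exact: mterm.
  transitivity (\int[@lebesgue_measure R]_v ((g v * W (r v) * expR (- (t * r v)))%:E +
      a%:E * (g v * V (r v) * expR (- (t * r v)))%:E))%E.
    by apply: eq_integral => v _; rewrite -EFinM -EFinD; congr EFin; ring.
  rewrite ge0_integralD//; last 3 first.
  - by move=> v _; rewrite lee_fin.
  - by move=> v _; rewrite -EFinM lee_fin mulr_ge0.
  - by apply: emeasurable_funM.
  by rewrite ge0_integralZl// => v _; rewrite lee_fin.
rewrite !e// leeD ?dW// lee_wpmul2l ?lee_fin// dV//.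
Qed.

Lemma dominates_nondecreasing (W_ : nat -> R -> R) (W : R -> R) :
  (forall n, nonneg_fun (W_ n)) -> (forall x, 0 < x -> nondecreasing_seq (W_ ^~ x)) ->
  (forall x, 0 < x -> W_ n x @[n --> \oo] --> W x) ->
  (forall n, dominates gm gp r (W_ n)) -> dominates gm gp r W.
Proof.
move=> nW ndW WW dW t t0.
have c (g : R -> R) : measurable_fun setT g -> (forall v, 0 <= g v) ->
    (\int[@lebesgue_measure R]_v (g v * W_ n (r v) * expR (- (t * r v)))%:E)%E @[n --> \oo] -->
    (\int[@lebesgue_measure R]_v (g v * W (r v) * expR (- (t * r v)))%:E)%E.
  move=> mg g0; apply: cvg_integral_nondecreasing.
  - by move=> n; apply: mterm => //; have [] := nW n.
  - by move=> n v; have [_ W0] := nW n; rewrite mulr_ge0 ?expR_ge0// mulr_ge0.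
  - by move=> v m n mn; rewrite ler_pM2r ?expR_gt0// ler_wpM2l// ndW.
  - by move=> v; apply: cvgMl; apply: cvgMr; exact: WW.
by apply: (lee_cvg_to (c _ mgm gm0) (c _ mgp gp0)) => n; exact: dW.
Qed.

Lemma dominates_bounded (W_ : nat -> R -> R) (W : R -> R) :
  (forall n, nonneg_fun (W_ n)) -> (forall n x, 0 < x -> W_ n x <= 1) ->
  (forall t : R, 0 < t -> (\int[@lebesgue_measure R]_v (gm v * expR (- (t * r v)))%:E < +oo)%E) ->
  (forall t : R, 0 < t -> (\int[@lebesgue_measure R]_v (gp v * expR (- (t * r v)))%:E < +oo)%E) ->
  (forall x, 0 < x -> W_ n x @[n --> \oo] --> W x) -> measurable_fun setT W ->
  (forall n, dominates gm gp r (W_ n)) -> dominates gm gp r W.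
Proof.
move=> nW W1 im ip WW mW dW t t0.
have c (g : R -> R) : measurable_fun setT g -> (forall v, 0 <= g v) ->
    (\int[@lebesgue_measure R]_v (g v * expR (- (t * r v)))%:E < +oo)%E ->
    (\int[@lebesgue_measure R]_v (g v * W_ n (r v) * expR (- (t * r v)))%:E)%E @[n --> \oo] -->
    (\int[@lebesgue_measure R]_v (g v * W (r v) * expR (- (t * r v)))%:E)%E.
  move=> mg g0 gy.
  have p0 v : 0 <= g v * expR (- (t * r v)) by rewrite mulr_ge0 ?expR_ge0.
  have mg1 : measurable_fun setT (fun v => (g v * expR (- (t * r v)))%:E).
    apply/measurable_EFinP; apply: measurable_funM => //.
    apply: (measurableT_comp (@measurable_expR R)); apply: measurableT_comp => //.
    exact: measurable_funM.
  have [] // := @dominated_convergence _ _ R (@lebesgue_measure R) setT measurableT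
    (fun n v => (g v * W_ n (r v) * expR (- (t * r v)))%:E)
    (fun v => (g v * W (r v) * expR (- (t * r v)))%:E)
    (fun v => (g v * expR (- (t * r v)))%:E).
  - by move=> n; apply/measurable_EFinP; apply: mterm => //; have [] := nW n.
  - by apply/measurable_EFinP; exact: mterm.
  - apply: aeW => v _; apply: cvg_EFin; first exact: nearW.
    by apply: cvgMl; apply: cvgMr; exact: WW.
  - apply/integrableP; split => //.
    by under eq_integral do rewrite gee0_abs ?lee_fin//.
  - apply: aeW => v n _; rewrite lee_fin; have [_ W0] := nW n.
    rewrite ger0_norm; last by rewrite mulr_ge0 ?expR_ge0// mulr_ge0.
    by rewrite ler_pM2r ?expR_gt0// ler_piMr// W1.
by apply: (lee_cvg_to (c _ mgm gm0 (im _ t0)) (c _ mgp gp0 (ip _ t0))) => n; exact: dW.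
Qed.

(** Powers of [B] come from repeated multiplication, partial sums of the exponential series from
    nonnegative combinations, and the exponential itself from monotone convergence. *)
Lemma dominates_exp (B h : R -> R) : nonneg_fun B -> nonneg_fun h ->
  (forall x : R, 0 < x ->
    (\int[@lebesgue_measure R]_y (h y * expR (- (x * expR y)))%:E = (B x)%:E)%E) ->
  dominates gm gp r (cst 1) -> dominates gm gp r (fun x => expR (B x)).
Proof.
move=> [mB B0] nh hB d1.
have dX n : dominates gm gp r (fun x => B x ^+ n).
  elim: n => [//|n ih].
  have -> : (fun x => B x ^+ n.+1) = (fun x => B x ^+ n * B x) by apply/funext => x; rewrite exprSr.
  apply: dominatesM hB ih => //; split; first exact: measurable_funX.
  by move=> x; rewrite exprn_ge0.
have sX n : nonneg_fun (fun x => series (exp_coeff (B x)) n).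
  split; last by move=> x; rewrite sumr_ge0// => i _; rewrite exp_coeff_ge0.
  apply: measurable_sum => i; rewrite /exp_coeff/=; apply: measurable_funM => //; exact: measurable_funX.
apply: (@dominates_nondecreasing (fun n x => series (exp_coeff (B x)) n)) => //.
- move=> x _; apply: nondecreasing_series => n _ _; exact: exp_coeff_ge0.
- move=> x _; exact: is_cvg_series_exp_coeff.
elim => [|n ih].
  by move=> t t0; rewrite !integral0_eq// => v _; rewrite /series/= big_geq// mulr0 mul0r.
have -> : (fun x => series (exp_coeff (B x)) n.+1) =
   (fun x => series (exp_coeff (B x)) n + n`!%:R^-1 * B x ^+ n).
  by apply/funext => x; rewrite seriesSr /exp_coeff/= mulrC.
apply: dominatesD => //; split; first exact: measurable_funX.
by move=> x; rewrite exprn_ge0.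
Qed.

End dominates.
Lemma integral_le_expRN_lty (R : realType) (f : R -> R) (K c : R) : 0 < c ->
  measurable_fun setT f -> (forall v, 0 <= f v <= K * expR (- (c * `|v|))) ->
  (\int[@lebesgue_measure R]_v (f v)%:E < +oo)%E.
Proof.
move=> c0 mf fK.
have K0 : 0 <= K by have /andP[h1 h2] := fK 0; have := le_trans h1 h2; rewrite pmulr_lge0 ?expR_gt0.
have me : measurable_fun setT (fun v : R => (expR (- (2^-1 * `|v|)))%:E).
  apply/measurable_EFinP; apply: (measurableT_comp (@measurable_expR R)); apply: measurableT_comp => //.
  exact: measurable_funM.
have c20 : 0 < 2 * c by rewrite mulr_gt0.
have e0 (v : R) : (0 <= (expR (- (2^-1 * `|v|)))%:E)%E by rewrite lee_fin expR_ge0.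
have e := ge0_integral_affine 0 (lt0r_neq0 c20) me e0.
have fin : (\int[@lebesgue_measure R]_v (expR (- (2^-1 * `|v|)))%:E < +oo)%E.
  have /integrableP[_] := @integrable_expRN_normr R.
  by under eq_integral => v _ do rewrite gee0_abs ?lee_fin ?expR_ge0//.
have me1 : measurable_fun setT (fun v : R => (expR (- (2^-1 * `|2 * c * v + 0|)))%:E).
  by apply: (measurableT_comp me); exact: measurable_affine.
apply: (@le_lt_trans _ _ (\int[@lebesgue_measure R]_v ((K / (2 * c))%:E * (`|2 * c|%:E * (expR (- (2^-1 * `|2 * c * v + 0|)))%:E)))%E).
  apply: ge0_le_integral => //.
  - by move=> v _; rewrite lee_fin; have /andP[] := fK v.
  - exact/measurable_EFinP.
  - by apply: emeasurable_funM => //; apply: emeasurable_funM.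
  move=> v _; rewrite -!EFinM lee_fin addr0 (gtr0_norm c20) normrM (gtr0_norm c20) mulrA divfK ?gt_eqF//.
  rewrite (_ : 2^-1 * (2 * c * `|v|) = c * `|v|); last by field.
  by have /andP[] := fK v.
rewrite ge0_integralZl//; last 2 first.
- by apply: emeasurable_funM.
- by rewrite lee_fin divr_ge0 ?(ltW c20).
rewrite ge0_integralZl// e lte_mul_pinfty//.
by rewrite lee_fin divr_ge0 ?(ltW c20).
Qed.

Lemma integral_shift (R : realType) (f : R -> R) (b : R) :
  measurable_fun setT f -> (forall v, 0 <= f v) ->
  (\int[@lebesgue_measure R]_v (f (v + b))%:E = \int[@lebesgue_measure R]_v (f v)%:E)%E.
Proof.
move=> mf f0; have f0' v : (0 <= (f v)%:E)%E by rewrite lee_fin.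
rewrite -(@ge0_integral_affine R 1 b (EFin \o f))// ?oner_neq0//; last exact/measurable_EFinP.
by rewrite normr1 mul1e; apply: eq_integral => v _; rewrite /= mul1r.
Qed.

Section stable.
Context {R : realType}.
Variable d : R.
Hypotheses (d0 : 0 < d) (d1 : d < 1).

Let lap (x v : R) : R := (1 - expR (- (x * expR v))) * expR (- (d * v)).
Let pot (x v : R) : R := expR ((1 - d) * v) * expR (- (x * expR v)).

Let mexp (x : R) : measurable_fun setT (fun v : R => expR (- (x * expR v))).
Proof.
apply: (measurableT_comp (@measurable_expR R)); apply: measurableT_comp => //.
by apply: measurable_funM => //; exact: measurable_expR.
Qed.

Let mlap x : measurable_fun setT (lap x).
Proof.
apply: measurable_funM; first by apply: measurable_funB.
apply: (measurableT_comp (@measurable_expR R)); apply: measurableT_comp => //.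
Qed.

Let mpot x : measurable_fun setT (pot x).
Proof.
apply: measurable_funM => //; apply: (measurableT_comp (@measurable_expR R)).
exact: measurable_funM.
Qed.

Let lap_ge0 x v : 0 <= x -> 0 <= lap x v.
Proof.
move=> x0; rewrite mulr_ge0 ?expR_ge0// subr_ge0 -expR0 ler_expR oppr_le0.
by rewrite mulr_ge0 ?expR_ge0.
Qed.

Let pot_ge0 x v : 0 <= pot x v.
Proof. by rewrite mulr_ge0 ?expR_ge0. Qed.

Let lap1_lty : (\int[@lebesgue_measure R]_v (lap 1 v)%:E < +oo)%E.
Proof.
apply: (@integral_le_expRN_lty _ _ 1 (Num.min d (1 - d))) => //.
  by rewrite lt_min d0 subr_gt0.
move=> v; rewrite lap_ge0//= mul1r /lap mul1r.
have m1 : Num.min d (1 - d) <= d by rewrite ge_min lexx.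
have m2 : Num.min d (1 - d) <= 1 - d by rewrite ge_min lexx orbT.
have [v0|v0] := leP 0 v.
  apply: (@le_trans _ _ (expR (- (d * v)))).
    by rewrite ler_piMl ?expR_ge0// lerBlDr lerDl expR_ge0.
  by rewrite ler_expR lerN2 ger0_norm// ler_wpM2r.
apply: (@le_trans _ _ (expR v * expR (- (d * v)))).
  by rewrite ler_pM2r ?expR_gt0// lerBlDr -lerBlDl; have := expR_ge1Dx (- expR v); lra.
rewrite -expRD ler_expR ltr0_norm// mulrN opprK.
rewrite (_ : v + - (d * v) = (1 - d) * v); last by ring.
by rewrite ler_wnM2r// ltW.
Qed.

Let pot1_lty : (\int[@lebesgue_measure R]_v (pot 1 v)%:E < +oo)%E.
Proof.
apply: (@integral_le_expRN_lty _ _ 2 (1 - d)) => //; first by rewrite subr_gt0.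
move=> v; rewrite pot_ge0 /pot mul1r.
have [v0|v0] := leP 0 v; last first.
  rewrite (ltr0_norm v0) -(mulrN (1 - d)) opprK mulrC; apply: ler_wpM2r; first exact: expR_ge0.
  by apply: (@le_trans _ _ 1); [rewrite -expR0 ler_expR oppr_le0 expR_ge0|rewrite ler1n].
have h : expR (- expR v) <= 2 * expR (- (2 * v)).
  have e2 : expR (2 * v) = expR v ^+ 2 by rewrite expr2 -expRD; congr expR; ring.
  rewrite !expRN ler_pdivlMr ?expR_gt0// mulrC ler_pdivrMr ?expR_gt0// e2.
  have := expR_ge1Dxn 1 (expR_ge0 v); rewrite (_ : 2`!%:R = 2 :> R)//.
  by move: (expR v ^+ 2) (expR _) => y z; lra.
apply: (le_trans (ler_wpM2l (expR_ge0 _) h)).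
have dv : 0 <= d * v by rewrite mulr_ge0// ltW.
rewrite mulrCA ler_pM2l// -expRD ler_expR ger0_norm// !mulrBl mul1r; lra.
Qed.

(** With y = e^v, this constant and the next are Gamma(1 - d) / d and Gamma(1 - d). They normalise
    the representations of x^d as a mixture of the functions 1 - exp(-xy) and of x^(d-1) as a
    Laplace transform. *)
Definition stable_laplace : R := fine (\int[@lebesgue_measure R]_v (lap 1 v)%:E)%E.
Definition stable_potential : R := fine (\int[@lebesgue_measure R]_v (pot 1 v)%:E)%E.

Lemma stable_laplace_gt0 : 0 < stable_laplace.
Proof.
apply: fine_gt0; rewrite lap1_lty andbT.
apply: (@integral_gt0_itv _ _ 0 1 ((1 - expR (-1)) * expR (- d))) => //.
- by move=> t; exact: lap_ge0.
- by rewrite mulr_gt0 ?expR_gt0// subr_gt0 -[ltRHS]expR0 ltr_expR ltrN10.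
move=> t /andP[t0 t1]; apply: ler_pM; rewrite ?expR_ge0//.
- by rewrite lerD2l lerN2 ler_expR mul1r lerN2 -expR0 ler_expR.
- by rewrite ler_expR lerN2 ler_piMr// ltW.
Qed.

Lemma stable_potential_gt0 : 0 < stable_potential.
Proof.
apply: fine_gt0; rewrite pot1_lty andbT.
apply: (@integral_gt0_itv _ _ 0 1 (1 * expR (- expR 1))) => //.
move=> t /andP[t0 t1]; apply: ler_pM; rewrite ?expR_ge0//.
- by rewrite -[leLHS]expR0 ler_expR mulr_ge0 ?subr_ge0// ltW.
- by rewrite ler_expR lerN2 mul1r ler_expR.
Qed.

Lemma integral_stable_laplace x : 0 < x ->
  (\int[@lebesgue_measure R]_v ((1 - expR (- (x * expR v))) * expR (- (d * v)))%:E =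
   (stable_laplace * x `^ d)%:E)%E.
Proof.
move=> x0; have xd : x `^ d = expR (d * ln x) by rewrite /powR gt_eqF.
rewrite mulrC EFinM fineK ?ge0_fin_numE ?integral_ge0//; last by move=> v _; rewrite lee_fin lap_ge0.
rewrite -(integral_shift (ln x))//; last by move=> v; exact: lap_ge0.
rewrite -ge0_integralZl//; last 3 first.
- apply/measurable_EFinP; apply: (measurableT_comp (mlap 1)); exact: measurable_funD.
- by move=> v _; rewrite lee_fin lap_ge0.
- by rewrite lee_fin powR_ge0.
apply: eq_integral => v _; rewrite -EFinM; congr EFin.
rewrite xd /lap mulrCA -expRD mul1r expRD lnK ?posrE//; congr (_ * _).
  by rewrite (mulrC x).
by congr expR; ring.
Qed.

Lemma integral_stable_potential x : 0 < x ->
  (\int[@lebesgue_measure R]_v (expR ((1 - d) * v) * expR (- (x * expR v)))%:E =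
   (stable_potential * x `^ (d - 1))%:E)%E.
Proof.
move=> x0; have xd : x `^ (d - 1) = expR ((d - 1) * ln x) by rewrite /powR gt_eqF.
rewrite mulrC EFinM fineK ?ge0_fin_numE ?integral_ge0//; last by move=> v _; rewrite lee_fin.
rewrite -(integral_shift (ln x))//.
rewrite -ge0_integralZl//; last 3 first.
- apply/measurable_EFinP; apply: (measurableT_comp (mpot 1)); exact: measurable_funD.
- by move=> v _; rewrite lee_fin.
- by rewrite lee_fin powR_ge0.
apply: eq_integral => v _; rewrite -EFinM; congr EFin.
rewrite xd /pot mulrA -(expRD ((d - 1) * ln x)) mul1r (expRD v) lnK ?posrE//; congr (expR _ * expR _).
  by ring.
by rewrite (mulrC x).
Qed.

End stable.
Section dominates_stable.
Context {R : realType}.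
Variables (gm gp r : R -> R) (d : R).
Hypotheses (mgm : measurable_fun setT gm) (mgp : measurable_fun setT gp)
  (mr : measurable_fun setT r) (gm0 : forall v, 0 <= gm v) (gp0 : forall v, 0 <= gp v)
  (r0 : forall v, 0 < r v) (d0 : 0 < d) (d1 : d < 1).

Let C := stable_laplace d.
Let C0 : 0 < C. Proof. exact: stable_laplace_gt0. Qed.

Let h (n : nat) (v : R) : R := if - n%:R <= v then C^-1 * expR (- (d * v)) else 0.

Let mh n : measurable_fun setT (h n).
Proof.
apply: measurable_fun_ifT => //; first exact: measurable_fun_ler.
apply: measurable_funM => //; apply: (measurableT_comp (@measurable_expR R)).
by apply: measurableT_comp => //; apply: measurable_funM.
Qed.

Let h0 n v : 0 <= h n v.
Proof. by rewrite /h; case: ifP => // _; rewrite mulr_ge0 ?expR_ge0// invr_ge0 ltW. Qed.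

Let h_lty n : (\int[@lebesgue_measure R]_v (h n v)%:E < +oo)%E.
Proof.
apply: (@integral_le_expRN_lty _ _ (C^-1 * expR (2 * d * n%:R)) d) => // v.
rewrite h0 /h; case: ifP => nv; last first.
  by rewrite mulr_ge0 ?expR_ge0// mulr_ge0 ?expR_ge0// invr_ge0 ltW.
rewrite /= -[leRHS]mulrA -expRD ler_pM2l ?invr_gt0// ler_expR.
have := ler0n R n; have [v0|v0] := leP 0 v => n0.
  by rewrite ger0_norm// lerDr mulr_ge0// mulr_ge0// ltW.
rewrite ltr0_norm//; have : 0 <= d * (n%:R + v) by rewrite mulr_ge0 ?(ltW d0)//; move: nv; lra.
by rewrite mulrDr mulrN opprK => ?; nra.
Qed.

Let mexp (x : R) : measurable_fun setT (fun v : R => expR (- (x * expR v))).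
Proof.
apply: (measurableT_comp (@measurable_expR R)); apply: measurableT_comp => //.
by apply: measurable_funM => //; exact: measurable_expR.
Qed.

Let mhe n (x : R) : measurable_fun setT (fun v => h n v * expR (- (x * expR v))).
Proof. by apply: measurable_funM; [exact: mh|exact: mexp]. Qed.

Let mhd n (x : R) : measurable_fun setT (fun v => h n v * (1 - expR (- (x * expR v)))).
Proof. by apply: measurable_funM; [exact: mh|apply: measurable_funB => //; exact: mexp]. Qed.

Let A n : R := fine (\int[@lebesgue_measure R]_v (h n v)%:E)%E.
Let B n x : R := fine (\int[@lebesgue_measure R]_v (h n v * expR (- (x * expR v)))%:E)%E.

Let expN1 (x v : R) : 0 <= x -> 0 <= 1 - expR (- (x * expR v)).
Proof.
by move=> x0; rewrite subr_ge0 -[leRHS]expR0 ler_expR oppr_le0 mulr_ge0 ?expR_ge0.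
Qed.

Let AE n : (\int[@lebesgue_measure R]_v (h n v)%:E = (A n)%:E)%E.
Proof.
by rewrite fineK// ge0_fin_numE// integral_ge0// => v _; rewrite lee_fin.
Qed.

Let hB_le n (x : R) : 0 <= x -> (\int[@lebesgue_measure R]_v (h n v * expR (- (x * expR v)))%:E <=
  \int[@lebesgue_measure R]_v (h n v)%:E)%E.
Proof.
move=> x0; apply: ge0_le_integral => //.
- by move=> v _; rewrite lee_fin mulr_ge0 ?expR_ge0.
- by apply/measurable_EFinP; exact: mhe.
- by apply/measurable_EFinP; exact: mh.
move=> v _; rewrite lee_fin ler_piMr//; have := expN1 v x0; by rewrite subr_ge0.
Qed.

Let BE n (x : R) : 0 <= x ->
  (\int[@lebesgue_measure R]_v (h n v * expR (- (x * expR v)))%:E = (B n x)%:E)%E.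
Proof.
move=> x0; rewrite fineK// ge0_fin_numE; first exact: le_lt_trans (hB_le n x0) (h_lty n).
by apply: integral_ge0 => v _; rewrite lee_fin mulr_ge0 ?expR_ge0.
Qed.

Let B_ge0 n x : 0 <= B n x.
Proof.
by apply: fine_ge0; apply: integral_ge0 => v _; rewrite lee_fin mulr_ge0 ?expR_ge0.
Qed.

Let BA n x : 0 <= x -> B n x <= A n.
Proof. by move=> x0; rewrite -lee_fin -BE// -AE hB_le. Qed.

Let mB n : measurable_fun setT (B n).
Proof.
pose f (z : R * R) := (h n z.2 * expR (- (z.1 * expR z.2)))%:E.
apply: (measurableT_comp (fine_measurable measurableT)) => //.
apply: (measurable_fun_fubini_tonelli_F (m2 := @lebesgue_measure R) f).
  apply/measurable_EFinP; apply: measurable_funM; first exact: (measurableT_comp (mh n)).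
  apply: (measurableT_comp (@measurable_expR R)); apply: measurableT_comp => //.
  by apply: measurable_funM => //; exact: (measurableT_comp (@measurable_expR R)).
by move=> z; rewrite lee_fin mulr_ge0 ?expR_ge0.
Qed.

Let diffAB n (x : R) : 0 <= x ->
  (\int[@lebesgue_measure R]_v (h n v * (1 - expR (- (x * expR v))))%:E = (A n - B n x)%:E)%E.
Proof.
move=> x0; have ge v : (0 <= (h n v * (1 - expR (- (x * expR v))))%:E)%E.
  by rewrite lee_fin mulr_ge0// expN1.
have : (\int[@lebesgue_measure R]_v (h n v * (1 - expR (- (x * expR v))))%:E + (B n x)%:E = (A n)%:E)%E.
  rewrite -BE// -AE -ge0_integralD//.
  - by apply: eq_integral => v _; rewrite -EFinD; congr EFin; ring.
  - by apply/measurable_EFinP; exact: mhd.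
  - by move=> v _; rewrite lee_fin mulr_ge0 ?expR_ge0.
  - by apply/measurable_EFinP; exact: mhe.
have : (0 <= \int[@lebesgue_measure R]_v (h n v * (1 - expR (- (x * expR v))))%:E)%E.
  exact: integral_ge0.
case: (integral _ _ _) => // u _; rewrite -EFinD => -[<-]; congr EFin; ring.
Qed.

Let cvgAB (x : R) : 0 < x -> A n - B n x @[n --> \oo] --> x `^ d.
Proof.
move=> x0; have x0' := ltW x0.
have c : (\int[@lebesgue_measure R]_v (h n v * (1 - expR (- (x * expR v))))%:E)%E @[n --> \oo] -->
    (\int[@lebesgue_measure R]_v ((C^-1 * expR (- (d * v))) * (1 - expR (- (x * expR v))))%:E)%E.
  apply: cvg_integral_nondecreasing.
  - by move=> n; exact: mhd.
  - by move=> n v; rewrite mulr_ge0// expN1.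
  - move=> v m n mn; rewrite ler_wpM2r ?expN1// /h; case: ifP => mv; last exact: h0.
    by rewrite (le_trans _ mv)// lerN2 ler_nat.
  move=> v; apply: cvgMl; apply: cvg_near_cst; exists (Num.truncn `|v|).+1 => // n /= vn.
  rewrite /h ifT// -[leRHS]opprK lerN2 (le_trans (ler_norm _))// normrN.
  by rewrite (le_trans (ltW (truncnS_gt _)))// ler_nat.
have e : (\int[@lebesgue_measure R]_v ((C^-1 * expR (- (d * v))) * (1 - expR (- (x * expR v))))%:E
    = (x `^ d)%:E)%E.
  have := integral_stable_laplace d0 d1 x0; rewrite -/C => i.
  transitivity ((C^-1)%:E * (C * x `^ d)%:E)%E; last by rewrite -EFinM mulKf// gt_eqF.
  rewrite -i -ge0_integralZl//.
  - by apply: eq_integral => v _; rewrite -EFinM; congr EFin; ring.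
  - apply/measurable_EFinP; apply: measurable_funM; first by apply: measurable_funB => //; exact: mexp.
    by apply: (measurableT_comp (@measurable_expR R)); apply: measurableT_comp.
  - by move=> v _; rewrite lee_fin mulr_ge0 ?expR_ge0// expN1.
  - by rewrite lee_fin invr_ge0 ltW.
rewrite e in c; have /(_ _) := fine_cvg c.
rewrite (_ : _ \o _ = (fun n => A n - B n x)); last by apply/funext => n; rewrite /= diffAB.
exact.
Qed.

Hypotheses (im : forall t : R, 0 < t -> (\int[@lebesgue_measure R]_v (gm v * expR (- (t * r v)))%:E < +oo)%E)
  (ip : forall t : R, 0 < t -> (\int[@lebesgue_measure R]_v (gp v * expR (- (t * r v)))%:E < +oo)%E).

(** What is at work is the complete monotonicity of exp(-x^d) x^(d-1). Cutting the density in the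
    representation of x^d at v >= -n gives it a finite mass [A n], so that the approximation exp(-(A
    n - B n x)) is exp(- A n) times the exponential of a Laplace transform; n -> oo yields
    exp(-x^d), the approximants being bounded by 1. The factor x^(d-1) is itself a Laplace
    transform, and the auxiliary factor exp(-tx) is removed by letting t decrease to 0. *)
Lemma dominates_stable : dominates gm gp r (cst 1) ->
  (\int[@lebesgue_measure R]_v (gm v * (expR (- (r v `^ d)) * r v `^ (d - 1)))%:E <=
   \int[@lebesgue_measure R]_v (gp v * (expR (- (r v `^ d)) * r v `^ (d - 1)))%:E)%E.
Proof.
move=> d1'.
have mE (s : R -> R) : measurable_fun setT s -> measurable_fun setT (fun x => expR (s x)).
  by move=> ms; exact: (measurableT_comp (@measurable_expR R)).
have dn n : dominates gm gp r (fun x => 0 + expR (- A n) * expR (B n x)).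
  apply: (@dominatesD _ _ _ _ mgm mgp mr gm0 gp0 (cst 0)) => //.
  - split; [by apply: mE|by move=> x; exact: expR_ge0].
  - by move=> t t0; rewrite !integral0_eq// => v _; rewrite mulr0 mul0r.
  by apply: (@dominates_exp _ _ _ _ mgm mgp mr gm0 gp0 r0 (B n) (h n)) => // x x0; apply: BE; exact: ltW.
have de : dominates gm gp r (fun x => expR (- (x `^ d))).
  apply: (@dominates_bounded _ _ _ _ mgm mgp mr gm0 gp0 r0 _ _ _ _ im ip _ _ dn).
  - move=> n; split => [|x]; last by rewrite add0r mulr_ge0 ?expR_ge0.
    by apply: measurable_funD => //; apply: measurable_funM => //; apply: mE.
  - by move=> n x x0; rewrite add0r -expRD -[leRHS]expR0 ler_expR addrC subr_le0 BA// ltW.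
  - move=> x x0; rewrite (_ : (fun n => _) = (fun n => expR (- (A n - B n x)))); last first.
      by apply/funext => n; rewrite add0r -expRD opprB addrC.
    by apply: continuous_cvg; [exact: continuous_expR|apply: cvgN; exact: cvgAB].
  - by apply: mE; apply: measurableT_comp => //; exact: measurable_powR.
have P0 := stable_potential_gt0 d0 d1.
have db : dominates gm gp r (fun x => expR (- (x `^ d)) * x `^ (d - 1)).
  apply: (@dominatesM _ _ _ _ mgm mgp mr gm0 gp0 r0 _
    (fun v => (stable_potential d)^-1 * expR ((1 - d) * v)) _ _ _ _ de).
  - split => [|x]; last exact: expR_ge0.
    by apply: mE; apply: measurableT_comp => //; exact: measurable_powR.
  - split => [|x]; last by rewrite mulr_ge0 ?expR_ge0// invr_ge0 ltW.
    by apply: measurable_funM => //; apply: mE; apply: measurable_funM.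
  move=> x x0; have i := integral_stable_potential d0 d1 x0.
  transitivity ((stable_potential d)^-1%:E * (stable_potential d * x `^ (d - 1))%:E)%E; last first.
    by rewrite -EFinM mulKf// gt_eqF.
  rewrite -i -ge0_integralZl//.
  - by apply: eq_integral => v _; rewrite -EFinM mulrA.
  - apply/measurable_EFinP; apply: measurable_funM; last exact: mexp.
    by apply: mE; apply: measurable_funM.
  - by rewrite lee_fin invr_ge0 ltW.
pose W x := expR (- (x `^ d)) * x `^ (d - 1).
have W0 x : 0 <= W x by rewrite mulr_ge0 ?expR_ge0 ?powR_ge0.
have mW : measurable_fun setT W.
  apply: measurable_funM; last exact: measurable_powR.
  by apply: mE; apply: measurableT_comp => //; exact: measurable_powR.
have c (g : R -> R) : measurable_fun setT g -> (forall v, 0 <= g v) ->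
    (\int[@lebesgue_measure R]_v (g v * W (r v) * expR (- (n.+1%:R^-1 * r v)))%:E)%E @[n --> \oo] -->
    (\int[@lebesgue_measure R]_v (g v * W (r v))%:E)%E.
  move=> mg g0; apply: cvg_integral_nondecreasing.
  - move=> n; apply: measurable_funM; last by apply: mE; apply: measurableT_comp => //; exact: measurable_funM.
    by apply: measurable_funM => //; exact: (measurableT_comp mW).
  - by move=> n v; rewrite mulr_ge0 ?expR_ge0// mulr_ge0.
  - move=> v m n mn /=; apply: ler_wpM2l; first by rewrite mulr_ge0.
    rewrite ler_expR lerN2 ler_pM2r//.
    by rewrite lef_pV2 ?posrE// ler_nat.
  move=> v.
  rewrite [X in _ --> X](_ : g v * W (r v) = g v * W (r v) * expR (- (0 * r v))); last first.
    by rewrite mul0r oppr0 expR0 mulr1.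
  apply: cvgMr; apply: continuous_cvg; first exact: continuous_expR.
  by apply: cvgN; apply: cvgMl; exact: cvg_harmonic.
apply: (lee_cvg_to (c _ mgm gm0) (c _ mgp gp0)) => n.
by apply: db; rewrite invr_gt0.
Qed.

End dominates_stable.

(** * Expectations in the exponential coordinate and the transfer between exponents *)

Lemma integral_expR_subst (R : realType) (H : R -> R) : measurable_fun setT H ->
  (forall x, 0 < x -> {for x, continuous H}) -> (forall x, 0 <= H x) ->
  (\int[@lebesgue_measure R]_(x in `]0%R, +oo[) (H x)%:E =
   \int[@lebesgue_measure R]_v (H (expR v) * expR v)%:E)%E.
Proof.
move=> mH cH H0.
pose I n := `[expR (- n%:R), expR n%:R]%classic : set R.
pose J n := `[- n%:R, n%:R]%classic : set R.
have mHe : measurable_fun setT (fun v => (H (expR v) * expR v)%:E).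
  apply/measurable_EFinP; apply: measurable_funM; last exact: measurable_expR.
  exact: (measurableT_comp mH (@measurable_expR R)).
have cI : (\int[@lebesgue_measure R]_(x in I n) (H x)%:E)%E @[n --> \oo] -->
    (\int[@lebesgue_measure R]_(x in `]0%R, +oo[) (H x)%:E)%E.
  apply: ge0_integral_cvg_sets => //.
  - by move=> n; exact: measurable_itv.
  - move=> m n mn; apply/subsetPset => x; rewrite /I /J/= !in_itv/= => /andP[a b].
    by rewrite (le_trans _ a) ?(le_trans b)// ler_expR ?lerN2 ler_nat.
  - apply/seteqP; split => [x [n _]|x]; rewrite /I/= !in_itv/=.
      by move=> /andP[a _]; rewrite (lt_le_trans _ a)// expR_gt0.
    rewrite andbT => x0; exists (Num.truncn `|ln x|).+1 => //; rewrite /I/=.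
    have := truncnS_gt `|ln x|; rewrite in_itv/= -{4 5}(lnK x0) !ler_expR => h.
    by rewrite -ler_norml ltW.
  - by apply/measurable_EFinP; apply: measurable_funTS.
  - by move=> x _; rewrite lee_fin.
have cJ : (\int[@lebesgue_measure R]_(v in J n) (H (expR v) * expR v)%:E)%E @[n --> \oo] -->
    (\int[@lebesgue_measure R]_v (H (expR v) * expR v)%:E)%E.
  apply: ge0_integral_cvg_sets => //.
  - by move=> n; exact: measurable_itv.
  - move=> m n mn; apply/subsetPset => x; rewrite /I /J/= !in_itv/= => /andP[a b].
    by rewrite (le_trans _ a) ?(le_trans b)// ?lerN2 ler_nat.
  - apply/seteqP; split => // x _; exists (Num.truncn `|x|).+1 => //; rewrite /J/=.
    by have := truncnS_gt `|x|; rewrite in_itv/= => h; rewrite -ler_norml ltW.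
  - by move=> x _; rewrite lee_fin mulr_ge0 ?expR_ge0.
rewrite -(cvg_lim _ cI)// -(cvg_lim _ cJ)//; congr (limn _); apply/funext => n.
have d1 : (@expR R)^`()%classic = @expR R by apply/funext => x; rewrite derive1E; exact: derive_val.
rewrite /I (@integration_by_substitution_increasing _ (@expR R)).
- by apply: eq_integral => v _; rewrite d1.
- by rewrite (le_trans (_ : _ <= 0))// oppr_le0.
- by move=> x y _ _; rewrite ltr_expR.
- by move=> x _; rewrite d1; exact: continuous_expR.
- rewrite d1; apply/cvg_ex; exists (expR (- n%:R)); apply: cvg_at_right_filter; exact: continuous_expR.
- rewrite d1; apply/cvg_ex; exists (expR n%:R); apply: cvg_at_left_filter; exact: continuous_expR.
- split.
  + by move=> x _; exact: ex_derive.
  + by apply: cvg_at_right_filter; exact: continuous_expR.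
  + by apply: cvg_at_left_filter; exact: continuous_expR.
- apply: continuous_in_subspaceT => x; rewrite inE/= in_itv/= => /andP[a _].
  by apply: cH; rewrite (lt_le_trans _ a)// expR_gt0.
Qed.

Lemma integral_even (R : realType) (f : R -> \bar R) : measurable_fun setT f ->
  (forall x, 0 <= f x)%E -> (forall x, f (- x) = f x) ->
  (\int[@lebesgue_measure R]_x f x = 2%:E * \int[@lebesgue_measure R]_(x in `]0%R, +oo[) f x)%E.
Proof.
move=> mf f0 fN.
have -> : [set: R] = `]-oo, 0%R[%classic `|` `[0%R, +oo[%classic.
  by apply/seteqP; split => // x _ /=; rewrite !in_itv/= andbT; case: (leP 0 x); [right|left].
rewrite ge0_integral_setU//=; last 2 first.
- exact: measurable_funTS.
- rewrite disj_set2E; apply/eqP/seteqP; split => // x /=; rewrite !in_itv/= andbT.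
  by move=> [a b]; have := lt_le_trans a b; rewrite ltxx.
rewrite -(@integral_itv_obnd_cbnd _ 0); last exact: measurable_funTS.
rewrite mule_natl mule2n; congr (_ + _)%E.
rewrite integral_mkcond [RHS]integral_mkcond.
rewrite -(lebesgue_oppr (f := f \_ `]-oo, 0%R[)).
  apply: eq_integral => x _; rewrite !patchE fN.
  congr (if _ then _ else _); apply/idP/idP; rewrite !inE/= !in_itv/= ?andbT ?oppr_lt0//.
by apply/(measurable_restrictT _ _).1 => //; exact: measurable_funTS.
Qed.

Lemma phi_expR (R : realType) (r v : R) : phi r (expR v) = expR ((r - 1) * v).
Proof.
by rewrite /phi gtr0_sg ?expR_gt0// mul1r gtr0_norm ?expR_gt0// /powR gt_eqF ?expR_gt0// expRK.
Qed.

Lemma wexp_expR (R : realType) (r v : R) : wexp r (expR v) = expR (- expR (r * v)).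
Proof. by rewrite /wexp gtr0_norm ?expR_gt0// /powR gt_eqF ?expR_gt0// expRK. Qed.

Lemma continuous_phi_pos (R : realType) (r x : R) : 0 < x -> {for x, continuous (phi r)}.
Proof.
move=> x0; have e : \forall y \near x, y `^ (r - 1) = phi r y.
  near=> y; have y0 : 0 < y by near: y; exact: lt_nbhsr.
  by rewrite /phi gtr0_sg// mul1r gtr0_norm.
change (phi r y @[y --> x] --> phi r x); rewrite -(nbhs_singleton e); apply: cvg_trans; first exact: near_eq_cvg e.
exact: (is_derive_continuous (g := fun x => (r - 1) * x `^ (r - 1 - 1)) (is_derive_powR _ x0)).
Unshelve. all: by end_near. Qed.

(** With x = e^v, for x > 0, the value [phi r x] is a pure exponential in v and [wexp r x] is
    exp(-e^(rv)), so a change of the exponent r can be matched by a linear change of v and a power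
    in the weight. *)
Lemma Ew_exp (R : realType) (r : R) (k : R -> R) : 1 <= r -> continuous k -> admissible k ->
  (forall u, 0 <= k u) -> (forall u, k (- u) = k u) ->
  (Zw r * Ew r k)%:E = (2%:E * \int[@lebesgue_measure R]_v
    (k (expR ((r - 1) * v)) * (expR (- expR (r * v)) * expR v))%:E)%E.
Proof.
move=> r1 ck ak k0 kN; have Z0 := Zw_gt0 r1.
have mk := continuous_measurable_fun ck.
have mH : measurable_fun setT (fun x => k (phi r x) * wexp r x).
  apply: measurable_funM; last exact: measurable_wexp.
  exact: (measurableT_comp mk (measurable_phi r)).
have H0 x : 0 <= k (phi r x) * wexp r x by rewrite mulr_ge0// ltW// wexp_gt0.
have e : (\int[@lebesgue_measure R]_x (k (phi r x) * wexp r x)%:E = (Zw r * Ew r k)%:E)%E.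
  rewrite -(EwZ _ r1 ak) -(ge0_integral_Ew r1 (admissibleZ (Zw r) ak)).
  by apply: eq_integral => x _; congr EFin; field; rewrite gt_eqF.
rewrite -e integral_even; last 3 first.
- exact/measurable_EFinP.
- by move=> x; rewrite lee_fin.
- by move=> x; rewrite phiN wexpN kN.
congr (_ * _)%E; rewrite integral_expR_subst//.
  by apply: eq_integral => v _; rewrite phi_expR wexp_expR mulrA.
move=> x x0; apply: cvgM.
  by apply: continuous_comp; [exact: continuous_phi_pos|exact: ck].
have x1 : x != 0 by rewrite gt_eqF.
exact: (is_derive_continuous (g := fun x => - (r * phi r x) * wexp r x) (is_derive_wexp r x1)).
Qed.

(* For [1 < p < q] the law of [phi q] under [wexp q] is a mixture of dilates of
   the law of [phi p] under [wexp p]. *)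
Theorem Ew_mixture (R : realType) (p q : R) (k : R -> R) : 1 < p -> p < q ->
  continuous k -> admissible k -> (forall u, k (- u) = k u) ->
  (forall s, 0 < s -> 0 <= Ew p (fun u => k (s * u))) -> 0 <= Ew q k.
Proof.
move=> p1 pq ck ak kN kp.
have q1 : 1 < q := lt_trans p1 pq.
have p1' := ltW p1; have q1' := ltW q1.
have p0 : 0 < p := lt_trans ltr01 p1.
have mexp (f : R -> R) : measurable_fun setT f -> measurable_fun setT (fun x => expR (f x)).
  by move=> mf; exact: (measurableT_comp (@measurable_expR R)).
pose P (g : R -> R) := [/\ continuous g, admissible g, forall u, 0 <= g u & forall u, g (- u) = g u].
(* [dominates] compares the integrals of two nonnegative functions, here the positive and negative
   parts of [k]. *)
pose ka u := Num.max (k u) 0; pose kb u := Num.max (- k u) 0.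
have Pa : P ka.
  split=> [x||u|u]; last by rewrite /ka kN.
  - by apply: continuous_max; [exact: ck|exact: cvg_cst].
  - have [mk [C kC]] := ak; split; first exact: measurable_maxr.
    exists C => u; rewrite (le_trans _ (kC u))// ger0_norm ?le_max ?lexx ?orbT//.
    by rewrite ge_max ler_norm normr_ge0.
  - by rewrite le_max lexx orbT.
have Pb : P kb.
  split=> [x||u|u]; last by rewrite /kb kN.
  - by apply: (@continuous_max _ _ (fun u => - k u) (fun=> 0)); [apply: cvgN; exact: ck|exact: cvg_cst].
  - have [mk [C kC]] := ak; split; first by apply: measurable_maxr => //; exact: measurableT_comp.
    exists C => u; rewrite (le_trans _ (kC u))// ger0_norm ?le_max ?lexx ?orbT//.
    by rewrite ge_max normr_ge0 andbT -normrN ler_norm.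
  - by rewrite le_max lexx orbT.
have kab u : k u = ka u + -1 * kb u.
  by rewrite /ka /kb /Num.max; case: ifPn; case: ifPn => ? ?; lra.
have Ps g s : P g -> P (fun u => g (s * u)).
  move=> [cg [mg [C gC]] g0 gN]; split=> [x||u|u]; [| |exact: g0|by rewrite mulrN gN].
  - by apply: continuous_comp; [exact: mulrl_continuous|exact: cg].
  - split; first by apply: measurableT_comp => //; exact: measurable_funM.
    exists (C * (1 + `|s| ^+ 6)) => u; apply: (le_trans (gC _)); rewrite -mulrA ler_wpM2l//.
      by have := gC 0; rewrite normr0 expr0n addr0 mulr1; apply: le_trans.
    rewrite normrM exprMn mulrDl mul1r mulrDr mulr1.
    have := exprn_ge0 6 (normr_ge0 s); have := exprn_ge0 6 (normr_ge0 u).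
    by move: (`|s| ^+ 6) (`|u| ^+ 6) => x y; lra.
have Esub (r e : R) : 1 <= r -> Ew r (fun u => k (e * u)) =
    Ew r (fun u => ka (e * u)) - Ew r (fun u => kb (e * u)).
  move=> r1; have [_ aa _ _] := Ps _ e Pa; have [_ ab _ _] := Ps _ e Pb.
  rewrite -mulN1r -(EwZ _ r1 ab) -(EwD r1 aa (admissibleZ _ ab)); congr (Ew r _).
  by apply/funext => u; exact: kab.
pose T (g : R -> R) (s : R) := (\int[@lebesgue_measure R]_v
    (g (s * expR ((p - 1) * v)) * (expR (- expR (p * v)) * expR v))%:E)%E.
have TE g s : P g -> (2%:E * T g s = (Zw p * Ew p (fun u => g (s * u)))%:E)%E.
  by move=> /Ps - /(_ s)[cg ag g0 gN]; rewrite (Ew_exp p1' cg ag).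
have Tle s : 0 < s -> (T kb s <= T ka s)%E.
  move=> s0; rewrite -(@lee_pmul2l _ 2%:E)// !TE// lee_fin ler_pM2l ?Zw_gt0//.
  by rewrite -subr_ge0 -Esub// kp.
have Tlty g s : P g -> (T g s < +oo)%E.
  move=> Pg; have := TE _ s Pg; case: (T g s) => [x _| |//]; first exact: ltry.
  by rewrite gt0_muley.
pose w (g : R -> R) v := g (expR ((p - 1) * v)) * expR v.
pose r v := expR (p * v).
have mr : measurable_fun setT r by apply: mexp; exact: measurable_funM.
have mw g : P g -> measurable_fun setT (w g).
  move=> [cg _ _ _]; apply: measurable_funM; last exact: measurable_expR.
  apply: (measurableT_comp (continuous_measurable_fun cg)); apply: mexp; exact: measurable_funM.
have w0 g v : P g -> 0 <= w g v by move=> [_ _ g0 _]; rewrite mulr_ge0 ?expR_ge0.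
(* Shifting v by ln t / p absorbs t and dilates the argument of [g] by t^(-(p-1)/p). The hypothesis
   at all dilations thus becomes domination with weight 1 at all t. *)
have wT g t : P g -> 0 < t -> exists2 s, 0 < s & exists2 c, 0 <= c &
  forall g, P g -> (\int[@lebesgue_measure R]_v (w g v * expR (- (t * r v)))%:E = c%:E * T g s)%E.
  move=> _ t0; pose b := ln t / p.
  have tb : t = expR (p * b) by rewrite /b mulrC divfK ?gt_eqF// lnK.
  exists (expR (- ((p - 1) * b))); first exact: expR_gt0.
  exists (expR (- b)); first exact: expR_ge0.
  move=> {}g Pg; have [cg ag g0 gN] := Pg.
  have m1 : measurable_fun setT (fun v => w g v * expR (- (t * r v))).
    apply: measurable_funM; [exact: mw|apply: mexp; apply: measurableT_comp => //].
    exact: measurable_funM.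
  rewrite -(integral_shift (- b) m1); last by move=> v; rewrite mulr_ge0 ?expR_ge0// w0.
  rewrite -ge0_integralZl//; last 2 first.
  - apply/measurable_EFinP; apply: measurable_funM.
      apply: (measurableT_comp (continuous_measurable_fun cg)); apply: measurable_funM => //.
      by apply: mexp; exact: measurable_funM.
    apply: measurable_funM; last exact: measurable_expR.
    by apply: mexp; apply: measurableT_comp => //; apply: mexp; exact: measurable_funM.
  - by move=> v _; rewrite lee_fin mulr_ge0// mulr_ge0 ?expR_ge0.
  apply: eq_integral => v _; rewrite -EFinM; congr EFin; rewrite /w /r.
  have -> : (p - 1) * (v - b) = - ((p - 1) * b) + (p - 1) * v by ring.
  have -> : p * (v - b) = - (p * b) + p * v by ring.
  have -> : t * expR (- (p * b) + p * v) = expR (p * v).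
    by rewrite {1}tb -expRD; congr expR; ring.
  by rewrite !expRD; ring.
have dom : dominates (w kb) (w ka) r (cst 1).
  move=> t t0; have [s s0 [c c0 E]] := wT _ _ Pa t0.
  by under eq_integral do rewrite mulr1; under [X in (_ <= X)%E]eq_integral do rewrite mulr1;
    rewrite !E// lee_wpmul2l ?lee_fin// Tle.
have fin g : P g -> forall t : R, 0 < t -> (\int[@lebesgue_measure R]_v (w g v * expR (- (t * r v)))%:E < +oo)%E.
  move=> Pg t t0; have [s s0 [c c0 E]] := wT _ _ Pg t0.
  by rewrite E// lte_mul_pinfty ?lee_fin// Tlty.
(* After v -> s v with s = (q - 1) / (p - 1), the argument of [g] is that of [phi q]. This d
   satisfies p s d = q, so [r v]^ d[becomes exp(q v), and]r v [^ (d - 1)] times the factor exp(s v)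
   coming from [w] is exactly exp(v). The condition d < 1 amounts to p < q. *)
pose d := q * (p - 1) / (p * (q - 1)).
have d0 : 0 < d by rewrite divr_gt0// mulr_gt0// ?subr_gt0// (lt_trans ltr01).
have d1 : d < 1.
  by rewrite ltr_pdivrMr ?mulr_gt0 ?subr_gt0// mul1r; nra.
have := dominates_stable (mw _ Pb) (mw _ Pa) mr (fun v => w0 _ v Pb) (fun v => w0 _ v Pa)
  (fun v => expR_gt0 _) d0 d1 (fin _ Pb) (fin _ Pa) dom.
have s0 : 0 < (q - 1) / (p - 1) by rewrite divr_gt0 ?subr_gt0.
pose s := (q - 1) / (p - 1).
have key g : P g -> (2%:E * \int[@lebesgue_measure R]_v (w g v * (expR (- (r v `^ d)) * r v `^ (d - 1)))%:E =
    s%:E * (Zw q * Ew q g)%:E)%E.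
  move=> Pg; have [cg ag g0 gN] := Pg.
  have m1 : measurable_fun setT (fun v => (w g v * (expR (- (r v `^ d)) * r v `^ (d - 1)))%:E).
    apply/measurable_EFinP; apply: measurable_funM; first exact: mw.
    apply: measurable_funM; last exact: (measurableT_comp (measurable_powR _)).
    by apply: mexp; apply: measurableT_comp => //; exact: (measurableT_comp (measurable_powR _)).
  rewrite -(ge0_integral_affine 0 (lt0r_neq0 s0) m1); last first.
    by move=> v; rewrite lee_fin mulr_ge0 ?w0// mulr_ge0 ?expR_ge0 ?powR_ge0.
  rewrite (Ew_exp q1' cg ag g0 gN) (gtr0_norm s0) muleCA; congr (_ * (_ * _))%E.
  apply: eq_integral => v _; congr EFin; rewrite addr0 /w /r.
  have pe (x y : R) : expR x `^ y = expR (y * x) by rewrite /powR gt_eqF ?expR_gt0// expRK.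
  rewrite !pe -/s -mulrA; congr (g (expR _) * _).
    by rewrite /s; field; rewrite gt_eqF// subr_gt0.
  rewrite mulrCA -(expRD (s * v)); congr (expR (- expR _) * expR _).
    by rewrite /s /d; field; rewrite !gt_eqF// subr_gt0.
  by rewrite /s /d; field; rewrite !gt_eqF// subr_gt0.
move=> h; have {h} : (s%:E * (Zw q * Ew q kb)%:E <= s%:E * (Zw q * Ew q ka)%:E)%E.
  by rewrite -!key// lee_pmul2l.
rewrite -!EFinM lee_fin ler_pM2l// ler_pM2l ?Zw_gt0// -subr_ge0.
have := Esub q 1 q1'.
have e1 (g : R -> R) : (fun u => g (1 * u)) = g by apply/funext => u; rewrite mul1r.
by rewrite !e1 => ->.
Qed.

(** * Gaussian integration by parts, characteristic function and moments *)

Lemma integral_derive_eq0 (R : realType) (G g : R -> R) : (forall x : R, is_derive x 1 G (g x)) ->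
  continuous g -> (@lebesgue_measure R).-integrable setT (EFin \o g) ->
  G n%:R @[n --> \oo] --> (0 : R) -> G (- n%:R) @[n --> \oo] --> (0 : R) ->
  \int[@lebesgue_measure R]_x g x = 0.
Proof.
move=> dG cg ig Gp Gm.
pose J n := `[- n%:R, n%:R]%classic : set R.
have mg : measurable_fun setT (EFin \o g) by apply/measurable_EFinP; exact: continuous_measurable_fun.
have [] // := @dominated_convergence _ _ R (@lebesgue_measure R) setT measurableT
    (fun n => (EFin \o g) \_ (J n)) (EFin \o g) (fun x => `|g x|%:E).
- move=> n; apply/(measurable_restrictT _ _).1; first exact: measurable_itv.
  exact: measurable_funTS.
- apply: aeW => x _; apply: cvg_near_cst; exists (Num.truncn `|x|).+1 => // n /= xn.
  rewrite patchE mem_set// /J/= in_itv/= -ler_norml.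
  by rewrite (le_trans (ltW (truncnS_gt _)))// ler_nat.
- exact: (integrable_abse ig).
- apply: aeW => x n _; rewrite patchE; case: ifP => _ //.
  by rewrite abse0 lee_fin.
move=> _ _ c.
have e n : (\int[@lebesgue_measure R]_x ((EFin \o g) \_ (J n)) x = (G n%:R - G (- n%:R))%:E)%E.
  rewrite -integral_mkcond /J; apply: integral_derive => //.
  - by rewrite (le_trans (_ : _ <= 0))// oppr_le0.
  - by move=> x _; exact: cg.
have c0 : (\int[@lebesgue_measure R]_x ((EFin \o g) \_ (J n)) x)%E @[n --> \oo] --> (0 : R)%:E.
  under eq_fun do rewrite e; apply: cvg_EFin; first exact: nearW.
  by rewrite -[X in _ --> X](subrr (0:R)); apply: cvgB.
by rewrite /Rintegral (cvg_unique _ c c0).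
Qed.

Lemma admissible_sin_mul (R : realType) (t : R) : admissible (fun u => u * sin (t * u)).
Proof.
split.
  apply: measurable_funM => //.
  apply: (measurableT_comp (continuous_measurable_fun (@continuous_sin R))).
  exact: measurable_funM.
exists 1 => u; rewrite mul1r normrM (@le_trans _ _ `|u|)//.
  by rewrite ler_piMr// ler_norml sin_geN1 sin_le1.
have [u1|u1] := leP `|u| 1; first by rewrite (le_trans u1)// lerDl exprn_ge0.
by rewrite -[leLHS]add0r lerD// -[leLHS]expr1; apply: ler_weXn2l => //; exact: ltW.
Qed.

Lemma admissibleX (R : realType) (n : nat) : (n <= 6)%N -> admissible (fun u : R => u ^+ n).
Proof.
move=> n6; split; first exact: measurable_funX.
exists 1 => u; rewrite mul1r normrX; have [u1|u1] := leP `|u| 1.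
  by rewrite (le_trans (exprn_ile1 _ (normr_ge0 u) u1))// lerDl exprn_ge0.
by rewrite -[leLHS]add0r lerD// ler_weXn2l// ltW.
Qed.

(** A quadratic error bound is stable under expectations, by linearity and monotonicity; it serves
    for differentiation under the integral sign. *)
Lemma quad_derive (R : realType) (f : R -> R) (t d C : R) :
  (forall h, `|f (t + h) - f t - h * d| <= C * h ^+ 2) -> is_derive t 1 f d.
Proof.
move=> fC; have C0 : 0 <= C by have := fC 1; rewrite expr1n mulr1; apply: le_trans.
have c : (fun h => h^-1 *: ((f \o shift t) (h *: 1) - f t)) @ 0^' --> d.
  apply/cvgrPdist_le => e e0; near=> h.
  have h0 : h != 0 by near: h; exact: nbhs_dnbhs_neq.
  have he : `|h| <= e / (C + 1).
    near: h; apply: dnbhs0_le; rewrite divr_gt0// ltr_pwDr//.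
  rewrite /= -[h *: 1]/(h * 1) mulr1 -[_ *: _]/(h^-1 * _).
  have -> : d - h^-1 * (f (h + t) - f t) = - h^-1 * (f (t + h) - f t - h * d).
    by rewrite (addrC h); field.
  rewrite normrM normrN normfV ler_pdivrMl ?normr_gt0//.
  apply: (le_trans (fC h)); rewrite -real_normK ?num_real// expr2 mulrCA ler_wpM2l//.
  apply: (le_trans (ler_wpM2l C0 he)); rewrite mulrA ler_pdivrMr; last by rewrite ltr_pwDr//.
  by rewrite mulrDr mulr1 mulrC lerDl ltW.
apply: DeriveDef; first by apply/cvg_ex; exists d.
exact: cvg_lim c.
Unshelve. all: by end_near. Qed.

Lemma subr_sin_le (R : realType) (y : R) : `|y - sin y| <= y ^+ 2.
Proof.
wlog y0 : y / 0 <= y => [h|].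
  have [/h//|/ltW y0] := leP 0 y.
  by have := h (- y); rewrite oppr_ge0 sinN sqrrN -opprD normrN => /(_ y0).
move: y0; rewrite le_eqVlt => /predU1P[<-|y0]; first by rewrite sin0 subrr normr0 expr0n.
have d (z : R) : z \in `]0, y[ -> is_derive z 1 (@sin R) (cos z) by move=> _; exact: is_derive_sin.
have c : {within `[0, y], continuous (@sin R)} by apply: continuous_subspaceT; exact: continuous_sin.
have [z] := MVT y0 d c; rewrite in_itv/= sin0 !subr0 => /andP[z0 zy] ->.
rewrite -{1}(mul1r y) -mulrBl normrM (gtr0_norm y0) expr2 ler_pM2r//.
have := oneBcos_le z; have := cos_geN1 z; have := cos_le1 z => a b e.
rewrite ger0_norm ?subr_ge0//; have [y2|y2] := leP y 2; nra.
Qed.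

Lemma cos_taylor_le (R : realType) (x y : R) : `|cos (x + y) - cos x + y * sin x| <= 2 * y ^+ 2.
Proof.
have -> : cos (x + y) - cos x + y * sin x = - cos x * (1 - cos y) + sin x * (y - sin y).
  by rewrite cosD; ring.
rewrite (le_trans (ler_normD _ _))// !normrM normrN.
have h1 : `|1 - cos y| <= y ^+ 2.
  rewrite ger0_norm ?subr_ge0 ?cos_le1//; have := oneBcos_le y; have := sqr_ge0 y; lra.
have -> : 2 * y ^+ 2 = 1 * y ^+ 2 + 1 * y ^+ 2 by ring.
rewrite lerD// ler_pM ?subr_sin_le//; first by rewrite ler_norml cos_geN1 cos_le1.
by rewrite ler_norml sin_geN1 sin_le1.
Qed.

Lemma phi2 (R : realType) (x : R) : phi 2 x = x.
Proof. by rewrite /phi (_ : 2 - 1 = 1) ?powRr1 -?numEsg//; lra. Qed.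

Lemma wexp2 (R : realType) (x : R) : wexp 2 x = expR (- x ^+ 2).
Proof. by rewrite /wexp -[2]/(2%:R) powR_mulrn// real_normK ?num_real. Qed.

Lemma le12 (R : realType) : 1 <= 2 :> R.
Proof. by rewrite ler1n. Qed.

Lemma cvg0_harmonic_le (R : realType) (u : R^nat) (K : R) :
  (forall n, `|u n| <= K * n.+1%:R^-1) -> u n @[n --> \oo] --> (0 : R).
Proof.
move=> uK; have h : K * n.+1%:R^-1 @[n --> \oo] --> (0 : R).
  by rewrite -[X in _ --> X](mulr0 K); apply: cvgMr; exact: cvg_harmonic.
apply: (squeeze_cvgr _ _ h); last by rewrite -oppr0; exact: cvgN h.
by apply: nearW => n; rewrite -ler_norml.
Qed.

Lemma poly_expRN_sqr_le (R : realType) (C y : R) : 0 <= C -> 0 <= y ->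
  C * (1 + y ^+ 6) * expR (- y ^+ 2) <= (100 * C) * (1 + y)^-1.
Proof.
move=> C0 y0; rewrite expRN ler_pdivlMr ?ltr_pwDl// mulrAC ler_pdivrMr ?expR_gt0//.
have h := expR_ge1Dxn 3 (sqr_ge0 y).
have {h} : 1 + y ^+ 8 / 24 <= expR (y ^+ 2).
  apply: le_trans h; rewrite -exprM (_ : 4`!%:R = 24 :> R)//.
rewrite -mulrA mulrAC (mulrC 100) -!mulrA; move: (expR _) => X h; rewrite ler_wpM2l//.
have [y1|y1] := leP y 1.
  have y6 : y ^+ 6 <= 1 by rewrite exprn_ile1.
  have y8 : 0 <= y ^+ 8 by rewrite exprn_ge0.
  have : (1 + y ^+ 6) * (1 + y) <= 2 * 2 by apply: ler_pM => //; rewrite ?addr_ge0 ?exprn_ge0//; lra.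
  lra.
have y6 : 1 <= y ^+ 6 by rewrite exprn_ege1// ltW.
have y7 : y ^+ 7 <= y ^+ 8 by rewrite ler_weXn2l// ltW.
have y67 : y ^+ 6 <= y ^+ 7 by rewrite ler_weXn2l// ltW.
have y17 : y <= y ^+ 7 by rewrite -[leLHS]expr1 ler_weXn2l// ltW.
have -> : (1 + y ^+ 6) * (1 + y) = 1 + y + y ^+ 6 + y ^+ 7 by rewrite [y ^+ 7]exprSr; ring.
lra.
Qed.

Lemma is_derive_exprn (R : realType) (n : nat) (x : R) :
  is_derive x 1 (fun u : R => u ^+ n.+1) (n.+1%:R * x ^+ n).
Proof.
have d := @is_deriveX R R^o (@id R) n.+1 x 1 1 (is_derive_id x 1).
by rewrite exprfctE in d; rewrite -[_%:R * _]mulr1; exact: d.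
Qed.

(** Gaussian integration by parts: multiplied by exp(-u^2), the integrand is the derivative of G(u)
    exp(-u^2), which vanishes at both ends by the growth bound on [G]. *)
Lemma Ew2_derive (R : realType) (G g : R -> R) (C : R) :
  (forall u, `|G u| <= C * (1 + `|u| ^+ 6)) ->
  (forall u : R, is_derive u 1 G (g u)) -> continuous g -> admissible g -> admissible (fun u => u * G u) ->
  Ew 2 (fun u => g u - 2 * (u * G u)) = 0.
Proof.
move=> GC dG cg ag aG; have r1 := le12 R.
have a : admissible (fun u => g u + (- 2) * (u * G u)).
  by apply: admissibleD => //; exact: admissibleZ.
have cG : continuous G by move=> x; exact: is_derive_continuous (dG x).
have dE (x : R) : is_derive x 1 (fun u => G u * expR (- u ^+ 2)) ((g x - 2 * (x * G x)) * expR (- x ^+ 2)).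
  have d1 : is_derive x 1 (fun u : R => - u ^+ 2) (- (2 * x)).
    by apply: is_deriveN; exact: (is_derive_exprn 1 x).
  have d2 : is_derive x 1 (fun u : R => expR (- u ^+ 2)) (expR (- x ^+ 2) * (- (2 * x))).
    exact: is_derive1_comp.
  apply: is_derive_eq; rewrite -![_ *: _]/(_ * _); ring.
have cE : continuous (fun u : R => expR (- u ^+ 2)).
  by move=> x; apply: continuous_comp; [apply: cvgN; exact: exprn_continuous|exact: continuous_expR].
rewrite Ew.unlock (_ : Rintegral _ _ _ = 0) ?mul0r//.
under eq_Rintegral do rewrite phi2 wexp2.
have C0 : 0 <= C by have := GC 0; rewrite normr0 expr0n addr0 mulr1; apply: le_trans.
have lim0 (u : R^nat) : (forall n, `|u n| = n%:R) ->
    G (u n) * expR (- u n ^+ 2) @[n --> \oo] --> (0 : R).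
  move=> un; apply: (@cvg0_harmonic_le _ _ (100 * C)) => n.
  rewrite normrM (ger0_norm (expR_ge0 _)) -[in expR _](real_normK (num_real (u n))).
  have := poly_expRN_sqr_le C0 (normr_ge0 (u n)); rewrite un => h.
  have -> : n.+1%:R = 1 + n%:R :> R by rewrite -natr1 addrC.
  by apply: le_trans h; rewrite ler_pM2r ?expR_gt0// -un; exact: GC.
apply: (integral_derive_eq0 dE).
- move=> x; apply: cvgM; last exact: cE.
  apply: cvgB; first exact: cg.
  by apply: cvgMr; apply: cvgM; [exact: cvg_id|exact: cG].
- have := integrable_admissible r1 a; congr (_.-integrable _ _); apply/funext => x.
  by rewrite /= phi2 wexp2 mulNr.
- by apply: lim0 => n; rewrite ger0_norm.
- by apply: lim0 => n; rewrite normrN ger0_norm.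
Qed.

Lemma continuous_cos_mul (R : realType) (t : R) : continuous (fun u : R => cos (t * u)).
Proof. by move=> x; apply: continuous_comp; [exact: mulrl_continuous|exact: continuous_cos]. Qed.

Lemma Ew_norm_le (R : realType) (r : R) (k l : R -> R) : 1 <= r -> admissible k -> admissible l ->
  (forall u, `|k u| <= l u) -> `|Ew r k| <= Ew r l.
Proof.
move=> r1 ak al kl; rewrite ler_norml; apply/andP; split; last first.
  by apply: Ew_le => // u; apply: le_trans (ler_norm _) (kl u).
rewrite lerNl -mulN1r -(EwZ _ r1 ak); apply: Ew_le => //; first exact: admissibleZ.
by move=> u; rewrite mulN1r (le_trans _ (kl u))// -normrN ler_norm.
Qed.

(** Integration by parts turns the derivative -E(Y sin(tY)) into -(t / 2) times the function itself,
    and exp(t^2 / 4) is an integrating factor. The density is proportional to exp(-u^2), hence the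
    variance 1/2. *)
Lemma cf2E (R : realType) (t : R) : cf 2 t = expR (- (t ^+ 2 / 4)).
Proof.
have r1 := le12 R.
have dcf (x : R) : is_derive x 1 (cf 2) (- (x / 2) * cf 2 x).
  have ac := admissible_cos x; have as_ := admissible_sin_mul x.
  have ibp : Ew 2 (fun u => u * sin (x * u)) = x / 2 * cf 2 x.
    suff : Ew 2 (fun u => x * cos (x * u) - 2 * (u * sin (x * u))) = 0.
      rewrite (_ : (fun u => _ - _) = (fun u => x * cos (x * u) + (- 2) * (u * sin (x * u)))); last first.
        by apply/funext => u; ring.
      rewrite (EwD r1 (admissibleZ x ac) (admissibleZ _ as_)) (EwZ _ r1 ac) (EwZ _ r1 as_) -/(cf 2 x).
      by move: (Ew 2 _) (cf 2 x) => a b; lra.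
    apply: (@Ew2_derive R (fun u => sin (x * u)) (fun u => x * cos (x * u)) 1) => //.
    - move=> u; rewrite mul1r (@le_trans _ _ 1)//; first by rewrite ler_norml sin_geN1 sin_le1.
      by rewrite lerDl exprn_ge0.
    - move=> u; have d1 : is_derive u 1 (fun y : R => x * y) x.
        by apply: is_derive_eq; rewrite -[_ *: _]/(_ * _) mulr1.
      have d2 : is_derive u 1 (fun y : R => sin (x * y)) (cos (x * u) * x) by exact: is_derive1_comp.
      by apply: is_derive_eq; rewrite mulrC.
    - by move=> u; apply: cvgMr; exact: continuous_cos_mul.
    - exact: admissibleZ.
  have a2 := @admissibleX R 2 isT.
  apply: (@quad_derive R (cf 2) x _ (2 * Ew 2 (fun u => u ^+ 2))) => h.
  have ah := admissible_cos (x + h).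
  have -> : cf 2 (x + h) - cf 2 x - h * (- (x / 2) * cf 2 x) =
      Ew 2 (fun u => cos ((x + h) * u) + (-1 * cos (x * u) + h * (u * sin (x * u)))).
    rewrite (EwD r1 ah (admissibleD (admissibleZ _ ac) (admissibleZ _ as_))).
    rewrite (EwD r1 (admissibleZ _ ac) (admissibleZ _ as_)) (EwZ _ r1 ac) (EwZ _ r1 as_) ibp -!/(cf 2 _).
    by ring.
  rewrite mulrAC -(EwZ _ r1 a2); apply: Ew_norm_le => //.
  - by apply: admissibleD => //; apply: admissibleD; exact: admissibleZ.
  - exact: admissibleZ.
  move=> u; have := cos_taylor_le (x * u) (h * u).
  rewrite -mulrDl (_ : 2 * h ^+ 2 * u ^+ 2 = 2 * (h * u) ^+ 2); last by ring.
  by congr (`|_| <= _); ring.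
have dd (x : R) : is_derive x 1 (fun y => cf 2 y * expR (y ^+ 2 / 4)) 0.
  have d1 : is_derive x 1 (fun u : R => u ^+ 2 / 4) (x / 2).
    have q := is_derive_exprn 1 x; have -> : x / 2 = 2 * x ^+ 1 / 4 by rewrite expr1; field.
    rewrite (_ : (fun u => _) = (fun u : R => 4^-1 *: u ^+ 2)); last by apply/funext => u; rewrite mulrC.
    by apply: is_derive_eq; rewrite -[_ *: _]/(_ * _) mulrC.
  have d2 : is_derive x 1 (fun u : R => expR (u ^+ 2 / 4)) (expR (x ^+ 2 / 4) * (x / 2)).
    exact: is_derive1_comp.
  have := dcf x => d3; apply: is_derive_eq; rewrite -![_ *: _]/(_ * _); ring.
have := is_derive_0_is_cst t 0 dd; rewrite expr0n/= mul0r expR0 mulr1 cf0// => e.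
apply: (@mulIf _ (expR (t ^+ 2 / 4))); first by rewrite gt_eqF// expR_gt0.
by rewrite e -expRD addNr expR0.
Qed.

Lemma Ew2_moment (R : realType) (n : nat) : (n <= 4)%N ->
  Ew 2 (fun u : R => u ^+ n.+2) = n.+1%:R / 2 * Ew 2 (fun u => u ^+ n).
Proof.
move=> n4; have r1 := le12 R.
have a1 := @admissibleX R n (leq_trans n4 (isT : (4 <= 6)%N)).
have a2 : admissible (fun u : R => u ^+ n.+2) by apply: admissibleX; rewrite !ltnS.
suff : Ew 2 (fun u : R => n.+1%:R * u ^+ n - 2 * (u * u ^+ n.+1)) = 0.
  rewrite (_ : (fun u => _ - _) = (fun u => n.+1%:R * u ^+ n + (- 2) * u ^+ n.+2)); last first.
    by apply/funext => u; rewrite (exprS u n.+1); ring.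
  rewrite (EwD r1 (admissibleZ _ a1) (admissibleZ _ a2)) (EwZ _ r1 a1) (EwZ _ r1 a2).
  by move: (Ew 2 _) (Ew 2 _) => a b; lra.
apply: (@Ew2_derive R (fun u => u ^+ n.+1) (fun u => n.+1%:R * u ^+ n) 1).
- move=> u; rewrite mul1r normrX; have [u1|u1] := leP `|u| 1.
    by rewrite (le_trans (exprn_ile1 _ (normr_ge0 u) u1))// lerDl exprn_ge0.
  by rewrite -[leLHS]add0r lerD// ler_weXn2l// ?(ltW u1)// (leq_ltn_trans n4).
- by move=> u; exact: is_derive_exprn.
- by move=> u; apply: cvgMr; exact: exprn_continuous.
- exact: admissibleZ.
- by move: a2; congr admissible; apply/funext => u; rewrite exprS.
Qed.

Lemma Ew2_X (R : realType) : [/\ Ew 2 (fun u : R => u ^+ 2) = 1 / 2,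
  Ew 2 (fun u : R => u ^+ 4) = 3 / 4 & Ew 2 (fun u : R => u ^+ 6) = 15 / 8].
Proof.
have e0 : Ew 2 (fun u : R => u ^+ 0) = 1 by rewrite (Ew_cst 1 (le12 R)).
have e2 : Ew 2 (fun u : R => u ^+ 2) = 1 / 2 by rewrite Ew2_moment// e0 mulr1.
have e4 : Ew 2 (fun u : R => u ^+ 4) = 3 / 4 by rewrite Ew2_moment// e2; field.
have e6 : Ew 2 (fun u : R => u ^+ 6) = 15 / 8 by rewrite Ew2_moment// e4; field.
by [].
Qed.

(** * Excess kurtosis for p > 2 *)

(** The three recursions express E2 and E4 through n1 and q. The last hypothesis is a quadratic in c
    evaluated at its minimiser c = n1 / m1, that is Cauchy-Schwarz n1^2 <= q m1. Hence E4 / (3 E2^2)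
    is at least (2p - 3) / (p - 1), which exceeds 1 exactly when p > 2. *)
Lemma kurtosis_algebra (R : realFieldType) (p Z E2 E4 m1 m2 m3 m4 n1 q : R) : 2 < p -> 0 < Z -> 0 < E2 ->
  Z * 1 = 2 * m1 -> Z * E2 = 2 * m2 -> Z * E4 = 2 * m4 ->
  p * m2 = (p - 1) * n1 -> p * m4 = 3 * (p - 1) * m3 -> p * m3 = (2 * p - 3) * q ->
  0 <= q - 2 * (n1 / m1) * n1 + (n1 / m1) ^+ 2 * m1 -> 3 * E2 ^+ 2 < E4.
Proof.
move=> p2 Z0 E20 e0 e2 e4 s1 s2 s3 cs.
have m10 : 0 < m1 by lra.
have m20 : 0 < m2 by have := mulr_gt0 Z0 E20; lra.
have n10 : 0 < n1 by have : 0 < (p - 1) * n1 by [rewrite -s1 mulr_gt0//; lra]; rewrite pmulr_rgt0//; lra.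
have {}cs : n1 ^+ 2 <= q * m1.
  have : 0 <= (q - 2 * (n1 / m1) * n1 + (n1 / m1) ^+ 2 * m1) * m1 by rewrite mulr_ge0// ltW.
  rewrite [X in 0 <= X](_ : _ = q * m1 - n1 ^+ 2) ?subr_ge0//.
  by field; rewrite gt_eqF.
have h : (p - 1) * n1 ^+ 2 < (2 * p - 3) * (q * m1).
  apply: (@lt_le_trans _ _ ((2 * p - 3) * n1 ^+ 2)).
    by rewrite ltr_pM2r ?exprn_gt0//; lra.
  by rewrite ler_pM2l//; lra.
have zp : 0 < Z ^+ 2 * p ^+ 2 by rewrite mulr_gt0// exprn_gt0//; lra.
rewrite -(ltr_pM2l zp).
have -> : Z ^+ 2 * p ^+ 2 * (3 * E2 ^+ 2) = 12 * (p - 1) * ((p - 1) * n1 ^+ 2).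
  have -> : Z ^+ 2 * p ^+ 2 * (3 * E2 ^+ 2) = 3 * (Z * E2 * p) ^+ 2 by ring.
  by rewrite e2 -mulrA (mulrC m2) s1; ring.
have -> : Z ^+ 2 * p ^+ 2 * E4 = 12 * (p - 1) * ((2 * p - 3) * (q * m1)).
  have -> : Z ^+ 2 * p ^+ 2 * E4 = Z * 1 * (Z * E4 * p) * p by ring.
  rewrite e0 e4 -(mulrA 2 m4) (mulrC m4) s2.
  have -> : 2 * m1 * (2 * (3 * (p - 1) * m3)) * p = 12 * (p - 1) * m1 * (p * m3) by ring.
  by rewrite s3; ring.
by rewrite ltr_pM2l// mulr_gt0//; lra.
Qed.

Section power_moments.
Context {R : realType}.
Variable p : R.
Hypothesis p1 : 1 < p.

Let p0 : 0 < p. Proof. exact: lt_trans p1. Qed.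

Let dens (s v : R) : R := expR (s * v - expR (p * v)).

Let mdens s : measurable_fun setT (dens s).
Proof.
apply: (measurableT_comp (@measurable_expR R)); apply: measurable_funB; first exact: measurable_funM.
by apply: (measurableT_comp (@measurable_expR R)); exact: measurable_funM.
Qed.

Let dens_le s : 0 < s -> exists2 K, 0 <= K &
  forall v, dens s v <= K * expR (- (Num.min 1 s * `|v|)).
Proof.
move=> s0; exists (expR ((s + 1) ^+ 2 / (2 * p ^+ 2))); first exact: expR_ge0.
move=> v; rewrite -expRD ler_expR.
have m1 : Num.min 1 s <= 1 by rewrite ge_min lexx.
have ms : Num.min 1 s <= s by rewrite ge_min lexx orbT.
have pp : 0 < 2 * p ^+ 2 by rewrite mulr_gt0// exprn_gt0.
have [v0|v0] := leP 0 v.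
  rewrite ger0_norm//.
  have h1 : Num.min 1 s * v <= v by rewrite ler_piMl.
  have h2 : 1 + (p * v) ^+ 2 / 2 <= expR (p * v).
    by have := expR_ge1Dxn 1 (mulr_ge0 (ltW p0) v0).
  suff h3 : (s + 1) * v - (p * v) ^+ 2 / 2 <= (s + 1) ^+ 2 / (2 * p ^+ 2).
    by move: h1 h2 h3; rewrite mulrDl mul1r; lra.
  rewrite ler_pdivlMr//; have := sqr_ge0 (p ^+ 2 * v - (s + 1)); nra.
have h1 : Num.min 1 s * - v <= s * - v by rewrite ler_wpM2r// oppr_ge0 ltW.
rewrite ltr0_norm//; have := expR_ge0 (p * v).
have : 0 <= (s + 1) ^+ 2 / (2 * p ^+ 2) by rewrite divr_ge0 ?sqr_ge0// ltW.
by move: h1; rewrite mulrN; lra.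
Qed.

Let dens_int s : 0 < s -> (@lebesgue_measure R).-integrable setT (EFin \o dens s).
Proof.
move=> s0; have [K K0 h] := dens_le s0.
apply/integrableP; split; first by apply/measurable_EFinP; exact: mdens.
under eq_integral do rewrite /= ger0_norm ?expR_ge0//.
apply: (@integral_le_expRN_lty _ _ K (Num.min 1 s)) => //; first by rewrite lt_min ltr01.
by move=> v; rewrite expR_ge0 h.
Qed.

(** With x = e^v this is the integral of x^(s-1) exp(-x^p) over x > 0, that is Gamma(s / p) / p; the
    step from s to s + p is the functional equation of Gamma. *)
Let mom (s : R) : R := \int[@lebesgue_measure R]_v dens s v.

Let momE s : 0 < s -> (\int[@lebesgue_measure R]_v (dens s v)%:E = (mom s)%:E)%E.
Proof. by move=> s0; rewrite fineK//; apply: integrable_fin_num => //; exact: dens_int. Qed.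

Let mom_step s : 0 < s -> p * mom (s + p) = s * mom s.
Proof.
move=> s0; have sp : 0 < s + p by rewrite addr_gt0.
have dd (v : R) : is_derive v 1 (dens s) (s * dens s v - p * dens (s + p) v).
  have d0 (c : R) : is_derive v 1 (fun y : R => c * y) c.
    by apply: is_derive_eq; rewrite -[_ *: _]/(_ * _) mulr1.
  have d1 : is_derive v 1 (fun y : R => expR (p * y)) (expR (p * v) * p) by exact: is_derive1_comp.
  have d2 : is_derive v 1 (fun y : R => s * y - expR (p * y)) (s - expR (p * v) * p).
    by have := d0 s => ds; exact: is_deriveB.
  have d3 : is_derive v 1 (dens s) (dens s v * (s - expR (p * v) * p)) by exact: is_derive1_comp.
  apply: is_derive_eq; rewrite (_ : dens (s + p) v = dens s v * expR (p * v)); first by ring.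
  by rewrite /dens -expRD; congr expR; ring.
have cd (e : R) : continuous (dens e).
  move=> v; apply: continuous_comp; last exact: continuous_expR.
  apply: cvgB; first exact: mulrl_continuous.
  by apply: continuous_comp; [exact: mulrl_continuous|exact: continuous_expR].
have i1 := dens_int s0; have i2 := dens_int sp.
have i1' : (@lebesgue_measure R).-integrable setT (EFin \o (fun v => s * dens s v)).
  exact: (integrableZl measurableT s i1).
have i2' : (@lebesgue_measure R).-integrable setT (EFin \o (fun v => p * dens (s + p) v)).
  exact: (integrableZl measurableT p i2).
have lim (u : R^nat) : (forall n, `|u n| = n%:R) -> dens s (u n) @[n --> \oo] --> (0 : R).
  move=> un; have [K K0 h] := dens_le s0; have m0 : 0 < Num.min 1 s by rewrite lt_min ltr01.
  apply: (@cvg0_harmonic_le _ _ (K / Num.min 1 s)) => n.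
  rewrite ger0_norm ?expR_ge0//; apply: (le_trans (h _)); rewrite un -mulrA ler_wpM2l//.
  rewrite expRN -invfM lef_pV2 ?posrE ?expR_gt0 ?mulr_gt0//.
  apply: le_trans (expR_ge1Dx _); rewrite -natr1 mulrDr mulr1 addrC lerD2r.
  by rewrite ge_min lexx.
have : \int[@lebesgue_measure R]_v (s * dens s v - p * dens (s + p) v) = 0.
  apply: (integral_derive_eq0 dd).
  - by move=> v; apply: cvgB; apply: cvgMr; exact: cd.
  - exact: (integrableB measurableT i1' i2').
  - by apply: lim => n; rewrite ger0_norm.
  - by apply: lim => n; rewrite normrN ger0_norm.
rewrite (RintegralB measurableT i1' i2') (RintegralZl s measurableT i1) (RintegralZl p measurableT i2) => h.
by apply/esym/eqP; rewrite -subr_eq0 h.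
Qed.

Let EwX n : (n <= 3)%N -> Zw p * Ew p (fun u => u ^+ n.*2) = 2 * mom (n.*2%:R * (p - 1) + 1).
Proof.
move=> n3; have s0 : 0 < n.*2%:R * (p - 1) + 1 :> R by rewrite ltr_pwDr// mulr_ge0// subr_ge0 ltW.
apply: EFin_inj; rewrite [RHS]EFinM -(momE s0) (@Ew_exp _ p (fun u => u ^+ n.*2) (ltW p1)); first last.
- by move=> u; rewrite -mul2n exprM sqrrN -exprM.
- by move=> u; rewrite -mul2n exprM exprn_ge0// sqr_ge0.
- by apply: admissibleX; rewrite -mul2n; apply: (@leq_trans (2 * 3)%N) => //; rewrite leq_mul2l.
- exact: exprn_continuous.
congr (_ * _)%E; apply: eq_integral => v _; congr EFin.
by rewrite -expRM_natl -!expRD; congr expR; ring.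
Qed.

(** The Gaussian has equality. The excess E Y^4 - 3 (E Y^2)^2 is twelve times the variance of the
    mixing law, and its positivity is the source of all strict gains for p > 2. *)
Lemma Ew_kurtosis : 2 < p -> 3 * Ew p (fun u => u ^+ 2) ^+ 2 < Ew p (fun u => u ^+ 4).
Proof.
move=> p2; have Z0 := Zw_gt0 (ltW p1).
have p10 : 0 < p - 1 by lra.
have q1 : 0 < 3 * (p - 1) by lra.
have q2 : 0 < 2 * p - 3 by lra.
have a2 : 1.*2%:R * (p - 1) + 1 = p - 1 + p by rewrite -[1.*2]/2%N; lra.
have a4 : 2.*2%:R * (p - 1) + 1 = 3 * (p - 1) + p by rewrite -[2.*2]/4%N; lra.
have a3 : 3 * (p - 1) = 2 * p - 3 + p by lra.
(* p - 1 is the midpoint of 1 and 2p - 3, so the expression is the integral of [dens 1] times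
   (exp((p - 2) v) - c)^2. *)
have cs c : 0 <= mom (2 * p - 3) - 2 * c * mom (p - 1) + c ^+ 2 * mom 1.
  have i1 := @dens_int (2 * p - 3); have i2 := @dens_int (p - 1); have i3 := @dens_int 1.
  have j2 := integrableZl measurableT (2 * c) (i2 p10); have j3 := integrableZl measurableT (c ^+ 2) (i3 ltr01).
  have {}i1 := i1 (ltac:(lra) : 0 < 2 * p - 3).
  have j12 := integrableB measurableT i1 j2.
  rewrite -(RintegralZl (2 * c) measurableT (i2 p10)) -(RintegralZl (c ^+ 2) measurableT (i3 ltr01)).
  rewrite -(RintegralB measurableT i1 j2) -(RintegralD measurableT j12 j3).
  apply: Rintegral_ge0 => v _.
  have -> : dens (2 * p - 3) v = dens 1 v * expR ((p - 2) * v) ^+ 2.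
    by rewrite /dens expr2 -!expRD; congr expR; ring.
  have -> : dens (p - 1) v = dens 1 v * expR ((p - 2) * v).
    by rewrite /dens -!expRD; congr expR; ring.
  have : 0 <= dens 1 v * (expR ((p - 2) * v) - c) ^+ 2 by rewrite mulr_ge0 ?sqr_ge0 ?expR_ge0.
  by move: (dens 1 v) (expR _) => x y; congr (_ <= _); ring.
have E2 : 0 < Ew p (fun u => u ^+ 2).
  apply: (@Ew_gt0 _ _ 1 2 1); [exact: ltW|exact: admissibleX|move=> u; exact: sqr_ge0|exact: ltr01|by rewrite ltr1n|].
  by move=> x /andP[x1 _]; rewrite exprn_ege1// phi_ge1// ltW.
have e0 := @EwX 0 isT; have e2 := @EwX 1 isT; have e4 := @EwX 2 isT.
rewrite (_ : Ew p (fun u => u ^+ 0.*2) = 1) in e0; last by rewrite (Ew_cst 1 (ltW p1)).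
rewrite mul0r add0r in e0.
have s1 := mom_step p10; have s2 := mom_step q1; have s3 := mom_step q2.
rewrite -a2 in s1; rewrite -a4 in s2; rewrite -a3 in s3.
exact: (kurtosis_algebra p2 Z0 E2 e0 e2 e4 s1 s2 s3 (cs _)).
Qed.

End power_moments.

(** * Test functions for the mixture and elementary exponential inequalities *)

(** Under the Gaussian dilated by s, with m = s^2 / 4, the function cos(sqrt z u) has mean exp(-zm),
    and u^2, u^4, u^6 have means 2m, 12m^2, 120m^3. Dividing by these numbers makes the mean an
    exponential sum plus c0 + c1 m + c2 m^2 + c3 m^3. *)
Definition cos_poly (R : realType) (l : seq (R * R)) (c0 c1 c2 c3 : R) (u : R) : R :=
  \sum_(z <- l) z.1 * cos (Num.sqrt z.2 * u) +
  (c0 + (c1 / 2 * u ^+ 2 + (c2 / 12 * u ^+ 4 + c3 / 120 * u ^+ 6))).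

Lemma admissible_dilate (R : realType) (k : R -> R) (s : R) : admissible k -> admissible (fun u => k (s * u)).
Proof.
move=> [mk [C kC]]; split; first by apply: measurableT_comp => //; exact: measurable_funM.
exists (C * (1 + `|s| ^+ 6)) => u; apply: (le_trans (kC _)); rewrite -mulrA ler_wpM2l//.
  by have := kC 0; rewrite normr0 expr0n addr0 mulr1; apply: le_trans.
rewrite normrM exprMn mulrDl mul1r mulrDr mulr1.
have := exprn_ge0 6 (normr_ge0 s); have := exprn_ge0 6 (normr_ge0 u).
by move: (`|s| ^+ 6) (`|u| ^+ 6) => x y; lra.
Qed.

Lemma admissible_cos_sum (R : realType) (l : seq (R * R)) :
  admissible (fun u => \sum_(z <- l) z.1 * cos (Num.sqrt z.2 * u)).
Proof.
elim: l => [|z l ih].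
  by rewrite (_ : (fun u => _) = cst 0); [exact: admissible_cst|apply/funext => u; rewrite big_nil].
rewrite (_ : (fun u => _) = (fun u => z.1 * cos (Num.sqrt z.2 * u) + \sum_(z <- l) z.1 * cos (Num.sqrt z.2 * u))).
  by apply: admissibleD => //; apply: admissibleZ; exact: admissible_cos.
by apply/funext => u; rewrite big_cons.
Qed.

Lemma Ew_cos_sum (R : realType) (r s : R) (l : seq (R * R)) : 1 <= r ->
  Ew r (fun u => \sum_(z <- l) z.1 * cos (Num.sqrt z.2 * (s * u))) =
  \sum_(z <- l) z.1 * cf r (Num.sqrt z.2 * s).
Proof.
move=> r1; elim: l => [|z l ih].
  rewrite big_nil (_ : (fun u => _) = cst 0) ?Ew_cst//.
  by apply/funext => u; rewrite big_nil.
have a := admissible_dilate s (admissible_cos_sum l).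
have ac := admissible_dilate s (admissible_cos (Num.sqrt z.2)).
rewrite big_cons -ih -[cf _ _](_ : Ew r (fun u => cos (Num.sqrt z.2 * (s * u))) = _).
  rewrite -(EwZ _ r1 ac) -(EwD r1 (admissibleZ _ ac) a); congr (Ew r _).
  by apply/funext => u; rewrite big_cons.
by rewrite /cf; congr (Ew r _); apply/funext => u; rewrite mulrA.
Qed.

Lemma Ew_cos_poly (R : realType) (r s : R) (l : seq (R * R)) (c0 c1 c2 c3 : R) : 1 <= r ->
  Ew r (fun u => cos_poly l c0 c1 c2 c3 (s * u)) =
  \sum_(z <- l) z.1 * cf r (Num.sqrt z.2 * s) +
  (c0 + (c1 / 2 * s ^+ 2 * Ew r (fun u => u ^+ 2) + (c2 / 12 * s ^+ 4 * Ew r (fun u => u ^+ 4) +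
   c3 / 120 * s ^+ 6 * Ew r (fun u => u ^+ 6)))).
Proof.
move=> r1; have a2 := @admissibleX R 2 isT; have a4 := @admissibleX R 4 isT; have a6 := @admissibleX R 6 isT.
have aZ c n : admissible (fun u : R => u ^+ n) -> admissible (fun u : R => c * u ^+ n).
  by move=> an; exact: admissibleZ.
have ap := admissibleD (admissible_cst c0) (admissibleD (aZ (c1 / 2 * s ^+ 2) _ a2)
  (admissibleD (aZ (c2 / 12 * s ^+ 4) _ a4) (aZ (c3 / 120 * s ^+ 6) _ a6))).
have a := admissible_dilate s (admissible_cos_sum l).
rewrite -(Ew_cos_sum s l r1) -(EwZ _ r1 a2) -(EwZ _ r1 a4) -(EwZ _ r1 a6).
rewrite -(EwD r1 (aZ _ _ a4) (aZ _ _ a6)) -(EwD r1 (aZ _ _ a2) (admissibleD (aZ _ _ a4) (aZ _ _ a6))).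
rewrite -{2}(Ew_cst c0 r1) -(EwD r1 (admissible_cst c0) (admissibleD (aZ _ _ a2)
  (admissibleD (aZ _ _ a4) (aZ _ _ a6)))) -(EwD r1 a ap).
by congr (Ew r _); apply/funext => u; rewrite /cos_poly /= !exprMn !mulrA.
Qed.

Lemma admissible_cos_poly (R : realType) (l : seq (R * R)) (c0 c1 c2 c3 : R) :
  admissible (cos_poly l c0 c1 c2 c3).
Proof.
apply: admissibleD; first exact: admissible_cos_sum.
apply: admissibleD; first exact: admissible_cst.
apply: admissibleD; first by apply: admissibleZ; exact: admissibleX.
by apply: admissibleD; apply: admissibleZ; exact: admissibleX.
Qed.

Lemma continuous_cos_poly (R : realType) (l : seq (R * R)) (c0 c1 c2 c3 : R) :
  continuous (cos_poly l c0 c1 c2 c3).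
Proof.
move=> u; apply: cvgD.
  elim: l => [|z l ih].
    by under eq_fun do rewrite big_nil; rewrite big_nil; exact: cvg_cst.
  under eq_fun do rewrite big_cons; rewrite big_cons; apply: cvgD => //.
  by apply: cvgMr; exact: continuous_cos_mul.
apply: cvgD; first exact: cvg_cst.
apply: cvgD; first by apply: cvgMr; exact: exprn_continuous.
by apply: cvgD; apply: cvgMr; exact: exprn_continuous.
Qed.

Lemma cosh_ge (R : realType) (z : R) : z ^+ 2 / 4 <= expR z + expR (- z) - 2.
Proof.
wlog z0 : z / 0 <= z => [h|].
  have [/h//|/ltW z0] := leP 0 z.
  by have := h (- z); rewrite oppr_ge0 sqrrN opprK (addrC (expR (- z))) => /(_ z0).
have h1 : (1 + z / 2) ^+ 2 <= expR z.
  have -> : expR z = expR (z / 2) ^+ 2 by rewrite expr2 -expRD; congr expR; field.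
  by rewrite lerXn2r ?nnegrE ?expR_ge0 ?expR_ge1Dx// addr_ge0// divr_ge0.
have := expR_ge1Dx (- z); nra.
Qed.

(** Jensen's inequality, by the tangent line of the exponential at the mean [m]. *)
Lemma expR_sum_le (R : realType) n (th y : 'I_n -> R) : (forall i, 0 <= th i) -> \sum_i th i = 1 ->
  expR (\sum_i th i * y i) <= \sum_i th i * expR (y i).
Proof.
move=> th0 th1; set m := \sum_i th i * y i.
have -> : expR m = \sum_i th i * (expR m * (1 + (y i - m))).
  rewrite -[LHS]mulr1; under [RHS]eq_bigr do rewrite mulrCA.
  rewrite -mulr_sumr; congr (_ * _).
  under eq_bigr do rewrite mulrDr mulr1 mulrBr.
  by rewrite big_split/= sumrB -mulr_suml th1 mul1r subrr addr0.
apply: ler_sum => i _; rewrite ler_wpM2l//.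
have -> : expR (y i) = expR m * expR (y i - m) by rewrite -expRD; congr expR; ring.
by rewrite ler_wpM2l ?expR_ge0// expR_ge1Dx.
Qed.

(** mu and nu stand for independent copies of the mixing variable. After symmetrisation the
    difference of exponentials is S (cosh z - 1) with S = exp(-m (mu + nu)) and z = (x - y)(mu - nu)
    / 2. The bounds cosh z - 1 >= z^2 / 8 and S >= 1 - m (mu + nu) leave a gain of degree 3 in each
    variable, which moments can evaluate. The parameter t is taken to be 0 for bare log-convexity
    and 1 for the gain. *)
Lemma two_point_pointwise (R : realType) (x y m g mu nu t : R) : 0 <= t <= 1 ->
  m = (x + y) / 2 -> g = t * ((x - y) / 2) ^+ 2 / 8 ->
  0 <= 2^-1 * (expR (- (y * nu)) * expR (- (x * mu)) + expR (- (x * nu)) * expR (- (y * mu))) -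
    expR (- (m * nu)) * expR (- (m * mu)) - g * ((1 - m * (mu + nu)) * (mu - nu) ^+ 2).
Proof.
move=> /andP[t0 t1] mE gE.
pose z := (x - y) / 2 * (mu - nu); pose S := expR (- (m * (mu + nu))).
have -> : expR (- (y * nu)) * expR (- (x * mu)) = S * expR (- z).
  by rewrite -!expRD; congr expR; rewrite mE /z; field.
have -> : expR (- (x * nu)) * expR (- (y * mu)) = S * expR z.
  by rewrite -!expRD; congr expR; rewrite mE /z; field.
have -> : expR (- (m * nu)) * expR (- (m * mu)) = S.
  by rewrite -!expRD; congr expR; rewrite mE; field.
have -> : g * ((1 - m * (mu + nu)) * (mu - nu) ^+ 2) = t * (1 - m * (mu + nu)) * (z ^+ 2 / 8).
  by rewrite gE /z; field.
have S0 : 0 <= S by exact: expR_ge0.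
have S1 : 1 - m * (mu + nu) <= S by apply: expR_ge1Dx.
have tS : t * (1 - m * (mu + nu)) <= S.
  have [a0|/ltW a0] := leP 0 (1 - m * (mu + nu)); first by apply: le_trans S1; rewrite ler_piMl.
  by apply: le_trans S0; rewrite mulr_ge0_le0.
have h1 : t * (1 - m * (mu + nu)) * (z ^+ 2 / 8) <= S * (z ^+ 2 / 8).
  by rewrite ler_wpM2r// divr_ge0// sqr_ge0.
have h2 := ler_wpM2l S0 (cosh_ge z).
by move: (t * _ * _) h1 h2 => q; rewrite !mulrDr; lra.
Qed.

(** * The case 2 < p *)

Section mixture_gt2.
Context {R : realType}.
Variable p : R.
Hypothesis p2 : 2 < p.

Let p1 : 1 <= p. Proof. exact: le_trans (le12 R) (ltW p2). Qed.

(* [cfsq], [mixm1], [mixm2], [mixm3] are the Laplace transform and the moments of the mixing law. *)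
Definition cfsq (s : R) : R := cf p (Num.sqrt s).
Definition mixm1 : R := Ew p (fun u => u ^+ 2) / 2.
Definition mixm2 : R := Ew p (fun u => u ^+ 4) / 12.
Definition mixm3 : R := Ew p (fun u => u ^+ 6) / 120.

(** An inequality valid for each m > 0 is integrated against the mixing law: exp(-zm) gives
    [cfsq z], and m, m^2, m^3 give its moments. Through this statement the mixture enters the case p
    > 2. *)
Lemma cfsq_mixture (l : seq (R * R)) (c0 c1 c2 c3 : R) : all (fun z => 0 <= z.2) l ->
  (forall m, 0 < m -> 0 <= \sum_(z <- l) z.1 * expR (- (z.2 * m)) +
    (c0 + c1 * m + c2 * m ^+ 2 + c3 * m ^+ 3)) ->
  0 <= \sum_(z <- l) z.1 * cfsq z.2 + (c0 + c1 * mixm1 + c2 * mixm2 + c3 * mixm3).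
Proof.
move=> l0 h.
have : 0 <= Ew p (cos_poly l c0 c1 c2 c3).
  apply: (@Ew_mixture R 2 p) => //.
  - by rewrite ltr1n.
  - exact: continuous_cos_poly.
  - exact: admissible_cos_poly.
  - move=> u; rewrite /cos_poly; congr (_ + _).
      by apply: eq_bigr => z _; rewrite mulrN cosN.
    by ring.
  move=> s s0; rewrite (Ew_cos_poly _ _ _ _ _ _ (le12 R)).
  have [-> -> ->] := Ew2_X R.
  have s4 : 0 < s ^+ 2 / 4 by rewrite divr_gt0// exprn_gt0.
  apply: le_trans (h _ s4) _; apply: lerD.
    rewrite le_eqVlt; apply/orP; left; apply/eqP; apply: eq_big_seq => z zl.
    have z0 := allP l0 _ zl; by rewrite cf2E exprMn sqr_sqrtr//; congr (_ * expR _); field.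
  by rewrite le_eqVlt; apply/orP; left; apply/eqP; field.
have -> : cos_poly l c0 c1 c2 c3 = (fun u => cos_poly l c0 c1 c2 c3 (1 * u)).
  by apply/funext => u; rewrite mul1r.
rewrite (Ew_cos_poly _ _ _ _ _ _ p1); congr (_ <= _).
congr (_ + _); first by apply: eq_bigr => z _; rewrite mulr1.
by rewrite /mixm1 /mixm2 /mixm3 !expr1n; field.
Qed.

(** Jensen's inequality under the mixing law: the test function is exp(-sm) minus its tangent line
    at m = [mixm1]. *)
Lemma cfsq_ge (s : R) : 0 <= s -> expR (- (s * mixm1)) <= cfsq s.
Proof.
move=> s0; pose e := expR (- (s * mixm1)).
have h : forall m, 0 < m -> 0 <= \sum_(z <- [:: (1, s)]) z.1 * expR (- (z.2 * m)) +
    (- (e * (1 + s * mixm1)) + e * s * m + 0 * m ^+ 2 + 0 * m ^+ 3).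
  move=> m _; rewrite big_seq1 /= mul1r.
  have -> : - (s * m) = - (s * mixm1) + (s * mixm1 - s * m) by ring.
  rewrite expRD -/e; have e0 : 0 <= e by exact: expR_ge0.
  have := ler_wpM2l e0 (expR_ge1Dx (s * mixm1 - s * m)).
  by move: {e0} (expR (s * mixm1 - s * m)) (e) mixm1 => x f w; lra.
have l0 : all (fun z : R * R => 0 <= z.2) [:: (1, s)] by rewrite /= s0.
have := cfsq_mixture l0 h; rewrite big_seq1 /= mul1r -/e.
by move: (cfsq s) (e) (mixm1) (mixm2) (mixm3) => f e' w1 w2 w3; lra.
Qed.

Lemma cfsq_gt0 (s : R) : 0 <= s -> 0 < cfsq s.
Proof. by move=> s0; apply: lt_le_trans (cfsq_ge s0); exact: expR_gt0. Qed.

Lemma cfsq_le1 (s : R) : cfsq s <= 1.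
Proof. by apply: le_trans (ler_norm _) _; exact: normr_cf_le1. Qed.

(** [cfsq_mixture] is applied twice, to mu with nu fixed and then to nu, which acts as an
    independent copy. The mean of (1 - m (mu + nu)) (mu - nu)^2 is twice the variance minus 2m times
    the covariance of mu and mu^2. *)
Lemma cfsq_two_point (x y m t : R) : 0 <= x -> 0 <= y -> 0 <= t <= 1 -> m = (x + y) / 2 ->
  cfsq m ^+ 2 + 2 * (t * ((x - y) / 2) ^+ 2 / 8) * ((mixm2 - mixm1 ^+ 2) - m * (mixm3 - mixm1 * mixm2)) <=
  cfsq x * cfsq y.
Proof.
move=> x0 y0 t01 mE; set g := t * _ / 8.
have m0 : 0 <= m by rewrite mE divr_ge0// addr_ge0.
have step1 nu : 0 < nu -> 0 <= 2^-1 * (cfsq x * expR (- (y * nu)) + cfsq y * expR (- (x * nu))) -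
   cfsq m * expR (- (m * nu)) - g * ((1 - m * nu) * nu ^+ 2 -
   (2 * (1 - m * nu) * nu + m * nu ^+ 2) * mixm1 + (1 - m * nu + 2 * m * nu) * mixm2 - m * mixm3).
  move=> nu0; pose l := [:: (2^-1 * expR (- (y * nu)), x); (2^-1 * expR (- (x * nu)), y);
    (- expR (- (m * nu)), m)].
  have l0 : all (fun z : R * R => 0 <= z.2) l by rewrite /= x0 y0 m0.
  have h : forall mu, 0 < mu -> 0 <= \sum_(z <- l) z.1 * expR (- (z.2 * mu)) +
     (- g * ((1 - m * nu) * nu ^+ 2) + g * (2 * (1 - m * nu) * nu + m * nu ^+ 2) * mu +
      - g * (1 - m * nu + 2 * m * nu) * mu ^+ 2 + g * m * mu ^+ 3).
    move=> mu _; rewrite !big_cons big_nil /=.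
    have := two_point_pointwise mu nu t01 mE (erefl g).
    move: (expR _) (expR _) (expR _) (expR _) (expR _) (expR _) => e1 e2 e3 e4 e5 e6.
    by congr (_ <= _); ring.
  have := cfsq_mixture l0 h; rewrite !big_cons big_nil /=.
  move: (expR _) (expR _) (expR _) => e1 e2 e3.
  by congr (_ <= _); ring.
pose l := [:: (2^-1 * cfsq x, y); (2^-1 * cfsq y, x); (- cfsq m, m)].
have l0 : all (fun z : R * R => 0 <= z.2) l by rewrite /= x0 y0 m0.
have h : forall nu, 0 < nu -> 0 <= \sum_(z <- l) z.1 * expR (- (z.2 * nu)) +
    (- g * (mixm2 - m * mixm3) + - g * (- 2 * mixm1 + m * mixm2) * nu + - g * (1 + m * mixm1) * nu ^+ 2 + g * m * nu ^+ 3).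
  move=> nu nu0; rewrite !big_cons big_nil /=; have := step1 _ nu0.
  move: (expR _) (expR _) (expR _) => e1 e2 e3.
  by congr (_ <= _); ring.
have := cfsq_mixture l0 h; rewrite !big_cons big_nil /=.
move=> K; rewrite -subr_ge0; move: K; congr (_ <= _).
by field.
Qed.

(** The ratio f((x + y) / 2) / sqrt(f(x) f(y)) for f = [cfsq]. It is at most 1 by log-convexity, and
    its distance to 1 is the defect. *)
Definition cfsq_cross (x y : R) : R := cfsq ((x + y) / 2) * expR (- ((ln (cfsq x) + ln (cfsq y)) / 2)).

Lemma cfsq_cross_le (x y w : R) : 0 <= x -> 0 <= y -> 0 <= w ->
  cfsq ((x + y) / 2) ^+ 2 + 2 * w <= cfsq x * cfsq y -> cfsq_cross x y <= 1 - w.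
Proof.
move=> x0 y0 w0 h; have m0 : 0 <= (x + y) / 2 by rewrite divr_ge0// addr_ge0.
have E0 : 0 <= cfsq_cross x y by rewrite mulr_ge0 ?expR_ge0// ltW// cfsq_gt0.
have E2 : cfsq_cross x y ^+ 2 * (cfsq x * cfsq y) = cfsq ((x + y) / 2) ^+ 2.
  have ex : expR (ln (cfsq x)) = cfsq x by rewrite lnK// posrE cfsq_gt0.
  have ey : expR (ln (cfsq y)) = cfsq y by rewrite lnK// posrE cfsq_gt0.
  have e1 (u v : R) : expR (- ((u + v) / 2)) ^+ 2 * (expR u * expR v) = 1.
    by rewrite -expRD expr2 -!expRD -[RHS]expR0; congr expR; field.
  by have := e1 (ln (cfsq x)) (ln (cfsq y)); rewrite ex ey /cfsq_cross exprMn => e2; rewrite -mulrA e2 mulr1.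
have xy1 : cfsq x * cfsq y <= 1 by rewrite mulr_ile1 ?cfsq_le1// ltW// cfsq_gt0.
have xy0 : 0 < cfsq x * cfsq y by rewrite mulr_gt0 ?cfsq_gt0.
move: h; rewrite -E2; move: (cfsq_cross x y) E0 (cfsq x * cfsq y) xy1 xy0 => e e0 d d1 dp h.
have h2 : (1 - e ^+ 2 - 2 * w) * d >= 0 by nra.
have {}h2 : e ^+ 2 <= 1 - 2 * w by move: h2; rewrite pmulr_lge0//; lra.
by nra.
Qed.

Lemma cfsq_cross_le1 (x y : R) : 0 <= x -> 0 <= y -> cfsq_cross x y <= 1.
Proof.
move=> x0 y0; rewrite -[leRHS]subr0; apply: cfsq_cross_le => //; rewrite mulr0 addr0.
have := @cfsq_two_point x y _ 0 x0 y0; rewrite lexx ler01 => /(_ _ isT erefl).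
by rewrite !mul0r mulr0 mul0r addr0.
Qed.

(** A form of Hoelder's inequality that keeps the defects of pairs. With y_i = -(s_i m + ln f(s_i))
    / 2, the pointwise inequality exp(sum th_i y_i)^2 <= (sum th_i exp(y_i))^2 is expanded into a
    double sum before integrating over m, so that each pair contributes its own [cfsq_cross]. *)
Lemma cfsq_jensen n (th s : 'I_n -> R) : (forall i, 0 <= th i) -> \sum_i th i = 1 ->
  (forall i, 0 <= s i) ->
  cfsq (\sum_i th i * s i) <= expR (\sum_i th i * ln (cfsq (s i))) *
    \sum_i \sum_j th i * th j * cfsq_cross (s i) (s j).
Proof.
move=> th0 th1 s0; set L := \sum_i th i * ln _; set sb := \sum_i th i * s i.
pose T i j := (th i * th j * expR (- ((ln (cfsq (s i)) + ln (cfsq (s j))) / 2)), (s i + s j) / 2).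
pose l := (- expR (- L), sb) :: [seq T i j | i <- enum 'I_n, j <- enum 'I_n].
have sb0 : 0 <= sb by rewrite sumr_ge0// => i _; rewrite mulr_ge0.
have l0 : all (fun z : R * R => 0 <= z.2) l.
  rewrite /= sb0; apply/allP => _ /allpairsP[[i j] [_ _ ->]] /=.
  by rewrite divr_ge0// addr_ge0.
have sumT (f : R -> R) : \sum_(z <- l) z.1 * f z.2 = - expR (- L) * f sb +
    \sum_i \sum_j th i * th j * (f ((s i + s j) / 2) * expR (- ((ln (cfsq (s i)) + ln (cfsq (s j))) / 2))).
  rewrite big_cons /= big_allpairs_dep; congr (_ + _).
  rewrite big_enum /=; apply: eq_bigr => i _; rewrite big_enum /=; apply: eq_bigr => j _.
  by rewrite mulrAC -mulrA.
have h : forall m, 0 < m -> 0 <= \sum_(z <- l) z.1 * expR (- (z.2 * m)) + (0 + 0 * m + 0 * m ^+ 2 + 0 * m ^+ 3).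
  move=> m _; rewrite !mul0r !addr0 (sumT (fun x => expR (- (x * m)))).
  pose y i := - (s i * m + ln (cfsq (s i))) / 2.
  have -> : - expR (- L) * expR (- (sb * m)) = - expR (\sum_i th i * y i) ^+ 2.
    rewrite mulNr; congr (- _); rewrite expr2 -!expRD; congr expR.
    rewrite /L /sb mulr_suml -!sumrN -!big_split /=; by apply: eq_bigr => i _; rewrite /y; field.
  have -> : \sum_i \sum_j th i * th j * (expR (- ((s i + s j) / 2 * m)) *
      expR (- ((ln (cfsq (s i)) + ln (cfsq (s j))) / 2))) = (\sum_i th i * expR (y i)) ^+ 2.
    rewrite expr2 mulr_suml; apply: eq_bigr => i _; rewrite mulr_sumr; apply: eq_bigr => j _.
    by rewrite [RHS]mulrACA -!expRD; congr (_ * expR _); rewrite /y; field.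
  by rewrite addrC subr_ge0 lerXn2r ?nnegrE ?expR_ge0 ?sumr_ge0// ?expR_sum_le// => i _; rewrite mulr_ge0 ?expR_ge0.
have := cfsq_mixture l0 h; rewrite !mul0r !addr0 sumT addrC mulNr subr_ge0.
rewrite expRN ler_pdivrMl ?expR_gt0//.
Qed.

(** For x, y at most V / (2B) the covariance term costs at most half of the variance V. The
    two-point inequality with t = 1 then has the gain (x - y)^2 V / 32, which is twice the defect (V
    / 64) (x - y)^2. *)
Lemma cfsq_strict : 3 * Ew p (fun u => u ^+ 2) ^+ 2 < Ew p (fun u => u ^+ 4) ->
  exists k e, [/\ 0 < k, 0 < e & forall x y, 0 <= x <= e -> 0 <= y <= e -> cfsq_cross x y <= 1 - k * (x - y) ^+ 2].
Proof.
move=> kur; pose V := mixm2 - mixm1 ^+ 2; pose B := `|mixm3 - mixm1 * mixm2| + 1.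
have V0 : 0 < V by rewrite /V /mixm2 /mixm1; move: kur; move: (Ew p _) (Ew p _) => a b; nra.
have B0 : 0 < B by rewrite ltr_pwDr.
exists (V / 64), (V / 2 / B); split; [by rewrite divr_gt0|by rewrite !divr_gt0|].
move=> x y /andP[x0 xe] /andP[y0 ye]; apply: cfsq_cross_le => //; first by rewrite mulr_ge0 ?sqr_ge0// ltW// divr_gt0.
have := @cfsq_two_point x y _ 1 x0 y0; rewrite lexx ler01 => /(_ _ isT erefl); apply: le_trans.
rewrite lerD2l; have mB : (x + y) / 2 * (mixm3 - mixm1 * mixm2) <= V / 2.
  have m0 : 0 <= (x + y) / 2 by rewrite divr_ge0// addr_ge0.
  apply: (@le_trans _ _ ((x + y) / 2 * B)).
    by rewrite ler_wpM2l// (le_trans (ler_norm _))// lerDl.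
  by rewrite -ler_pdivlMr//; lra.
have : 0 <= (x - y) ^+ 2 * (V / 2 - (x + y) / 2 * (mixm3 - mixm1 * mixm2)) by rewrite mulr_ge0 ?sqr_ge0// subr_ge0.
rewrite -/V; move: ((x + y) / 2 * (mixm3 - mixm1 * mixm2)) (V) mB V0 => z w zw w0; nra.
Qed.

End mixture_gt2.

(** * From characteristic functions to first moments, for p > 2 *)

Lemma integral_gain (R : realType) (f g : R -> R) (x y e A B : R) :
  measurable_fun setT f -> measurable_fun setT g -> (forall t, 0 <= f t) ->
  (\int[@lebesgue_measure R]_t (f t)%:E = x%:E)%E ->
  (\int[@lebesgue_measure R]_t (g t)%:E = y%:E)%E ->
  (forall t, f t <= g t) -> 0 <= e -> A < B -> (forall t, A <= t <= B -> f t + e <= g t) ->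
  x + e * (B - A) <= y.
Proof.
move=> mf mg f0 fx gy fg e0 AB fe; rewrite -lee_fin EFinD -fx -gy.
have -> : (e * (B - A))%:E = (\int[@lebesgue_measure R]_t (e%:E * (\1_(`[A, B]%classic) t)%:E))%E.
  rewrite integral_cst_indic//.
  rewrite -[X in (_ * X)%E]/(@lebesgue_measure R `[A, B]%classic).
  by rewrite lebesgue_measure_itv/= lte_fin AB -EFinD -EFinM.
have mi : measurable_fun setT (fun t : R => (e%:E * (\1_(`[A, B]%classic) t)%:E)%E).
  by apply/measurable_EFinP; apply: measurable_funM.
have i0 (t : R) : (0 <= e%:E * (\1_(`[A, B]%classic) t)%:E)%E.
  by rewrite -EFinM lee_fin mulr_ge0// indicE.
have mf' : measurable_fun setT (fun t => (f t)%:E) by apply/measurable_EFinP.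
have mg' : measurable_fun setT (fun t => (g t)%:E) by apply/measurable_EFinP.
rewrite -ge0_integralD//; last by move=> t _; rewrite lee_fin.
apply: ge0_le_integral => //.
- by move=> t _; rewrite adde_ge0// lee_fin.
- by apply: emeasurable_funD.
move=> t _; rewrite -EFinM -EFinD lee_fin indicE; case: (boolP (t \in _)) => [|_].
  by rewrite inE/= in_itv/= => tAB; rewrite mulr1 fe.
by rewrite mulr0 addr0.
Qed.

Lemma Phi0_rep (R : realType) (l : seq (R * R)) : laws l ->
  (\int[@lebesgue_measure R]_t ((1 - cfs l t) * invsq t)%:E = (K0 R * Phi l 0)%:E)%E.
Proof.
move=> gl; rewrite -Phi_rep//; apply: eq_integral => t _.
by rewrite mulr0 cos0 mul1r.
Qed.

Lemma measurable_cfs_invsq (R : realType) (l : seq (R * R)) : laws l ->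
  measurable_fun setT (fun t => (1 - cfs l t) * invsq t).
Proof.
move=> gl; apply: measurable_funM; last exact: measurable_invsq.
by apply: measurable_funB => //; exact: measurable_cfs.
Qed.

Lemma cfs_le1 (R : realType) (l : seq (R * R)) (t : R) : laws l -> cfs l t <= 1.
Proof. by move=> gl; rewrite (le_trans (ler_norm _))// normr_cfs_le1. Qed.

(** A larger characteristic function means a smaller first moment. On [t0 / 2, t0], of length t0 /
    2, the weight t^-2 is at least t0^-2, whence the factor 1 / (2 t0). *)
Lemma Phi_gain (R : realType) (l l' : seq (R * R)) (e t0 : R) : laws l -> laws l' ->
  (forall t, 0 < t -> cfs l' t <= cfs l t) -> 0 <= e -> 0 < t0 ->
  (forall t, t0 / 2 <= t <= t0 -> cfs l' t + e <= cfs l t) ->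
  Phi l 0 + e / (2 * t0 * K0 R) <= Phi l' 0.
Proof.
move=> gl gl' le e0 t00 lee; have K := K0_gt0 R.
rewrite -(ler_pM2l K) mulrDr (_ : K0 R * (e / _) = e / t0 ^+ 2 * (t0 - t0 / 2)); last first.
  by field; rewrite !gt_eqF.
apply: (integral_gain _ _ _ (Phi0_rep gl) (Phi0_rep gl')).
- exact: measurable_cfs_invsq.
- exact: measurable_cfs_invsq.
- by move=> t; rewrite mulr_ge0 ?invsq_ge0// subr_ge0 cfs_le1.
- move=> t; rewrite /invsq; case: ifP => t1; last by rewrite !mulr0.
  by rewrite ler_pM2r ?invr_gt0 ?exprn_gt0// lerD2l lerN2 le.
- by rewrite divr_ge0// sqr_ge0.
- by rewrite ltr_pdivrMr//; lra.
move=> t tt; have /andP[t1 t2] := tt; have t3 : 0 < t by rewrite (lt_le_trans _ t1)// divr_gt0.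
rewrite /invsq t3; apply: (@le_trans _ _ ((1 - cfs l t) * t ^- 2 + e * t ^- 2)).
  rewrite lerD2l ler_wpM2l// lef_pV2 ?posrE ?exprn_gt0// lerXn2r ?nnegrE// ltW//.
by rewrite -mulrDl ler_pM2r ?invr_gt0 ?exprn_gt0//; have := lee _ tt; lra.
Qed.

(** 1 - [cfs] is at most min(1, v t^2), whose weighted integral is finite and the same for all
    lists, hence for all n. *)
Lemma Phi_le_gauss (R : realType) (v : R) : 0 <= v -> exists2 M, 0 < M &
  forall l, laws l -> (forall t : R, expR (- (t ^+ 2 * v)) <= cfs l t) -> Phi l 0 <= M.
Proof.
move=> v0; have K := K0_gt0 R.
have fin := integral_min_invsq_lty (A := 1) ler01 v0.
pose I := (\int[@lebesgue_measure R]_t (Num.min 1 (v * t ^+ 2) * invsq t)%:E)%E.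
exists ((fine I + 1) / K0 R).
  by rewrite divr_gt0// ltr_pwDr// fine_ge0// integral_ge0// => t _;
    rewrite lee_fin mulr_ge0 ?invsq_ge0// le_min ler01 mulr_ge0// sqr_ge0.
move=> l gl h; rewrite ler_pdivlMr// mulrC -lee_fin EFinD -Phi0_rep//.
have I0 : (0 <= I)%E.
  by apply: integral_ge0 => t _; rewrite lee_fin mulr_ge0 ?invsq_ge0// le_min ler01 mulr_ge0// sqr_ge0.
rewrite fineK ?ge0_fin_numE//; apply: (@le_trans _ _ I); last by rewrite leeDl.
apply: ge0_le_integral => //.
- by move=> t _; rewrite lee_fin mulr_ge0 ?invsq_ge0// subr_ge0 cfs_le1.
- by apply/measurable_EFinP; exact: measurable_cfs_invsq.
- apply/measurable_EFinP; apply: measurable_funM; last exact: measurable_invsq.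
  by apply: measurable_minr => //; apply: measurable_funM => //; exact: measurable_funX.
move=> t _; rewrite lee_fin ler_wpM2r ?invsq_ge0// le_min; apply/andP; split.
  by rewrite lerBlDr lerDl (le_trans _ (h t))// expR_ge0.
have := h t; have := expR_ge1Dx (- (t ^+ 2 * v)); rewrite mulrC; lra.
Qed.

Lemma sum_sqr_diff (R : realType) n (x : 'I_n -> R) :
  \sum_i \sum_j (x i - x j) ^+ 2 = 2 * n%:R * (\sum_i x i ^+ 2) - 2 * (\sum_i x i) ^+ 2.
Proof.
transitivity (\sum_i (n%:R * x i ^+ 2 + \sum_j x j ^+ 2 - 2 * x i * \sum_j x j)).
  apply: eq_bigr => i _; under eq_bigr do rewrite sqrrB.
  rewrite big_split /= sumrB sumr_const card_ord -[_ *+ n]mulr_natl addrAC; congr (_ + _ - _).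
  by rewrite mulr_sumr; apply: eq_bigr => j _; rewrite -mulr_natl mulrA.
by rewrite sumrB big_split /= sumr_const card_ord -[_ *+ n]mulr_natl -mulr_sumr -mulr_suml -mulr_sumr; ring.
Qed.

Lemma sum_inv_card (R : realType) n : (0 < n)%N -> \sum_(i < n) n%:R^-1 = 1 :> R.
Proof.
by move=> n0; rewrite sumr_const card_ord -[n%:R^-1 *+ n]mulr_natl divff// pnatr_eq0 -lt0n.
Qed.

Lemma cfs_iid (R : realType) (p : R) n (a : 'rV[R]_n) (t : R) :
  cfs (iid p a) t = \prod_(i < n) cfsq p (t ^+ 2 * a 0 i ^+ 2).
Proof.
rewrite /cfs /iid big_map big_enum /=; apply: eq_bigr => i _.
rewrite /cfsq -exprMn sqrtr_sqr; case: (ger0P (t * a 0 i)) => // _; by rewrite cfN.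
Qed.

Lemma bilinear_avg_le (R : realFieldType) (b g u v z : R) : 0 <= b -> b <= 1 -> u <= 1 -> z <= 1 ->
  v <= 1 - g ->
  b * b * u + b * (1 - b) * v + ((1 - b) * b * v + (1 - b) * (1 - b) * z) <=
  1 + - (2 * g * (b * (1 - b))).
Proof.
move=> b0 b1 u1 z1 vg; have b1' : 0 <= 1 - b by rewrite subr_ge0.
have := ler_wpM2l (mulr_ge0 b0 b0) u1.
have := ler_wpM2l (mulr_ge0 b1' b1') z1.
have := ler_wpM2l (mulr_ge0 b0 b1') vg; lra.
Qed.

Section gt2.
Context {R : realType}.
Variable p : R.
Hypothesis p2 : 2 < p.

Let p1 : 1 <= p. Proof. exact: le_trans (le12 R) (ltW p2). Qed.
Let w := mixm1 p.
Let w0 : 0 <= w.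
Proof. by rewrite divr_ge0//; apply: Ew_ge0 => // u; exact: sqr_ge0. Qed.

Let prod_cfsq_ge n (b : 'I_n -> R) (s : R) : 0 <= s -> (forall i, 0 <= b i) -> \sum_i b i = 1 ->
  expR (- (s * w)) <= \prod_(i < n) cfsq p (s * b i).
Proof.
move=> s0 b0 b1; have -> : - (s * w) = \sum_(i < n) - (s * b i * w).
  by rewrite sumrN -mulr_suml -mulr_sumr b1 mulr1.
rewrite expR_sum; apply: ler_prod => i _; rewrite expR_ge0/=.
by apply: cfsq_ge => //; rewrite mulr_ge0.
Qed.

(** By [cfsq_ge] the product of characteristic functions is at least exp(-t^2 w), however the unit
    mass is spread over the coordinates. The uniform bound converts additive gains into gains of
    ratios with constants free of n. *)
Lemma Phi_iid_bounded : exists2 M, 0 < M &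
  forall n (a : 'rV[R]_n), \sum_i a 0 i ^+ 2 = 1 -> Phi (iid p a) 0 <= M.
Proof.
have [M M0 h] := Phi_le_gauss w0; exists M => // n a a1; apply: h; first exact: laws_iid.
move=> t; rewrite cfs_iid; apply: prod_cfsq_ge => //; [exact: sqr_ge0|move=> i; exact: sqr_ge0].
Qed.

Let kur := Ew_kurtosis (lt_trans (ltr_nat R 1 2) p2) p2.

(** [cfsq_jensen] with weights 1/n at the points s b_i, b_i = a_i^2, whose mean is s / n. The
    average of (b_i - b_j)^2 over pairs is 2S / n, and the n-th power turns a factor 1 - 2gS / n
    into a gain 2gS independent of n. The comparison without gain holds for all t; the gain, with g
    = k t^4, holds where t^2 stays within the range of [cfsq_strict]. *)
Lemma Phi_flat_gain : exists2 c, 0 < c & forall n (a d : 'rV[R]_n), (0 < n)%N ->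
  \sum_i a 0 i ^+ 2 = 1 -> (forall i, d 0 i ^+ 2 = n%:R^-1) ->
  Phi (iid p a) 0 + c * \sum_i (a 0 i ^+ 2 - n%:R^-1) ^+ 2 <= Phi (iid p d) 0.
Proof.
have [k [ep [k0 ep0 hE]]] := cfsq_strict p2 kur.
pose t0 := Num.sqrt ep; have t00 : 0 < t0 by rewrite sqrtr_gt0.
have t0E : t0 ^+ 2 = ep by rewrite sqr_sqrtr// ltW.
pose c0 := expR (- (ep * w)) * (2 * k * (ep / 4) ^+ 2).
have c00 : 0 < c0 by rewrite mulr_gt0 ?expR_gt0// mulr_gt0 ?exprn_gt0 ?divr_gt0// mulr_gt0.
have K := K0_gt0 R.
exists (c0 / (2 * t0 * K0 R)); first by rewrite divr_gt0// mulr_gt0// mulr_gt0.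
move=> n a d n0 a1 d1; set S := \sum_i _.
have S0 : 0 <= S by rewrite sumr_ge0// => i _; exact: sqr_ge0.
have nR : 0 < n%:R :> R by rewrite ltr0n.
pose b i := a 0 i ^+ 2.
have b0 i : 0 <= b i by exact: sqr_ge0.
have b_1 i : b i <= 1 by rewrite -a1 (bigD1 i)//= lerDl sumr_ge0// => j _; exact: sqr_ge0.
have dE t : cfs (iid p d) t = cfsq p (t ^+ 2 / n%:R) ^+ n.
  by rewrite cfs_iid; under eq_bigr do rewrite d1; rewrite prodr_const card_ord.
have jen s g : 0 <= s -> 0 <= g -> (forall i j, cfsq_cross p (s * b i) (s * b j) <= 1 - g * (b i - b j) ^+ 2) ->
    cfsq p (s / n%:R) ^+ n * (1 + 2 * g * S) <= \prod_(i < n) cfsq p (s * b i).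
  move=> s0 g0 hg.
  pose L := \sum_(i < n) n%:R^-1 * ln (cfsq p (s * b i)).
  have sb i : 0 <= s * b i by rewrite mulr_ge0.
  have F1 : cfsq p (s / n%:R) <= expR L * (1 - 2 * g * S / n%:R).
    have th1 : \sum_(i < n) n%:R^-1 = 1 :> R by exact: sum_inv_card.
    have := @cfsq_jensen R p p2 n (fun=> n%:R^-1) (fun i => s * b i) (fun _ => ltac:(by rewrite invr_ge0 ltW)) th1 sb.
    rewrite -/L -mulr_sumr -mulr_sumr a1 mulr1 mulrC => /le_trans; apply.
    rewrite ler_pM2l ?expR_gt0//.
    apply: (@le_trans _ _ (\sum_(i < n) \sum_(j < n) (n%:R^-1 * n%:R^-1 * (1 - g * (b i - b j) ^+ 2)))).
      apply: ler_sum => i _; apply: ler_sum => j _; rewrite ler_wpM2l//.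
    have -> : \sum_(i < n) \sum_(j < n) (n%:R^-1 * n%:R^-1 * (1 - g * (b i - b j) ^+ 2)) =
        1 - n%:R^-1 * n%:R^-1 * g * \sum_i \sum_j (b i - b j) ^+ 2.
      rewrite mulr_sumr -[X in _ = X - _](sum_inv_card R n0) -sumrB; apply: eq_bigr => i _.
      rewrite mulr_sumr -[X in _ = X - _]mulr1 -[X in _ = _ * X - _](sum_inv_card R n0) mulr_sumr -sumrB.
      by apply: eq_bigr => j _; ring.
    rewrite sum_sqr_diff a1.
    have -> : S = \sum_i b i ^+ 2 - n%:R^-1.
      transitivity (\sum_i (b i ^+ 2 - 2 * n%:R^-1 * b i + n%:R^-1 * n%:R^-1)).
        by apply: eq_bigr => i _; rewrite /b; ring.
      rewrite big_split /= sumrB -!mulr_sumr a1 sum_inv_card//; ring.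
    by rewrite le_eqVlt; apply/orP; left; apply/eqP; field; rewrite gt_eqF.
  have PE : \prod_(i < n) cfsq p (s * b i) = expR (L *+ n).
    rewrite -[L *+ n]mulr_natl /L mulr_sumr expR_sum; apply: eq_bigr => i _.
    by rewrite mulrA divff ?gt_eqF// mul1r lnK// posrE cfsq_gt0.
  have F0 : 0 < cfsq p (s / n%:R) by apply: cfsq_gt0 => //; rewrite divr_ge0// ltW.
  have {}F1 : cfsq p (s / n%:R) <= expR (L - 2 * g * S / n%:R).
    by apply: (le_trans F1); rewrite expRD ler_pM2l ?expR_gt0// expR_ge1Dx.
  apply: (@le_trans _ _ (cfsq p (s / n%:R) ^+ n * expR (2 * g * S))).
    by rewrite ler_wpM2l ?expR_ge1Dx// exprn_ge0// ltW.
  apply: (@le_trans _ _ (expR (L - 2 * g * S / n%:R) ^+ n * expR (2 * g * S))).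
    by rewrite ler_pM2r ?expR_gt0// lerXn2r ?nnegrE ?expR_ge0// ltW.
  rewrite PE -expRM_natl -expRD ler_expR -[L *+ n]mulr_natl le_eqVlt; apply/orP; left; apply/eqP.
  by field; rewrite gt_eqF.
rewrite mulrAC; apply: Phi_gain; rewrite ?laws_iid//.
- move=> t t1; rewrite dE cfs_iid.
  have := @jen (t ^+ 2) 0 (sqr_ge0 _) (lexx _); rewrite mulr0 mul0r addr0 mulr1; apply.
  move=> i j; rewrite mul0r subr0; apply: cfsq_cross_le1 => //; by rewrite mulr_ge0// sqr_ge0.
- by rewrite mulr_ge0// ltW.
move=> t /andP[tl tu]; have t1 : 0 < t by rewrite (lt_le_trans _ tl)// divr_gt0.
have te : t ^+ 2 <= ep by rewrite -t0E lerXn2r ?nnegrE// ltW.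
have tg : ep / 4 <= t ^+ 2.
  rewrite -t0E (_ : t0 ^+ 2 / 4 = (t0 / 2) ^+ 2); last by field.
  by rewrite lerXn2r ?nnegrE ?divr_ge0// ltW.
have te0 := sqr_ge0 t.
rewrite dE cfs_iid; apply: le_trans (@jen (t ^+ 2) (k * (t ^+ 2) ^+ 2) te0 _ _).
- have hF : expR (- (ep * w)) <= cfsq p (t ^+ 2 / n%:R) ^+ n.
    have := @prod_cfsq_ge n (fun=> n%:R^-1) _ te0; rewrite prodr_const card_ord => h.
    apply: le_trans (h _ _); last exact: sum_inv_card.
      by rewrite ler_expR lerN2 ler_wpM2r.
    by move=> _; rewrite invr_ge0 ltW.
  have h4 : (ep / 4) ^+ 2 <= (t ^+ 2) ^+ 2 by rewrite lerXn2r ?nnegrE// divr_ge0// ltW.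
  have hc : c0 <= cfsq p (t ^+ 2 / n%:R) ^+ n * (2 * k * (t ^+ 2) ^+ 2).
    have k20 : 0 < 2 * k by rewrite mulr_gt0.
    apply: ler_pM; [exact: expR_ge0| |exact: hF|by rewrite ler_pM2l].
    by apply: mulr_ge0; [exact: ltW|exact: sqr_ge0].
  rewrite mulrDr mulr1 lerD2l; apply: le_trans (ler_wpM2r S0 hc) _.
  by rewrite le_eqVlt; apply/orP; left; apply/eqP; ring.
- by rewrite mulr_ge0 ?sqr_ge0// ltW.
move=> i j; rewrite (_ : k * _ * _ = k * (t ^+ 2 * b i - t ^+ 2 * b j) ^+ 2); last by ring.
have tb i0 : 0 <= t ^+ 2 * b i0 <= ep.
  by rewrite mulr_ge0//= (le_trans _ te)// ler_piMr.
exact: hE.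
Qed.

(** The point s b_i is the mean of s and 0 with weights b_i and 1 - b_i, so the two-point case of
    [cfsq_jensen] bounds its factor by f(s)^(b_i) exp(-2g b_i (1 - b_i)). As the b_i sum to 1, the
    product is at most f(s) exp(-2gT). *)
Lemma Phi_axis_gain : exists2 c, 0 < c & forall n (a d : 'rV[R]_n),
  \sum_i a 0 i ^+ 2 = 1 -> (forall t, cfs (iid p d) t = cfsq p (t ^+ 2)) ->
  Phi (iid p d) 0 + c * \sum_i (a 0 i ^+ 2 * (1 - a 0 i ^+ 2)) <= Phi (iid p a) 0.
Proof.
have [k [ep1 [k0 ep10 hE1]]] := cfsq_strict p2 kur.
(* The bounds 1 and 1 / (2k) give 2k ep^2 <= 1, hence 2gT <= 1 below, where exp(-2gT) <= 1 - gT is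
   derived. *)
pose ep := Num.min ep1 (Num.min 1 (2 * k)^-1).
have ep0 : 0 < ep by rewrite !lt_min ep10 ltr01 invr_gt0 mulr_gt0.
have epk : 2 * k * ep ^+ 2 <= 1.
  have e1 : ep <= 1 by rewrite !ge_min lexx orbT.
  have e2 : ep <= (2 * k)^-1 by rewrite !ge_min lexx !orbT.
  rewrite expr2 mulrA; apply: (@le_trans _ _ (2 * k * ep)); first by rewrite ler_piMr// !mulr_ge0// ltW.
  by rewrite mulrC -ler_pdivlMr ?mulr_gt0// div1r.
have hE x y : 0 <= x <= ep -> 0 <= y <= ep -> cfsq_cross p x y <= 1 - k * (x - y) ^+ 2.
  have e1 : ep <= ep1 by rewrite ge_min lexx.
  by move=> /andP[x0 xe] /andP[y0 ye]; apply: hE1; rewrite ?x0 ?y0 (le_trans _ e1).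
pose t0 := Num.sqrt ep; have t00 : 0 < t0 by rewrite sqrtr_gt0.
have t0E : t0 ^+ 2 = ep by rewrite sqr_sqrtr// ltW.
pose c0 := expR (- (ep * w)) * (k * (ep / 4) ^+ 2).
have c00 : 0 < c0 by rewrite mulr_gt0 ?expR_gt0// mulr_gt0 ?exprn_gt0 ?divr_gt0.
have K := K0_gt0 R.
exists (c0 / (2 * t0 * K0 R)); first by rewrite divr_gt0// mulr_gt0// mulr_gt0.
move=> n a d a1 dE.
pose b i := a 0 i ^+ 2.
have b0 i : 0 <= b i by exact: sqr_ge0.
have b_1 i : b i <= 1 by rewrite -a1 (bigD1 i)//= lerDl sumr_ge0// => j _; exact: sqr_ge0.
set T := \sum_i _; have T0 : 0 <= T by rewrite sumr_ge0// => i _; rewrite mulr_ge0 ?sqr_ge0// subr_ge0; exact: b_1.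
have T1 : T <= 1.
  by rewrite -a1 /T; apply: ler_sum => i _; rewrite ler_piMr ?sqr_ge0// lerBlDr lerDl sqr_ge0.
have cf00 : cfsq p 0 = 1 by rewrite /cfsq sqrtr0 cf0.
have two s g i : 0 <= s -> 0 <= g -> cfsq_cross p s 0 <= 1 - g ->
    cfsq p (s * b i) <= expR (b i * ln (cfsq p s) - 2 * g * (b i * (1 - b i))).
  move=> s0 g0 hg.
  pose th (j : 'I_2) := if j == 0 then b i else 1 - b i.
  pose sv (j : 'I_2) := if j == 0 then s else 0 : R.
  have th0 j : 0 <= th j by rewrite /th; case: ifP; rewrite ?subr_ge0 ?b_1.
  have sv0 j : 0 <= sv j by rewrite /sv; case: ifP.
  have sum2 (f : 'I_2 -> R) : \sum_i f i = f 0 + f 1.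
    by rewrite big_ord_recl big_ord1; congr (_ + f _); exact: val_inj.
  have th1 : \sum_i th i = 1 by rewrite sum2 /th /= addrC subrK.
  have hs : cfsq_cross p 0 s = cfsq_cross p s 0 by rewrite /cfsq_cross addrC (addrC (ln _)).
  have ss : cfsq_cross p s s <= 1 by exact: cfsq_cross_le1.
  have z0 : cfsq_cross p 0 0 <= 1 by exact: cfsq_cross_le1.
  have := @cfsq_jensen R p p2 2 th sv th0 th1 sv0.
  have -> : \sum_i th i * sv i = s * b i by rewrite sum2 /th /sv /= mulr0 addr0 mulrC.
  have -> : \sum_i th i * ln (cfsq p (sv i)) = b i * ln (cfsq p s).
    by rewrite sum2 /th /sv /= cf00 ln1 mulr0 addr0.
  have -> : \sum_i \sum_j th i * th j * cfsq_cross p (sv i) (sv j) =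
      b i * b i * cfsq_cross p s s + b i * (1 - b i) * cfsq_cross p s 0 +
      ((1 - b i) * b i * cfsq_cross p s 0 + (1 - b i) * (1 - b i) * cfsq_cross p 0 0).
    by rewrite sum2 !sum2 /th /sv /= hs.
  move=> h; apply: (le_trans h).
  rewrite expRD ler_pM2l ?expR_gt0//; apply: le_trans (expR_ge1Dx _).
  by apply: bilinear_avg_le; rewrite ?b0 ?b_1.
have prodle s g : 0 <= s -> 0 <= g -> cfsq_cross p s 0 <= 1 - g ->
    \prod_(i < n) cfsq p (s * b i) <= cfsq p s * expR (- (2 * g * T)).
  move=> s0 g0 hg.
  have -> : cfsq p s * expR (- (2 * g * T)) =
      \prod_(i < n) expR (b i * ln (cfsq p s) - 2 * g * (b i * (1 - b i))).
    rewrite -expR_sum sumrB -mulr_suml a1 mul1r -mulr_sumr expRD lnK// posrE.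
    exact: cfsq_gt0.
  apply: ler_prod => i _; rewrite two// ltW// cfsq_gt0//.
  by rewrite mulr_ge0.
rewrite mulrAC; apply: Phi_gain; rewrite ?laws_iid//.
- move=> t t1; rewrite dE cfs_iid.
  have := @prodle (t ^+ 2) 0 (sqr_ge0 _) (lexx _); rewrite mulr0 mul0r oppr0 expR0 mulr1; apply.
  by rewrite addr0; apply: cfsq_cross_le1 => //; exact: sqr_ge0.
- by rewrite mulr_ge0// ltW.
move=> t /andP[tl tu]; have t1 : 0 < t by rewrite (lt_le_trans _ tl)// divr_gt0.
have te : t ^+ 2 <= ep by rewrite -t0E lerXn2r ?nnegrE// ltW.
have tg : ep / 4 <= t ^+ 2.
  rewrite -t0E (_ : t0 ^+ 2 / 4 = (t0 / 2) ^+ 2); last by field.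
  by rewrite lerXn2r ?nnegrE ?divr_ge0// ltW.
have te0 := sqr_ge0 t.
have [g gE] : exists g, g = k * (ep / 4) ^+ 2 by exists (k * (ep / 4) ^+ 2).
have g0 : 0 <= g by rewrite gE mulr_ge0 ?sqr_ge0// ltW.
have gs : g <= k * (t ^+ 2) ^+ 2.
  by rewrite gE ler_pM2l// lerXn2r ?nnegrE// divr_ge0// ltW.
have hg : cfsq_cross p (t ^+ 2) 0 <= 1 - g.
  apply: (@le_trans _ _ (1 - k * (t ^+ 2 - 0) ^+ 2)); last by rewrite subr0 lerD2l lerN2.
  by apply: hE; rewrite ?te0 ?lexx ?(ltW ep0).
have := prodle _ _ te0 g0 hg; rewrite dE cfs_iid => h; apply: le_trans (lerD h (lexx _)) _.
have hF : expR (- (ep * w)) <= cfsq p (t ^+ 2).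
  by apply: le_trans (cfsq_ge p2 te0); rewrite ler_expR lerN2 ler_wpM2r.
have y0 : 0 <= 2 * g * T by rewrite mulr_ge0// mulr_ge0.
have y1 : 2 * g * T <= 1.
  have : 2 * g <= 1.
    apply: le_trans epk; rewrite gE mulrA ler_pM2l ?mulr_gt0//.
    rewrite lerXn2r ?nnegrE ?divr_ge0 ?(ltW ep0)// ler_pdivrMr//; move: (ltW ep0); lra.
  by move=> g1; rewrite mulr_ile1// mulr_ge0.
have ey : expR (- (2 * g * T)) <= 1 - g * T.
  rewrite expRN -[leLHS]mul1r ler_pdivrMr ?expR_gt0//.
  have := expR_ge1Dx (2 * g * T); move: (expR _) => X hX.
  have gT : 0 <= g * T by rewrite mulr_ge0.
  apply: (@le_trans _ _ ((1 - g * T) * (1 + 2 * g * T))).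
    by move: y1; rewrite -mulrA; move: (g * T) gT => z z0 z1; nra.
  by rewrite ler_wpM2l//; move: y1; rewrite -mulrA; lra.
apply: (@le_trans _ _ (cfsq p (t ^+ 2) * (1 - g * T) + cfsq p (t ^+ 2) * (g * T))); last first.
  by rewrite -mulrDr subrK mulr1.
apply: lerD; first by rewrite ler_pM2l// cfsq_gt0.
by rewrite /c0 -gE -mulrA ler_wpM2r// mulr_ge0.
Qed.

End gt2.
(** * The case p < 2 *)

(** The null point x = 0 has to be excluded for p = 1: there [phi] is the sign function, of absolute
    value 1 everywhere else. *)
Lemma Ew_le_phi (R : realType) (r : R) (k l : R -> R) : 1 <= r -> admissible k -> admissible l ->
  (forall x, x != 0 -> k (phi r x) <= l (phi r x)) -> Ew r k <= Ew r l.
Proof.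
move=> r1 ak al kl; rewrite !Ew.unlock ler_pM2r ?invr_gt0 ?Zw_gt0//.
have ik := integrable_admissible r1 ak; have il := integrable_admissible r1 al.
have mD : measurable ([set: R] `\ 0 : set R) by apply: measurableD.
have e g : (@lebesgue_measure R).-integrable setT (EFin \o g) ->
    \int[@lebesgue_measure R]_x g x = \int[@lebesgue_measure R]_(x in [set: R] `\ 0) g x.
  move=> /integrableP[mg _]; rewrite /Rintegral integral_setD1//.
  exact: measurable_funS mg.
rewrite (e _ ik) (e _ il); apply: le_Rintegral => //.
- exact: integrableS ik.
- exact: integrableS il.
by move=> x /= [_ /eqP x0]; rewrite ler_pM2r ?wexp_gt0// kl.
Qed.

Lemma normrD_normrB (R : realType) (x y : R) : `|x + y| + `|x - y| = 2 * Num.max `|x| `|y|.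
Proof.
rewrite /Num.max; case: ifPn.
  by case: (ger0P x); case: (ger0P y); case: (ger0P (x + y)); case: (ger0P (x - y)); lra.
rewrite -leNgt.
by case: (ger0P x); case: (ger0P y); case: (ger0P (x + y)); case: (ger0P (x - y)); lra.
Qed.

Lemma lip_max_norm (R : realType) (x a : R) : lip (fun u => Num.max `|x| (a * `|u|)).
Proof.
exists `|a| => u v; have h : `|a * `|u| - a * `|v| | <= `|a| * `|u - v|.
  by rewrite -mulrBr normrM ler_wpM2l// ler_dist_dist.
apply: le_trans h; move: (a * `|u|) (a * `|v|) `|x| => y z w.
rewrite /Num.max; case: ifPn => h1; case: ifPn => h2; rewrite ?subrr ?normr0 ?normr_ge0//.
- rewrite -leNgt in h2; rewrite !ger0_norm ?subr_ge0 ?(ltW h1)//; [lra|exact: le_trans h2 (ltW h1)].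
- rewrite -leNgt in h1; rewrite distrC (distrC y) !ger0_norm ?subr_ge0 ?(ltW h2)//; [lra|exact: le_trans h1 (ltW h2)].
Qed.

(** A symmetric variable may be averaged with its opposite, and |x + y| + |x - y| = 2 max(|x|, |y|).
    In the form on the right, convexity in the scale [a] can be read off pointwise. *)
Lemma Ew_norm_affine (R : realType) (r x a : R) : 1 <= r -> 0 <= a ->
  Ew r (fun u => `|x + a * u|) = Ew r (fun u => Num.max `|x| (a * `|u|)).
Proof.
move=> r1 a0.
have ak c : admissible (fun u : R => `|x + c * u|).
  exact/lip_admissible/(lip_comp_affine _ _ (@lip_norm R)).
have am := lip_admissible (lip_max_norm x a).
have h : Ew r (fun u => `|x + a * u|) = Ew r (fun u => `|x + - a * u|).
  by rewrite -(EwN r1 (ak a)); congr (Ew r _); apply/funext => u; rewrite mulrN mulNr.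
have : Ew r (fun u => `|x + a * u|) + Ew r (fun u => `|x + - a * u|) =
    2 * Ew r (fun u => Num.max `|x| (a * `|u|)).
  rewrite -(EwD r1 (ak a) (ak (- a))) -(EwZ _ r1 am); congr (Ew r _); apply/funext => u.
  by rewrite mulNr normrD_normrB normrM (ger0_norm a0).
by rewrite -h => e; lra.
Qed.

Lemma Ew_norm_scale (R : realType) (r x a : R) : 1 <= r -> 0 < a ->
  Ew r (fun u => `|x + a * u|) = a * Ew r (fun u => `|x / a + 1 * u|).
Proof.
move=> r1 a0; rewrite -EwZ//; last exact/lip_admissible/(lip_comp_affine _ _ (@lip_norm R)).
congr (Ew r _); apply/funext => u; rewrite -{2}(gtr0_norm a0) -normrM mulrDr mul1r.
by rewrite (mulrC a (x / a)) divfK// gt_eqF.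
Qed.

Section lt2.
Context {R : realType}.
Variable p : R.
Hypotheses (p1 : 1 <= p) (p2 : p < 2).

Let r2 := le12 R.
Let an : admissible (@Num.norm R R) := lip_admissible (@lip_norm R).

Definition gauss_mean : R := Ew 2 (fun u => `|u|).
Definition match_scale : R := gauss_mean / Ew p (fun u => `|u|).

Let m2 := gauss_mean.
Let s0 := match_scale.
Let mY : R := Ew p (fun u => `|u|).

Let m20 : 0 < m2. Proof. exact: Ew_norm_gt0. Qed.
Let mY0 : 0 < mY. Proof. exact: Ew_norm_gt0. Qed.
Let s00 : 0 < s0. Proof. exact: divr_gt0. Qed.
Let s0E : s0 * mY = m2. Proof. by rewrite /s0 /match_scale divfK// gt_eqF. Qed.

(** For p > 1 the Gaussian is a mixture of dilates sY, and the equality of first moments says that s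
    has mean s0. The inequality is then Jensen's for the convex function s -> E max(|x|, s|Y|): the
    test function [k] subtracts the tangent at s0, whose slope [D] is the mean of |Y| over the event
    s0 |Y| > |x|. For p = 1 the variable |Y| is almost surely constant, and max(|x|, E|G|) <= E
    max(|x|, |G|) suffices. *)
Let mean_shift1 (x : R) : Ew p (fun u => Num.max `|x| (s0 * `|u|)) <= Ew 2 (fun u => Num.max `|x| (1 * `|u|)).
Proof.
have am a := lip_admissible (lip_max_norm x a).
move: p1; rewrite le_eqVlt => /predU1P[p1'|p1'].
  have phi1 y : y != 0 -> `|phi p y| = 1.
    move=> y0; rewrite /phi -p1' subrr powRr0 mulr1.
    by rewrite normr_sg y0.
  have mYE : mY = 1.
    apply/eqP; rewrite eq_le -{1}(Ew_cst 1 p1) -{2}(Ew_cst 1 p1).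
    have a1 := admissible_cst (1 : R).
    by apply/andP; split; apply: Ew_le_phi => // y y0; rewrite /= phi1.
  have h2 : Num.max `|x| m2 <= Ew 2 (fun u => Num.max `|x| (1 * `|u|)).
    rewrite ge_max -{1}(Ew_cst `|x| r2); apply/andP; split; apply: Ew_le => //.
    - exact: admissible_cst.
    - by move=> u; rewrite le_max lexx.
    - by move=> u; rewrite mul1r le_max lexx orbT.
  apply: le_trans h2.
  rewrite -(Ew_cst (Num.max `|x| m2) p1); apply: Ew_le_phi => //; first exact: admissible_cst.
  by move=> y y0 /=; rewrite phi1// mulr1 -s0E mYE mulr1.
pose ind (u : R) : R := if `|x| < s0 * `|u| then 1 else 0.
have mind : measurable_fun setT ind.
  by apply: measurable_fun_ifT => //; apply: measurable_fun_ltr => //; apply: measurable_funM.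
have ai : admissible (fun u => `|u| * ind u).
  have [mn [C hC]] := an; split; first exact: measurable_funM.
  exists C => u; apply: le_trans (hC u); rewrite /ind normr_id normrM normr_id.
  by case: ifP => _; rewrite ?normr1 ?mulr1// normr0 mulr0.
pose D := Ew p (fun u => `|u| * ind u).
pose P := Ew p (fun u => Num.max `|x| (s0 * `|u|)).
pose k (u : R) := Num.max `|x| (1 * `|u|) + ((- (D / mY)) * `|u| + (D * s0 - P)).
have ak0 := admissibleD (admissibleZ (- (D / mY)) an) (admissible_cst (D * s0 - P)).
have ak : admissible k := admissibleD (am 1) ak0.
have : 0 <= Ew 2 k.
  apply: (@Ew_mixture R p 2) => //.
  - move=> u; apply: cvgD; first exact: (lip_continuous (lip_max_norm x 1)).
    by apply: cvgD; [apply: cvgMr; exact: norm_continuous|exact: cvg_cst].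
  - by move=> u; rewrite /k normrN.
  move=> s sp.
  have e : Ew p (fun u => k (s * u)) = Ew p (fun u => Num.max `|x| (s * `|u|)) + (- (D / mY) * s * mY + (D * s0 - P)).
    have a1 := admissibleZ (- (D / mY) * s) an.
    have a2 := admissible_cst (D * s0 - P).
    rewrite -(EwZ _ p1 an) -(Ew_cst (D * s0 - P) p1) -(EwD p1 a1 a2) -(EwD p1 (am s) (admissibleD a1 a2)).
    by congr (Ew p _); apply/funext => u; rewrite /k /= normrM (gtr0_norm sp) mul1r !mulrA.
  rewrite e (_ : - (D / mY) * s * mY = - (D * s)); last by field; rewrite gt_eqF.
  suff : P + (s - s0) * D <= Ew p (fun u => Num.max `|x| (s * `|u|)) by move: (Ew p (fun u => Num.max `|x| (s * `|u|))) (P) (D) => u v w; lra.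
  rewrite /P /D -(EwZ _ p1 ai) -(EwD p1 (am s0) (admissibleZ _ ai)).
  apply: Ew_le => //; first exact: admissibleD (am s0) (admissibleZ _ ai).
  move=> u; rewrite /ind /Num.max; case: ifPn => h1.
    by rewrite mulr1 -mulrDl addrC subrK; case: ifPn => // h; rewrite -leNgt in h.
  by rewrite !mulr0 addr0; case: ifPn => // /ltW.
rewrite /k (EwD r2 (am 1) ak0) (EwD r2 (admissibleZ _ an) (admissible_cst _)) (EwZ _ r2 an) (Ew_cst _ r2).
have m2E : Ew 2 (@Num.norm R R) = s0 * mY by rewrite s0E.
rewrite m2E (_ : - (D / mY) * (s0 * mY) = - (D * s0)); last by field; rewrite gt_eqF.
by move: (Ew 2 (fun u => Num.max `|x| (1 * `|u|))) => w; rewrite -/P; move: (P) (D * s0) => u v; lra.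
Qed.

Lemma mean_shift_le (x a : R) : 0 <= a ->
  Ew p (fun u => `|x + s0 * a * u|) <= Ew 2 (fun u => `|x + a * u|).
Proof.
rewrite le_eqVlt => /predU1P[<-|a0].
  have z (r c : R) : 1 <= r -> c = 0 -> Ew r (fun u => `|x + c * u|) = `|x|.
    by move=> r1 ->; rewrite -[RHS](Ew_cst _ r1); congr (Ew r _); apply/funext => u; rewrite mul0r addr0.
  by rewrite !z// mulr0.
have sa : 0 < s0 * a by exact: mulr_gt0.
rewrite (Ew_norm_scale _ r2 a0) (Ew_norm_affine _ r2 ler01) (Ew_norm_affine _ p1 (ltW sa)).
have am c := lip_admissible (lip_max_norm (x / a) c).
have -> : (fun u : R => Num.max `|x| (s0 * a * `|u|)) = (fun u : R => a * Num.max `|x / a| (s0 * `|u|)).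
  apply/funext => u; rewrite maxr_pMr ?(ltW a0)// normrM normfV (gtr0_norm a0).
  by congr Num.max; [field; rewrite gt_eqF|ring].
by rewrite (EwZ _ p1 (am s0)) ler_pM2l.
Qed.

Lemma Ew2_ge_itv (k : R -> R) (A B d U : R) : admissible k -> (forall u, 0 <= k u) -> 0 <= d -> A < B ->
  (forall x, A <= x <= B -> `|x| <= U /\ d <= k x) ->
  d * expR (- U ^+ 2) / Zw 2 * (B - A) <= Ew 2 k.
Proof.
move=> ak k0 d0 AB h; have Z0 := Zw_gt0 r2; rewrite -[leLHS]add0r.
have [mk _] := ak.
apply: (@integral_gain R (cst 0) (fun x => k (phi 2 x) * wexp 2 x / Zw 2)) => //.
- apply: measurable_funM => //; apply: measurable_funM; last exact: measurable_wexp.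
  exact: (measurableT_comp mk (measurable_phi 2)).
- by rewrite integral0_eq.
- exact: (ge0_integral_Ew r2 ak).
- by move=> t; rewrite /= divr_ge0 ?(ltW Z0)// mulr_ge0// ltW// wexp_gt0.
- by rewrite divr_ge0 ?(ltW Z0)// mulr_ge0// expR_ge0.
move=> t tAB; have [tU dk] := h _ tAB; rewrite /= add0r phi2 wexp2 ler_pM2r ?invr_gt0//.
apply: ler_pM => //.
by rewrite ler_expR lerN2 -(real_normK (num_real t)) lerXn2r ?nnegrE// (le_trans _ tU).
Qed.

Lemma Ew_le_itv (k : R -> R) (d rho : R) : admissible k -> (forall u, 0 <= k u) -> 0 <= d -> 0 <= rho ->
  (forall x, k (phi p x) <= d) -> (forall x, rho < `|x| -> k (phi p x) = 0) ->
  Ew p k <= d / Zw p * (2 * rho).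
Proof.
move=> ak k0 d0 rho0 kd kr; have Z0 := Zw_gt0 p1; have [mk _] := ak.
have mg : measurable_fun setT (fun x => (k (phi p x) * wexp p x / Zw p)%:E).
  apply/measurable_EFinP; apply: measurable_funM => //; apply: measurable_funM; last exact: measurable_wexp.
  exact: (measurableT_comp mk (measurable_phi p)).
have dZ : 0 <= d / Zw p by rewrite divr_ge0// ltW.
rewrite -lee_fin -(ge0_integral_Ew p1 ak).
apply: (@le_trans _ _ (\int[@lebesgue_measure R]_t ((d / Zw p)%:E * (\1_(`[- rho, rho]%classic) t)%:E))%E).
  apply: ge0_le_integral => //.
  - by move=> x _; rewrite lee_fin divr_ge0 ?(ltW Z0)// mulr_ge0// ltW// wexp_gt0.
  - by apply/measurable_EFinP; apply: measurable_funM.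
  move=> x _; rewrite -EFinM lee_fin indicE.
  have [xr|xr] := leP `|x| rho.
    rewrite mem_set/= ?in_itv/= -?ler_norml// mulr1 ler_pM2r ?invr_gt0//.
    by apply: le_trans (kd x); rewrite ler_piMr// wexp_le1.
  by rewrite kr// !mul0r mulr_ge0.
rewrite integral_cst_indic//.
rewrite -[X in (_ * X)%E]/(@lebesgue_measure R `[- rho, rho]%classic).
rewrite lebesgue_measure_itv/= lte_fin; case: ifPn => _.
  by rewrite -EFinD -EFinM lee_fin opprK (_ : 2 * rho = rho + rho)//; ring.
by rewrite mule0 lee_fin mulr_ge0// mulr_ge0.
Qed.

(** Let w = |v|. The two expectations exceed the common value E|G| by the means of the positive
    parts of w - s0 |Y| and w - |G|. The Gaussian one is at least of order w^2, the density being
    positive at 0. The other is at most w times the probability of s0 |x|^(p-1) < w, which is o(w)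
    because p - 1 < 1: for w <= v1 the event forces |x| <= eta w, and [eta] is chosen so that at
    most half of the Gaussian gain is lost. *)
Lemma mean_shift_gap : exists c v0, [/\ 0 < c, 0 < v0, v0 <= 1 & forall v, `|v| <= v0 ->
  Ew p (fun u => Num.max `|v| (s0 * `|u|)) + c * v ^+ 2 <= Ew 2 (fun u => Num.max `|v| (1 * `|u|))].
Proof.
have Zp := Zw_gt0 p1; have Z2 := Zw_gt0 r2.
pose c1 : R := 4^-1 * expR (- 1 ^+ 2) / Zw 2.
have c10 : 0 < c1 by rewrite divr_gt0// mulr_gt0// expR_gt0.
pose eta := c1 * Zw p / 4.
have eta0 : 0 < eta by rewrite divr_gt0// mulr_gt0.
have p20 : 0 < 2 - p by rewrite subr_gt0.
(* The solution of v1^(2 - p) = s0 eta^(p - 1), so that w <= v1 gives w <= s0 (eta w)^(p - 1). *)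
pose v1 := (s0 * eta `^ (p - 1)) `^ ((2 - p)^-1).
have se0 : 0 < s0 * eta `^ (p - 1) by rewrite mulr_gt0// powR_gt0.
have v10 : 0 < v1 by rewrite powR_gt0.
exists (c1 / 2), (Num.min v1 1); split; rewrite ?divr_gt0 ?lt_min ?v10 ?ltr01 ?ge_min ?lexx ?orbT//.
move=> v; rewrite le_min => /andP[vv1 v1'].
have [->|vn] := eqVneq v 0.
  rewrite expr0n mulr0 addr0; have := mean_shift1 0; by [].
have w0 : 0 < `|v| by rewrite normr_gt0.
rewrite -(real_normK (num_real v)); move: `|v| w0 vv1 v1' => w w0 wv1 w1 {v vn}.
have am a : admissible (fun u => Num.max w (a * `|u|)).
  by have := lip_admissible (lip_max_norm w a); rewrite (gtr0_norm w0).
have e r a : 1 <= r -> Ew r (fun u => Num.max w (a * `|u|)) =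
    a * Ew r (fun u => `|u|) + Ew r (fun u => Num.max w (a * `|u|) + - a * `|u|).
  move=> r1; rewrite (EwD r1 (am a) (admissibleZ _ an)) (EwZ _ r1 an); ring.
have aq a := admissibleD (am a) (admissibleZ (- a) an).
have q0 a u : 0 <= Num.max w (a * `|u|) + - a * `|u|.
  by rewrite mulNr subr_ge0 le_max lexx orbT.
rewrite (e _ _ p1) (e _ _ r2) s0E mul1r -addrA lerD2l.
have up : Ew p (fun u => Num.max w (s0 * `|u|) + - s0 * `|u|) <= w / Zw p * (2 * (eta * w)).
  apply: Ew_le_itv => //; [exact: ltW|by rewrite mulr_ge0// ltW| |].
    move=> x; rewrite mulNr lerBlDr ge_max lerDl lerDr (ltW w0) andbT.
    by rewrite mulr_ge0// ltW.
  move=> x xw; rewrite mulNr; apply/eqP; rewrite subr_eq0; apply/eqP/max_idPr.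
  have x0 : 0 < `|x| by apply: lt_trans xw; rewrite mulr_gt0.
  have -> : `|phi p x| = `|x| `^ (p - 1).
    by rewrite /phi normrM normr_sg -normr_gt0 x0 mul1r ger0_norm// powR_ge0.
  have pw : 0 <= p - 1 by rewrite subr_ge0.
  apply: (@le_trans _ _ (s0 * (eta * w) `^ (p - 1))); last first.
    rewrite ler_pM2l//; apply: ge0_ler_powR => //; [|exact: ltW].
    by rewrite nnegrE; apply: mulr_ge0; exact: ltW.
  rewrite (powRM _ (ltW eta0) (ltW w0)) mulrA.
  have ww : w `^ (2 - p) <= s0 * eta `^ (p - 1).
    have -> : s0 * eta `^ (p - 1) = v1 `^ (2 - p).
      by rewrite /v1 -powRrM mulVf ?gt_eqF// powRr1// ltW.
    by apply: ge0_ler_powR => //; rewrite ?nnegrE ltW.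
  apply: le_trans (ler_wpM2r (powR_ge0 w (p - 1)) ww).
  by rewrite -powRD ?(gt_eqF w0) ?implybT// (_ : 2 - p + (p - 1) = 1) ?powRr1 ?(ltW w0)//; ring.
have lo : w / 2 * expR (- 1 ^+ 2) / Zw 2 * (w / 2 - 0) <= Ew 2 (fun u => Num.max w (1 * `|u|) + - 1 * `|u|).
  apply: Ew2_ge_itv => //; rewrite ?divr_gt0 ?divr_ge0 ?(ltW w0)//.
  move=> x /andP[x0 xw]; rewrite ger0_norm//; split; first lra.
  by rewrite mul1r mulN1r lerBrDr le_max; apply/orP; left; lra.
apply: le_trans lo; rewrite subr0.
have -> : w / 2 * expR (- 1 ^+ 2) / Zw 2 * (w / 2) = c1 * w ^+ 2 by rewrite /c1; field; rewrite gt_eqF.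
have -> : c1 * w ^+ 2 = w / Zw p * (2 * (eta * w)) + c1 / 2 * w ^+ 2 by rewrite /eta; field; rewrite gt_eqF.
by rewrite lerD2r.
Qed.

(** [A] is the sum of the squared coefficients still carried by Gaussians, merged into a single
    one. *)
Let NG (A z : R) : R := Ew 2 (fun u => `|z + Num.sqrt A * u|).
Let aff (c z : R) : admissible (fun u : R => `|z + c * u|).
Proof. exact/lip_admissible/(lip_comp_affine _ _ (@lip_norm R)). Qed.
Let lipNG A : lip (NG A).
Proof. exact: (lip_Ew _ r2 (@lip_norm R)). Qed.
Let aNG A c z : admissible (fun u : R => NG A (z + c * u)).
Proof. exact/lip_admissible/(lip_comp_affine _ _ (lipNG A)). Qed.

Let NG_stable (A a z : R) : 0 <= A -> 0 <= a -> NG (A + a ^+ 2) z = Ew 2 (fun u => NG A (z + a * u)).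
Proof.
move=> A0 a0; have K := K0_gt0 R.
pose l1 := [:: (Num.sqrt (A + a ^+ 2), 2) : R * R]; pose l2 := [:: (a, 2); (Num.sqrt A, 2)] : seq (R * R).
have g1 : laws l1 by rewrite /= r2. have g2 : laws l2 by rewrite /= r2.
have : (K0 R * Phi l1 z)%:E = (K0 R * Phi l2 z)%:E.
  rewrite -!Phi_rep//; apply: eq_integral => t _; congr ((1 - _ * _) * _)%:E.
  rewrite /cfs !big_cons !big_nil /= !mulr1 !cf2E -expRD; congr expR.
  by rewrite !exprMn !sqr_sqrtr ?addr_ge0 ?sqr_ge0//; field.
by move=> [] /mulfI; apply; rewrite gt_eqF.
Qed.

Let Dl (a x : R) : R := Ew 2 (fun u => `|x + a * u|) + -1 * Ew p (fun u => `|x + s0 * a * u|).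
Let aDl a c z : admissible (fun u : R => Dl a (z + c * u)).
Proof.
apply: admissibleD; first exact/lip_admissible/(lip_comp_affine _ _ (lip_Ew _ r2 (@lip_norm R))).
by apply: admissibleZ; exact/lip_admissible/(lip_comp_affine _ _ (lip_Ew _ p1 (@lip_norm R))).
Qed.
Let Dl0 a x : 0 <= a -> 0 <= Dl a x.
Proof. by move=> a0; rewrite /Dl mulN1r subr_ge0 mean_shift_le. Qed.

(** One replacement step: a Gaussian with coefficient a is split off and exchanged for s0 a Y. The
    price is the nonnegative gap [Dl a] of a single exchange, averaged over the Gaussian that
    remains. *)
Let NG_step (A a z : R) : 0 <= A -> 0 <= a ->
  NG (A + a ^+ 2) z = Ew p (fun u => NG A (z + s0 * a * u)) + Ew 2 (fun v => Dl a (z + Num.sqrt A * v)).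
Proof.
move=> A0 a0; rewrite NG_stable// /NG.
have ng := fun u : R => normr_ge0 u.
rewrite (Ew_swap a (Num.sqrt A) z r2 r2 (@lip_norm R) ng).
rewrite (Ew_swap (s0 * a) (Num.sqrt A) z p1 r2 (@lip_norm R) ng).
have a1 : admissible (fun v => Ew p (fun u => `|z + Num.sqrt A * v + s0 * a * u|)).
  exact/lip_admissible/(lip_comp_affine _ _ (lip_Ew _ p1 (@lip_norm R))).
rewrite -(EwD r2 a1 (aDl _ _ _)); congr (Ew 2 _); apply/funext => v; rewrite /Dl; ring.
Qed.

Let Dl_ge : exists c v0, [/\ 0 < c, 0 < v0, v0 <= 1 & forall a x, 0 < a -> a <= 1 -> `|x| <= v0 * a ->
  c * x ^+ 2 / a <= Dl a x].
Proof.
have [c [v0 [c0 v00 v01 h]]] := mean_shift_gap; exists c, v0; split => // a x a0 a1 xa.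
have sa : 0 < s0 * a by exact: mulr_gt0.
have xv : `|x / a| <= v0 by rewrite normrM normfV (gtr0_norm a0) ler_pdivrMr.
rewrite /Dl mulN1r (Ew_norm_scale _ r2 a0) (Ew_norm_affine _ r2 ler01) (Ew_norm_affine _ p1 (ltW sa)).
have am b := lip_admissible (lip_max_norm (x / a) b).
have -> : (fun u : R => Num.max `|x| (s0 * a * `|u|)) = (fun u : R => a * Num.max `|x / a| (s0 * `|u|)).
  apply/funext => u; rewrite maxr_pMr ?(ltW a0)// normrM normfV (gtr0_norm a0).
  by congr Num.max; [field; rewrite gt_eqF|ring].
rewrite (EwZ _ p1 (am s0)) -mulrBr.
have -> : c * x ^+ 2 / a = a * (c * (x / a) ^+ 2) by field; rewrite gt_eqF.
by rewrite ler_pM2l// lerBrDl; exact: h.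
Qed.

(** With A >= 1/4 and z bounded, z + sqrt A G falls into [a v0 / 2, a v0] with probability at least
    of order a, and there [Dl a] is at least of order a. The window for G lies within 2 (M + 1) of
    the origin, since sqrt A >= 1/2. *)
Let gain_far (M : R) : 0 <= M -> exists2 k, 0 < k & forall A a z, 4^-1 <= A -> A <= 1 -> 0 < a -> a <= 1 ->
  `|z| <= M -> k * a ^+ 2 <= Ew 2 (fun v => Dl a (z + Num.sqrt A * v)).
Proof.
move=> M0; have [c [v0 [c0 v00 v01 h]]] := Dl_ge.
have Z2 := Zw_gt0 r2.
exists (c * v0 ^+ 2 / 4 * expR (- (2 * (M + 1)) ^+ 2) / Zw 2 * (v0 / 2)).
  by rewrite mulr_gt0 ?divr_gt0// mulr_gt0 ?expR_gt0// divr_gt0// mulr_gt0// exprn_gt0.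
move=> A a z A4 A1 a0 a1 zM; have s2 : 2^-1 <= Num.sqrt A.
  have -> : 2^-1 = Num.sqrt (4^-1) :> R.
    by rewrite (_ : 4^-1 = 2^-1 ^+ 2) ?sqrtr_sqr ?ger0_norm//; field.
  by rewrite ler_wsqrtr.
have s1 : Num.sqrt A <= 1 by rewrite -sqrtr1 ler_wsqrtr.
move: (Num.sqrt A) s2 s1 => s s2 s1; have sp : 0 < s by lra.
apply: (@le_trans _ _ (c * v0 ^+ 2 * a / 4 * expR (- (2 * (M + 1)) ^+ 2) / Zw 2 *
    ((a * v0 - z) / s - (a * v0 / 2 - z) / s))).
  have -> : (a * v0 - z) / s - (a * v0 / 2 - z) / s = a * v0 / 2 / s by field; rewrite gt_eqF.
  have av : 0 <= a * v0 / 2 by rewrite divr_ge0// mulr_ge0// ltW.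
  have av2 : a * v0 / 2 <= a * v0 / 2 / s by rewrite ler_pdivlMr// ler_piMr.
  set X := c * v0 ^+ 2 * a / 4 * _ / Zw 2.
  have X0 : 0 <= X.
    by rewrite /X divr_ge0 ?(ltW Z2)// mulr_ge0 ?expR_ge0// divr_ge0// mulr_ge0 ?(ltW a0)// mulr_ge0 ?sqr_ge0// ltW.
  apply: le_trans (ler_wpM2l X0 av2); rewrite le_eqVlt; apply/orP; left; apply/eqP.
  by rewrite /X; field; rewrite gt_eqF.
apply: Ew2_ge_itv.
- exact: aDl.
- by move=> u; apply: Dl0; exact: ltW.
- by rewrite divr_ge0// mulr_ge0 ?(ltW a0)// mulr_ge0 ?sqr_ge0// ltW.
- rewrite ltr_pM2r ?invr_gt0// ltrD2r; have := mulr_gt0 a0 v00; lra.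
move=> u /andP[]; rewrite ler_pdivrMr// ler_pdivlMr// => u1 u2.
have av0 : a * v0 <= 1 by rewrite mulr_ile1// ltW.
have avp := mulr_gt0 a0 v00.
move: zM; rewrite ler_norml => /andP[z1 z2].
split.
  have : `|u| * s <= M + 1.
    by rewrite -{1}(gtr0_norm sp) -normrM ler_norml; apply/andP; split; lra.
  have := normr_ge0 u; move: `|u| => w w0 ws; nra.
have x1 : a * v0 / 2 <= z + s * u by rewrite (mulrC s); lra.
have x2 : z + s * u <= a * v0 by rewrite (mulrC s); lra.
apply: le_trans (h _ _ a0 a1 _); last by rewrite ger0_norm ?(mulrC v0)//; lra.
have -> : c * v0 ^+ 2 * a / 4 = c * (a * v0 / 2) ^+ 2 / a by field; rewrite gt_eqF.
by rewrite ler_pM2r ?invr_gt0// ler_pM2l// lerXn2r ?nnegrE//; lra.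
Qed.

(** One coordinate is large and the others carry only A. For G in the fixed window [v0 / 4, v0 / 2]
    the argument sqrt A G is at most v0 a, and [Dl a] is bounded below by a multiple of its square,
    of order A. *)
Let gain_near : exists2 k, 0 < k & forall A a, 0 <= A -> A <= 1 -> 2^-1 <= a -> a <= 1 ->
  k * A <= Ew 2 (fun v => Dl a (0 + Num.sqrt A * v)).
Proof.
have [c [v0 [c0 v00 v01 h]]] := Dl_ge.
have Z2 := Zw_gt0 r2.
exists (c * (v0 / 4) ^+ 2 * expR (- 1 ^+ 2) / Zw 2 * (v0 / 2 - v0 / 4)).
  rewrite mulr_gt0//; last lra.
  by rewrite divr_gt0// mulr_gt0 ?expR_gt0// mulr_gt0// exprn_gt0// divr_gt0.
move=> A a A0 A1 a2 a1; have a0 : 0 < a by lra.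
have -> : c * (v0 / 4) ^+ 2 * expR (- 1 ^+ 2) / Zw 2 * (v0 / 2 - v0 / 4) * A =
  c * (v0 / 4) ^+ 2 * A * expR (- 1 ^+ 2) / Zw 2 * (v0 / 2 - v0 / 4) by field; rewrite gt_eqF.
apply: Ew2_ge_itv.
- exact: aDl.
- by move=> u; apply: Dl0; exact: ltW.
- by rewrite mulr_ge0// mulr_ge0 ?sqr_ge0// ltW.
- by lra.
have s1 : Num.sqrt A <= 1 by rewrite -sqrtr1 ler_wsqrtr.
have s0' := sqrtr_ge0 A; have sE := sqr_sqrtr A0.
move=> u /andP[u1 u2]; have u0 : 0 <= u by lra.
split; first by rewrite ger0_norm//; lra.
have su : Num.sqrt A * u <= u by rewrite ler_piMl.
apply: le_trans (h _ _ a0 a1 _); last first.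
  rewrite add0r ger0_norm ?mulr_ge0//; apply: (le_trans su); apply: (le_trans u2); rewrite ler_pM2l//; lra.
have su2 : (0 + Num.sqrt A * u) ^+ 2 = A * u ^+ 2 by rewrite add0r exprMn sE.
rewrite su2; apply: (@le_trans _ _ (c * (A * u ^+ 2))); last first.
  by rewrite ler_pdivlMr// ler_piMr// mulr_ge0 ?(ltW c0)// mulr_ge0// sqr_ge0.
rewrite -mulrA ler_pM2l// mulrC ler_wpM2l// lerXn2r ?nnegrE//; lra.
Qed.

Let lst (l : seq R) : seq (R * R) := [seq (s0 * a, p) | a <- l].
Let glst l : laws (lst l). Proof. by apply/allP => _ /mapP[a _ ->]. Qed.
Let T (l : seq R) : R := \sum_(a <- l) a ^+ 2.
Let T0 l : 0 <= T l. Proof. by apply: sumr_ge0 => a _; exact: sqr_ge0. Qed.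
Let TS a l : T (a :: l) = T l + a ^+ 2. Proof. by rewrite /T big_cons addrC. Qed.

Lemma Phi_le_gauss_mean l c : all (fun a => 0 <= a) l -> Phi (lst l) c <= NG (T l) c.
Proof.
elim: l c => [c _|a l ih c /= /andP[a0 l0]].
  by rewrite /T big_nil /NG sqrtr0 -[leLHS](Ew_cst _ r2) le_eqVlt; apply/orP; left; apply/eqP;
    congr (Ew 2 _); apply/funext => u; rewrite mul0r addr0.
rewrite TS NG_step//.
rewrite -[leLHS]addr0 lerD//; last by apply: Ew_ge0 => // u; exact: Dl0.
apply: Ew_le => //; first exact/lip_admissible/(lip_comp_affine _ _ (lip_Phi (glst l))).
by move=> u; exact: ih.
Qed.

(** With no coordinate above 1/2 the gains a^2 of single steps have to be summed, and each is
    secured only while |c| <= M and the remaining mass is at least 1/4. [W] is the second moment of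
    the completed sum, so 1 - W / M^2 keeps its expectation along the replacement and lies below the
    indicator of |c| <= M; it carries the gain through the induction. [h] counts the mass in excess
    of 1/2: as a^2 <= 1/4, a step that increases it leaves a remaining mass of at least 1/4. *)
Lemma Phi_small_gain : exists2 k, 0 < k & forall l, all (fun a => (0 <= a) && (a ^+ 2 <= 4^-1)) l ->
  T l = 1 -> Phi (lst l) 0 + k <= NG 1 0.
Proof.
pose B := s0 ^+ 2 * Ew p (fun u => u ^+ 2).
have ax2 := @admissibleX R 2 isT.
have B0 : 0 <= B by rewrite mulr_ge0 ?sqr_ge0//; apply: Ew_ge0 => // u; exact: sqr_ge0.
(* This choice gives M^2 > B, so the potential is positive for the full sum, where t = 1 and c =
   0. *)
pose M : R := 2 * B + 1; have M1 : 1 <= M by rewrite /M; lra.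
have M0 : 0 <= M by lra.
have M2 : 0 < M ^+ 2 by rewrite exprn_gt0//; lra.
have [k k0 hk] := gain_far M0.
pose h (t : R) : R := Num.max t 2^-1 - 2^-1.
pose W (t c : R) : R := c ^+ 2 + B * t.
exists (k * h 1 * (1 - W 1 0 / M ^+ 2)).
  have h1 : h 1 = 2^-1 by rewrite /h max_l; lra.
  rewrite h1 /W expr0n add0r mulr1; apply: mulr_gt0; first by rewrite mulr_gt0.
  rewrite subr_gt0 ltr_pdivrMr// mul1r expr2; apply: (@lt_le_trans _ _ M); first by rewrite /M; lra.
  by rewrite ler_peMl.
have aW t c d : admissible (fun u : R => W t (c + d * u)).
  have := admissibleD (admissible_cst (W t c)) (admissibleD (admissibleZ (2 * c * d) (@admissibleX R 1 isT)) (admissibleZ (d ^+ 2) ax2)).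
  by congr admissible; apply/funext => u; rewrite /W /= expr1; ring.
have EW t c a : Ew p (fun u => W t (c + s0 * a * u)) = W (t + a ^+ 2) c.
  have a1 := @admissibleX R 1 isT.
  have -> : (fun u => W t (c + s0 * a * u)) = (fun u => W t c + (2 * c * (s0 * a) * u ^+ 1 + (s0 * a) ^+ 2 * u ^+ 2)).
    by apply/funext => u; rewrite /W expr1; ring.
  rewrite (EwD p1 (admissible_cst (W t c)) (admissibleD (admissibleZ _ a1) (admissibleZ _ ax2))).
  rewrite (EwD p1 (admissibleZ _ a1) (admissibleZ _ ax2)) (EwZ _ p1 a1) (EwZ _ p1 ax2) (Ew_cst (W t c) p1).
  rewrite (Ew_odd p1 a1); last by move=> u; rewrite !expr1.
  by rewrite /W /B; ring.
have h0 t : 0 <= h t by rewrite /h subr_ge0 le_max lexx orbT.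
have key l c : all (fun a => (0 <= a) && (a ^+ 2 <= 4^-1)) l -> T l <= 1 ->
    Phi (lst l) c + k * h (T l) * (1 - W (T l) c / M ^+ 2) <= NG (T l) c.
  elim: l c => [c _ _|a l ih c /= /andP[/andP[a0 a4] gl]].
    have -> : h (T [::]) = 0 by rewrite /h /T big_nil max_r ?subrr//; lra.
    rewrite mulr0 mul0r addr0; exact: (@Phi_le_gauss_mean [::]).
  rewrite TS => T1; have Tl := T0 l; have a20 := sqr_ge0 a.
  have Tl1 : T l <= 1 by lra.
  rewrite NG_step//.
  have st : Ew p (fun u => Phi (lst l) (c + s0 * a * u)) + k * h (T l) * (1 - W (T l + a ^+ 2) c / M ^+ 2)
      <= Ew p (fun u => NG (T l) (c + s0 * a * u)).
    have aP : admissible (fun u => Phi (lst l) (c + s0 * a * u)).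
      exact/lip_admissible/(lip_comp_affine _ _ (lip_Phi (glst l))).
    have -> : k * h (T l) * (1 - W (T l + a ^+ 2) c / M ^+ 2) =
      k * h (T l) + (- (k * h (T l) / M ^+ 2)) * W (T l + a ^+ 2) c by field; rewrite gt_eqF//; lra.
    have az := admissibleZ (- (k * h (T l) / M ^+ 2)) (aW (T l) c (s0 * a)).
    rewrite -EW -(EwZ _ p1 (aW _ _ _)) -[X in _ + (X + _)](Ew_cst _ p1) -(EwD p1 (admissible_cst _) az).
    rewrite -(EwD p1 aP (admissibleD (admissible_cst _) az)).
    apply: Ew_le => //; first by apply: admissibleD => //; apply: admissibleD => //; exact: admissible_cst.
    move=> u; apply: le_trans (ih _ gl Tl1); rewrite lerD2l le_eqVlt; apply/orP; left; apply/eqP.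
    by rewrite /=; field; lra.
  set w := W (T l + a ^+ 2) c in st *.
  suff gn : k * (h (T l + a ^+ 2) - h (T l)) * (1 - w / M ^+ 2) <= Ew 2 (fun v => Dl a (c + Num.sqrt (T l) * v)).
    have split_gain (k' x y z : R) : k' * y * z = k' * x * z + k' * (y - x) * z by ring.
    by rewrite (split_gain k (h (T l))) addrA; exact: lerD st gn.
  have D0 : 0 <= Ew 2 (fun v => Dl a (c + Num.sqrt (T l) * v)) by apply: Ew_ge0 => // v; exact: Dl0.
  have hd : 0 <= h (T l + a ^+ 2) - h (T l) <= a ^+ 2.
    rewrite /h /Num.max; case: ifPn; case: ifPn; rewrite -?leNgt => *; apply/andP; split; lra.
  have /andP[hd0 hd1] := hd.
  have [Ml|Ml] := leP (M ^+ 2) w.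
    apply: le_trans D0; apply: mulr_ge0_le0; first by rewrite mulr_ge0// ltW.
    by rewrite subr_le0 ler_pdivlMr// mul1r.
  have w0 : 0 <= w by rewrite /w /W addr_ge0 ?sqr_ge0// mulr_ge0// addr_ge0.
  have w1 : 1 - w / M ^+ 2 <= 1 by rewrite lerBlDr lerDl divr_ge0// ltW.
  have w2 : 0 <= 1 - w / M ^+ 2 by rewrite subr_ge0 ler_pdivrMr// mul1r ltW.
  apply: (@le_trans _ _ (k * (h (T l + a ^+ 2) - h (T l)))).
    by rewrite ler_piMr// mulr_ge0// ltW.
  have [T4|T4] := leP 4^-1 (T l); last first.
    have -> : h (T l + a ^+ 2) = 0 by rewrite /h max_r ?subrr//; lra.
    by apply: le_trans D0; rewrite pmulr_rle0// subr_le0.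
  move: a0; rewrite le_eqVlt => /predU1P[az|ap].
    by apply: le_trans D0; rewrite -az expr0n/= addr0 subrr mulr0.
  apply: (@le_trans _ _ (k * a ^+ 2)); first by rewrite ler_pM2l.
  apply: hk => //; first by rewrite -(@ler_pXn2r _ 2) ?nnegrE ?(ltW ap)// expr1n; lra.
  rewrite -(@ler_pXn2r _ 2) ?nnegrE// real_normK ?num_real//; apply: le_trans (ltW Ml).
  by rewrite /w /W lerDl mulr_ge0// addr_ge0.
move=> l gl T1; have := key l 0 gl; rewrite T1; exact.
Qed.

Lemma Phi_scale (l : seq (R * R)) (s c : R) : 0 < s -> laws l ->
  Phi [seq (s * x.1, x.2) | x <- l] (s * c) = s * Phi l c.
Proof.
move=> sp; elim: l c => [c _|[a r] l ih c /= /andP[r1 gl]]; first by rewrite /= normrM gtr0_norm.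
rewrite -(EwZ _ r1); last exact/lip_admissible/(lip_comp_affine _ _ (lip_Phi gl)).
by congr (Ew r _); apply/funext => u; rewrite -ih// mulrDr mulrA.
Qed.

(** Everything is scaled by s0 to compare with the Gaussian mean. If a_1^2 <= 1/4 the constant gain
    is enough, as 1 - a_1 <= 1. Otherwise only the exchange of a_1 against Gaussian others is
    credited: it gains a multiple of 1 - a_1^2, which is at least 1 - a_1. *)
Lemma Phi_axis_max : exists2 k, 0 < k & forall m (a : 'rV[R]_m.+1),
  \sum_i a 0 i ^+ 2 = 1 -> (forall i, 0 <= a 0 i) -> (forall i, a 0 i <= a 0 0) ->
  Phi (iid p a) 0 + k * (1 - a 0 0) <= Ew p (fun u => `|u|).
Proof.
have [k1 k10 h1] := gain_near; have [k2 k20 h2] := Phi_small_gain.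
have N10 : NG 1 0 = m2.
  by rewrite /NG sqrtr1; congr (Ew 2 _); apply/funext => u; rewrite add0r mul1r.
exists (Num.min k1 k2 / s0); first by rewrite divr_gt0// lt_min k10.
move=> m a a1 a0 amax; rewrite -(ler_pM2l s00) s0E -N10 mulrDr.
have kE : s0 * (Num.min k1 k2 / s0 * (1 - a 0 0)) = Num.min k1 k2 * (1 - a 0 0).
  by field; rewrite gt_eqF.
rewrite kE -(Phi_scale _ s00); last exact: laws_iid.
have a01 : a 0 0 ^+ 2 <= 1 by rewrite -a1 (bigD1 0)//= lerDl sumr_ge0// => i _; exact: sqr_ge0.
have a01' : a 0 0 <= 1 by rewrite -(@ler_pXn2r _ 2) ?nnegrE// expr1n.
have da0 : 0 <= 1 - a 0 0 by rewrite subr_ge0.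
pose l := [seq a 0 i | i <- enum 'I_m.+1].
have -> : [seq (s0 * x.1, x.2) | x <- iid p a] = lst l by rewrite /iid /lst /l -!map_comp.
rewrite mulr0; have Tl : T l = 1 by rewrite /T /l big_map big_enum.
have l0 : all (fun a => 0 <= a) l by apply/allP => _ /mapP[i _ ->].
have k1m : Num.min k1 k2 <= k1 by rewrite ge_min lexx.
have k2m : Num.min k1 k2 <= k2 by rewrite ge_min lexx orbT.
have [a4|a4] := leP (a 0 0 ^+ 2) 4^-1.
  apply: le_trans (h2 l _ Tl); last first.
    apply/allP => _ /mapP[i _ ->]; rewrite a0 (le_trans _ a4)//.
    by rewrite lerXn2r ?nnegrE// a0.
  rewrite lerD2l; apply: le_trans k2m; rewrite ler_piMr//; first by rewrite le_min !ltW.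
  by rewrite lerBlDr lerDl.
have lE : l = a 0 0 :: [seq a 0 (lift ord0 i) | i <- enum 'I_m] by rewrite /l enum_ordSl /= -map_comp.
move: l0 Tl; rewrite lE /= => /andP[_ l0]; move: [seq _ | _ <- _] l0 => l' l0; rewrite TS => Tl.
have a2 : 2^-1 <= a 0 0.
  by rewrite -(@ler_pXn2r _ 2) ?nnegrE// (le_trans _ (ltW a4))// le_eqVlt; apply/orP; left; apply/eqP; field.
rewrite -[X in NG X 0]Tl NG_step ?T0 ?a0//.
apply: lerD.
  apply: Ew_le => //; first exact/lip_admissible/(lip_comp_affine _ _ (lip_Phi (glst l'))).
  by move=> u; exact: Phi_le_gauss_mean.
have T'0 := T0 l'; have T'1 : T l' <= 1 by have := sqr_ge0 (a 0 0); lra.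
apply: le_trans (h1 _ _ T'0 T'1 a2 a01').
apply: (@le_trans _ _ (k1 * (1 - a 0 0))); first by rewrite ler_wpM2r.
rewrite ler_pM2l// (_ : T l' = 1 - a 0 0 ^+ 2); last by lra.
by rewrite lerD2l lerN2 expr2 ler_piMr// a0.
Qed.

End lt2.

(** * The two extremal directions and the volume ratios *)

Lemma adiagE (R : realType) n k (j : 'I_n) :
  adiag R n k 0 j = (Num.sqrt k%:R)^-1 * (j < k)%N%:R.
Proof.
rewrite /adiag mxE summxE; congr (_ * _).
rewrite big_mkcond (bigD1 j)//= big1 ?addr0; last first.
  by move=> i ij; case: ifP => // _; rewrite mxE eqxx /= eq_sym (negPf ij).
by rewrite mxE !eqxx; case: ifP.
Qed.

Section unit_vectors.
Context {R : realType} {m : nat}.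
Implicit Type a : 'rV[R]_m.+1.

Let d1 := adiag R m.+1 1.
Let dn := adiag R m.+1 m.+1.

Let d1E (i : 'I_m.+1) : d1 0 i = (i == 0)%:R.
Proof. by rewrite /d1 adiagE sqrtr1 invr1 mul1r ltnS leqn0. Qed.

Let dnE (i : 'I_m.+1) : dn 0 i = (Num.sqrt m.+1%:R)^-1.
Proof. by rewrite /dn adiagE ltn_ord mulr1. Qed.

Lemma dot_sqr a : dot a a = \sum_i a 0 i ^+ 2.
Proof. by apply: eq_bigr => i _; rewrite expr2. Qed.

Lemma dot_axis : dot d1 d1 = 1.
Proof.
rewrite dot_sqr (bigD1 0)//= big1 ?addr0; first by rewrite d1E eqxx expr1n.
by move=> i i0; rewrite d1E (negPf i0) expr0n.
Qed.

Lemma sqr_diag (i : 'I_m.+1) : dn 0 i ^+ 2 = m.+1%:R^-1.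
Proof. by rewrite dnE exprVn sqr_sqrtr. Qed.

Lemma dot_diag : dot dn dn = 1.
Proof. by rewrite dot_sqr; under eq_bigr do rewrite sqr_diag; rewrite sum_inv_card. Qed.

Lemma enorm_sub_axis a : \sum_i a 0 i ^+ 2 = 1 -> enorm (a - d1) ^+ 2 = 2 * (1 - a 0 0).
Proof.
move=> a1; rewrite /enorm sqr_sqrtr dot_sqr; last by rewrite sumr_ge0// => i _; exact: sqr_ge0.
transitivity (\sum_i (a 0 i ^+ 2 - 2 * (a 0 i * d1 0 i) + d1 0 i ^+ 2)).
  by apply: eq_bigr => i _; rewrite !mxE; ring.
rewrite big_split /= sumrB a1 -mulr_sumr -dot_sqr dot_axis.
rewrite (bigD1 0)//= big1 ?addr0; last by move=> i i0; rewrite d1E (negPf i0) mulr0.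
by have -> : d1 0 0 = 1; [rewrite d1E eqxx|ring].
Qed.

Lemma cfs_axis (p t : R) : 1 <= p -> cfs (iid p d1) t = cfsq p (t ^+ 2).
Proof.
move=> p1; rewrite cfs_iid (bigD1 0)//= big1 ?mulr1; first by rewrite d1E eqxx expr1n mulr1.
by move=> i i0; rewrite d1E (negPf i0) expr0n mulr0 /cfsq sqrtr0 cf0.
Qed.

Lemma Phi_axis (p : R) : 1 <= p -> Phi (iid p d1) 0 = Ew p (fun u => `|u|).
Proof.
move=> p1; have K := K0_gt0 R.
have -> : Ew p (fun u => `|u|) = Phi [:: (1, p)] 0.
  by congr (Ew p _); apply/funext => u; rewrite /= add0r mul1r.
have g : laws [:: (1, p)] by rewrite /= p1.
have : (K0 R * Phi (iid p d1) 0)%:E = (K0 R * Phi [:: (1, p)] 0)%:E.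
  rewrite -!Phi0_rep ?laws_iid//; apply: eq_integral => t _; congr ((1 - _) * _)%:E.
  rewrite cfs_axis// /cfs big_seq1 mulr1 /cfsq sqrtr_sqr.
  by case: (ger0P t) => // _; rewrite cfN.
by move=> [] /mulfI; apply; rewrite gt_eqF.
Qed.

Lemma Phi_iid_gt0 (p : R) a : 1 <= p -> a 0 0 != 0 -> 0 < Phi (iid p a) 0.
Proof.
by move=> p1 a0; have := laws_iid a p1; rewrite iidS => g; apply: Phi_cons_gt0.
Qed.

Lemma axis_neq0 : d1 0 0 != 0. Proof. by rewrite d1E eqxx oner_eq0. Qed.

Lemma diag_neq0 : dn 0 0 != 0. Proof. by rewrite dnE invr_eq0 sqrtr_eq0 -ltNge ltr0n. Qed.

Lemma sum_axis : \sum_i d1 0 i = 1.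
Proof.
rewrite (bigD1 0)//= big1 ?addr0 ?d1E ?eqxx//.
by move=> i i0; rewrite d1E (negPf i0).
Qed.

Lemma sum_diag : \sum_i dn 0 i = Num.sqrt m.+1%:R.
Proof.
have s0 : 0 < Num.sqrt (m.+1%:R : R) by rewrite sqrtr_gt0.
have e := sqr_sqrtr (ler0n R m.+1).
under eq_bigr do rewrite dnE.
rewrite sumr_const card_ord -[_^-1 *+ _]mulr_natl.
by rewrite -[X in X * _]e expr2 mulfK// gt_eqF.
Qed.

Lemma axis_ge0 i : 0 <= d1 0 i. Proof. by rewrite d1E ler0n. Qed.

Lemma diag_ge0 i : 0 <= dn 0 i. Proof. by rewrite dnE invr_ge0 sqrtr_ge0. Qed.

End unit_vectors.

Section ratios.
Context {R : realType} {m : nat} (a : 'rV[R]_m.+1).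
Hypothesis a1 : \sum_i a 0 i ^+ 2 = 1.
Hypothesis amon : forall i j : 'I_m.+1, (i <= j)%N -> a 0 j <= a 0 i.
Hypothesis a0 : forall i, 0 <= a 0 i.

Let am i : a 0 i <= a 0 0. Proof. exact: amon. Qed.

Let aa : dot a a = 1. Proof. by rewrite dot_sqr. Qed.

Let head_gt0 : 0 < a 0 0.
Proof.
rewrite lt_neqAle a0 andbT eq_sym; apply/eqP => z; have := a1.
rewrite big1 => [/esym/eqP|i _]; first by rewrite oner_eq0.
have -> : a 0 i = 0 by apply/eqP; rewrite eq_le a0 -z am.
by rewrite expr0n.
Qed.

Let head_le1 : a 0 0 <= 1.
Proof.
rewrite -(@ler_pXn2r _ 2) ?nnegrE// expr1n -a1 (bigD1 0)//= lerDl sumr_ge0// => i _.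
exact: sqr_ge0.
Qed.

Let ratio_infty (x y : R) : 0 < y ->
  ((2 ^+ m * x)%:E / (2 ^+ m * y)%:E)%E = (x / y)%:E.
Proof.
move=> y0; have P2 : 2 ^+ m != 0 :> R by rewrite gt_eqF.
have yn : y != 0 by rewrite gt_eqF.
rewrite inver mulf_eq0 (negPf P2) (negPf yn) /= -EFinM; congr EFin.
by field; rewrite P2 yn.
Qed.

(** With x = a_1 the largest coordinate, x times the sum of the a_i is at least the sum of the
    a_i^2, that is 1, while |a - a_(1)|^2 = 2 (1 - x). *)
Lemma ratio_axis_infty :
  ((1 + 4^-1 * enorm (a - adiag R m.+1 1) ^+ 2)%:E <=
   projvol +oo a / projvol +oo (adiag R m.+1 1))%E.
Proof.
rewrite (projvol_infty aa a0) (projvol_infty dot_axis axis_ge0) sum_axis ratio_infty//.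
rewrite divr1 lee_fin enorm_sub_axis//.
have : 1 <= a 0 0 * \sum_i a 0 i.
  by rewrite -a1 mulr_sumr; apply: ler_sum => i _; rewrite expr2 ler_wpM2r.
move: (\sum_i a 0 i) (a 0 0) head_gt0 head_le1 => s x x0 x1 xs.
have : (1 + 4^-1 * (2 * (1 - x))) * x <= s * x.
  by apply: (@le_trans _ _ 1); [nra|rewrite mulrC].
by rewrite ler_pM2r.
Qed.

(** With u the sum of the a_i divided by sqrt n, the double sum is 2n (1 - u^2), and the claim with
    constant 1/4 reads (1 - u)^2 >= 0. *)
Lemma ratio_diag_infty :
  (projvol +oo a / projvol +oo (adiag R m.+1 m.+1) <=
   (1 - 4^-1 / m.+1%:R * \sum_(i < m.+1) \sum_(j < m.+1) (a 0 i - a 0 j) ^+ 2)%:E)%E.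
Proof.
have s0 : 0 < Num.sqrt (m.+1%:R : R) by rewrite sqrtr_gt0.
rewrite (projvol_infty aa a0) (projvol_infty dot_diag diag_ge0) sum_diag ratio_infty//.
rewrite lee_fin sum_sqr_diff a1.
move: (\sum_i a 0 i) (sqr_sqrtr (ler0n R m.+1)) => s.
move: (Num.sqrt m.+1%:R) s0 => w w0 <-.
rewrite -subr_ge0 (_ : _ - _ = (1 - s / w) ^+ 2 / 2); first by rewrite divr_ge0// sqr_ge0.
by field; rewrite gt_eqF.
Qed.

Lemma ratio_axis_lt2 (p k : R) : 1 <= p ->
  Phi (iid p a) 0 + k * (1 - a 0 0) <= Ew p (fun u => `|u|) ->
  (projvol p%:E a / projvol p%:E (adiag R m.+1 1) <=
   (1 - k / (2 * Ew p (fun u => `|u|)) * enorm (a - adiag R m.+1 1) ^+ 2)%:E)%E.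
Proof.
move=> p1 h; have Y0 := Ew_norm_gt0 p1; have D0 := Phi_iid_gt0 p1 (@axis_neq0 R m).
rewrite (projvol_ratio p1 aa dot_axis D0) lee_fin enorm_sub_axis// Phi_axis//.
rewrite ler_pdivrMr// mulrBl mul1r lerBrDr; apply: le_trans h.
by rewrite lerD2l le_eqVlt; apply/orP; left; apply/eqP; field; rewrite gt_eqF.
Qed.

(** As a_1 is the largest coordinate, the sum of a_i^2 (1 - a_i^2) is at least 1 - a_1^2, hence at
    least 1 - a_1, which is half of |a - a_(1)|^2. The bound M on the denominator makes the additive
    gain relative. *)
Lemma ratio_axis_gt2 (p k M C : R) : 1 <= p -> 0 < k -> 0 < M -> 0 < C -> C <= k / (2 * M) ->
  Phi (iid p (adiag R m.+1 1)) 0 <= M ->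
  Phi (iid p (adiag R m.+1 1)) 0 + k * \sum_i a 0 i ^+ 2 * (1 - a 0 i ^+ 2) <= Phi (iid p a) 0 ->
  ((1 + C * enorm (a - adiag R m.+1 1) ^+ 2)%:E <=
   projvol p%:E a / projvol p%:E (adiag R m.+1 1))%E.
Proof.
move=> p1 k0 M0 C0 CM DM; have D0 := Phi_iid_gt0 p1 (@axis_neq0 R m).
rewrite (projvol_ratio p1 aa dot_axis D0) lee_fin enorm_sub_axis//.
set S := \sum_i _ => hS.
have S1 : 1 - a 0 0 <= S.
  apply: (@le_trans _ _ (1 - a 0 0 ^+ 2)); first by rewrite lerD2l lerN2 expr2 ler_piMr.
  rewrite -[leLHS]mul1r -a1 mulr_suml; apply: ler_sum => i _.
  by rewrite ler_wpM2l ?sqr_ge0// a1 lerD2l lerN2 lerXn2r ?nnegrE.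
rewrite ler_pdivlMr//; apply: le_trans hS; rewrite mulrDl mul1r lerD2l.
have d0 : 0 <= 1 - a 0 0 by rewrite subr_ge0.
apply: (@le_trans _ _ (k / (2 * M) * (2 * (1 - a 0 0)) * M)).
  apply: ler_pM => //; rewrite ?(ltW D0)//.
    by rewrite mulr_ge0 ?(ltW C0)// mulr_ge0.
  by rewrite ler_wpM2r// mulr_ge0.
rewrite (_ : _ * M = k * (1 - a 0 0)); last by field; rewrite gt_eqF.
by rewrite ler_pM2l.
Qed.

Lemma ratio_diag_gt2 (p k M C : R) : 1 <= p -> 0 < M -> 0 < C -> C <= k / M ->
  Phi (iid p (adiag R m.+1 m.+1)) 0 <= M ->
  Phi (iid p a) 0 + k * \sum_i (a 0 i ^+ 2 - m.+1%:R^-1) ^+ 2 <=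
    Phi (iid p (adiag R m.+1 m.+1)) 0 ->
  (projvol p%:E a / projvol p%:E (adiag R m.+1 m.+1) <=
   (1 - C * \sum_(i < m.+1) (a 0 i ^+ 2 - m.+1%:R^-1) ^+ 2)%:E)%E.
Proof.
move=> p1 M0 C0 CM DM; have D0 := Phi_iid_gt0 p1 (@diag_neq0 R m).
rewrite (projvol_ratio p1 aa dot_diag D0) lee_fin.
set S := \sum_i _ => hS.
have S0 : 0 <= S by rewrite sumr_ge0// => i _; exact: sqr_ge0.
rewrite ler_pdivrMr// mulrBl mul1r lerBrDr; apply: le_trans hS; rewrite lerD2l.
apply: (@le_trans _ _ (k / M * S * M)).
  apply: ler_pM => //; rewrite ?(ltW D0)//; first by rewrite mulr_ge0 ?(ltW C0).
  by rewrite ler_wpM2r.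
by rewrite (_ : _ * M = k * S)//; field; rewrite gt_eqF.
Qed.

End ratios.

Theorem theorem1 (R : realType) (p : \bar R) (hp1 : (1 <= p)%E) (hp2 : p <> 2%:E) :
  exists c : R, 0 < c /\
  forall (n : nat) (a : 'rV[R]_n),
    (1 <= n)%N ->
    \sum_(i < n) a 0 i ^+ 2 = 1 ->
    (forall i j : 'I_n, (i <= j)%N -> a 0 j <= a 0 i) ->
    (forall i : 'I_n, 0 <= a 0 i) ->
  [/\ (2%:E < p)%E ->
         ((1 + c * enorm (a - adiag R n 1) ^+ 2)%:E <=
          projvol p a / projvol p (adiag R n 1))%E,
      p = +oo%E ->
         (projvol +oo a / projvol +oo (adiag R n n) <=
          (1 - c / n%:R * \sum_(i < n) \sum_(j < n) (a 0 i - a 0 j) ^+ 2)%:E)%E,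
      (2%:E < p)%E /\ (p < +oo)%E ->
         (projvol p a / projvol p (adiag R n n) <=
          (1 - c * \sum_(i < n) (a 0 i ^+ 2 - n%:R^-1) ^+ 2)%:E)%E &
      (p < 2%:E)%E ->
         (projvol p a / projvol p (adiag R n 1) <=
          (1 - c * enorm (a - adiag R n 1) ^+ 2)%:E)%E].
Proof.
case: p hp1 hp2 => [p| |]//; last first.
  move=> _ _; exists 4^-1; split => // -[//|m] a _ a1 amon a0.
  split => // [_|_|[]//]; [exact: ratio_axis_infty|exact: ratio_diag_infty].
rewrite lee_fin => p1 p2'; have {p2'} : p != 2 by apply/eqP => e; apply: p2'; rewrite e.
rewrite neq_lt => /orP[p2|p2].
  have [k k0 hk] := Phi_axis_max p1 p2.
  exists (k / (2 * Ew p (fun u => `|u|))); split.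
    by rewrite divr_gt0// mulr_gt0// Ew_norm_gt0.
  move=> -[//|m] a _ a1 amon a0; split => //.
  - by rewrite lte_fin => /lt_trans/(_ p2); rewrite ltxx.
  - by case; rewrite lte_fin => /lt_trans/(_ p2); rewrite ltxx.
  by move=> _; apply: ratio_axis_lt2 => //; apply: hk => // i; exact: amon.
have [M M0 hM] := Phi_iid_bounded p2.
have [c1 c10 h1] := Phi_axis_gain p2; have [c2 c20 h2] := Phi_flat_gain p2.
(* One constant has to serve both comparisons; the factor 2 in the first comes from |a - a_(1)|^2 =
   2 (1 - a_1). *)
have C0 : 0 < Num.min (c1 / (2 * M)) (c2 / M) by rewrite lt_min !divr_gt0// mulr_gt0.
exists (Num.min (c1 / (2 * M)) (c2 / M)); split => //.
have C1 : Num.min (c1 / (2 * M)) (c2 / M) <= c1 / (2 * M) by rewrite ge_min lexx.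
have C2 : Num.min (c1 / (2 * M)) (c2 / M) <= c2 / M by rewrite ge_min lexx orbT.
move: (Num.min _ _) C0 C1 C2 => C C0 C1 C2 -[//|m] a _ a1 amon a0.
split => //.
- move=> _; apply: (ratio_axis_gt2 a1 amon a0 p1 c10 M0 C0 C1).
    by apply: hM; rewrite -dot_sqr dot_axis.
  by apply: h1 => // t; exact: cfs_axis.
- move=> _; apply: (ratio_diag_gt2 a1 p1 M0 C0 C2).
    by apply: hM; rewrite -dot_sqr dot_diag.
  by apply: h2 => // i; exact: sqr_diag.
by rewrite lte_fin => /lt_trans/(_ p2); rewrite ltxx.
Qed.
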